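(* There exists an algorithm that, given any c-connected clustered graph $C(G,T)$ whose underlying graph $G$ is planar and has $n$ vertices, computes a $\langle 0,\beta,0\rangle$-drawing of $C(G,T)$ with $\beta\in O(n^2)$. If $C(G,T)$ is moreover flat, the computed drawing has $\beta\in O(n)$.
   Context: A clustered graph $C(G,T)$ consists of a graph $G$ and a rooted tree $T$ whose leaves are exactly the vertices of $G$; each internal node $\mu$ of $T$ is a cluster, identified with the set of leaves of its subtree. $C(G,T)$ is c-connected if for every cluster $\mu$ the subgraph of $G$ induced by the vertices of $\mu$ is connected; it is flat if no cluster other than the root contains another cluster. A drawing of $C(G,T)$ maps vertices to distinct points, edges to open curves between their endpoints, and each cluster $\mu$ to a simple closed region $R(\mu)$ containing all and only the vertices of $\mu$, with $R(\nu)\supseteq R(\mu)$ whenever $\mu$ is a descendant of $\nu$. Intersections among curves are isolated points, no three curves meet at a point, and two curves alternate around each intersection point. Edge-edge crossings are crossings between two edges; an edge crossing the boundary of $R(\mu)$ exactly $k$ times contributes $\lfloor k/2\rfloor$ edge-region crossings; for clusters $\mu,\nu$ neither an ancestor of the other, the number of region-region crossings is the number of connected components of $R(\mu)\setminus R(\nu)$ minus one. An $\langle\alpha,\beta,\gamma\rangle$-drawing has exactly $\alpha$ edge-edge, $\beta$ edge-region and $\gamma$ region-region crossings. $n$ is the number of vertices of $G$.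
   Formalization: Distinct internal nodes of T are assumed to have distinct vertex sets; if T could repeat one cluster arbitrarily often, β could not be bounded in terms of n (take K5 minus an edge with many nested copies of the separating triangle). *)

(* Defs.v *)
From HB Require Import structures.
From mathcomp Require Import all_boot all_order all_algebra.
From mathcomp Require Import all_classical all_reals all_analysis.

Set Implicit Arguments.
Unset Strict Implicit.
Unset Printing Implicit Defensive.

Import Order.TTheory GRing.Theory Num.Theory.
Import numFieldNormedType.Exports.

Local Open Scope classical_set_scope.
Local Open Scope ring_scope.

Inductive murec : Type :=
| MZero
| MSucc
| MProj of nat
| MComp of murec & seq murec
| MPrim of murec & murec
| MMin of murec.

(* [computes c s y]: on arguments [s] the program [c] halts with value [y];
   missing arguments are read as 0. [MPrim] recurses on the first argument, and
   its step program receives the counter, the previous value and the parameters.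
   [MMin] searches for the least first argument on which its body returns 0. *)
Fixpoint computes (c : murec) (s : seq nat) (y : nat) {struct c} : Prop :=
  match c with
  | MZero => y = 0%N
  | MSucc => y = (head 0%N s).+1
  | MProj i => y = nth 0%N s i
  | MComp f gs =>
      exists2 ys : seq nat,
        (fix computes_all (gs : seq murec) (ys : seq nat) : Prop :=
           match gs, ys with
           | [::], [::] => True
           | g :: gs', z :: ys' => computes g s z /\ computes_all gs' ys'
           | _, _ => False
           end) gs ys
        & computes f ys y
  | MPrim f g =>
      exists h : nat -> nat,
        [/\ computes f (behead s) (h 0%N),
            forall i, (i < head 0%N s)%N ->
              computes g [:: i, h i & behead s] (h i.+1)
          & y = h (head 0%N s)]
  | MMin f =>
      computes f (y :: s) 0%N /\
      forall i, (i < y)%N -> exists k, computes f (i :: s) k.+1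
  end.

Section ClusterTree.
Variables (n m : nat) (parent : 'I_n + 'I_m -> option 'I_m).

Definition tree_up : rel ('I_n + 'I_m) :=
  fun x y => if y is inr k then parent x == Some k else false.

(* reflexive: every internal node is its own ancestor *)
Definition ancestor (k : 'I_m) (x : 'I_n + 'I_m) : bool :=
  connect tree_up x (inr k).

Definition leaves_below (k : 'I_m) : {set 'I_n} :=
  [set v | ancestor k (inl v)].

Definition rooted_tree : Prop :=
  exists2 r, parent r = None & forall x, connect tree_up x r.

End ClusterTree.

(* G is a finite simple graph on 'I_n; the nodes of T are 'I_n + 'I_m, the left
   summand being the leaves (the vertices of G) and the right one the internal
   nodes (the clusters); [parent] is [None] exactly at the root. By
   [cgraph_internal] the right summand contains no leaf. Clusters are identified
   with their vertex sets, so distinct internal nodes have distinct vertex sets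
   ([cgraph_inj]); with arbitrarily many copies of one cluster, no bound on the
   number of edge-region crossings in terms of n alone could hold. *)
Record cgraph (n m : nat) := CGraph {
  adj : rel 'I_n;
  parent : 'I_n + 'I_m -> option 'I_m;
  cgraph_sym : symmetric adj;
  cgraph_irr : irreflexive adj;
  cgraph_tree : rooted_tree parent;
  cgraph_internal : forall k : 'I_m, exists x, parent x = Some k;
  cgraph_inj : injective (leaves_below parent)
}.

Definition vcluster n m (C : cgraph n m) (k : 'I_m) : {set 'I_n} :=
  leaves_below (parent C) k.

Definition c_connected n m (C : cgraph n m) : Prop :=
  forall k, {in vcluster C k &, forall u v,
    connect [rel x y | [&& adj C x y, x \in vcluster C k & y \in vcluster C k]]
      u v}.

Definition flat n m (C : cgraph n m) : Prop :=
  forall k l, parent C (inr k) <> None -> vcluster C l \subset vcluster C k ->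
    l = k.

(* each undirected edge is listed once, from its smaller to its larger end *)
Definition edges n (e : rel 'I_n) : {set 'I_n * 'I_n} :=
  [set p : 'I_n * 'I_n | (p.1 < p.2)%N && e p.1 p.2].

(* what a program is given: n, m, the adjacency matrix of G and the parents of
   the leaves and of the internal nodes of T *)
Definition cgraph_code n m (C : cgraph n m) : seq nat :=
  [:: n; m;
      pickle [seq [seq adj C u v | v <- enum 'I_n] | u <- enum 'I_n];
      pickle [seq parent C (inl v) | v <- enum 'I_n];
      pickle [seq parent C (inr k) | k <- enum 'I_m]].

Section Plane.
Variable R : realType.
Implicit Types (p q : R * R) (A B J : set (R * R)).

Definition open_curve p q A : Prop :=
  exists g : R -> R * R,
    [/\ {within `[0, 1], continuous g}, {in `[0, 1] &, injective g},
        g 0 = p, g 1 = q & A = g @` `]0, 1[].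

Definition simple_closed_curve J : Prop :=
  exists g : R -> R * R,
    [/\ {within `[0, 1], continuous g}, {in `[0, 1[ &, injective g},
        g 0 = g 1 & J = g @` `[0, 1]].

(* the closed region bounded by the simple closed curve J *)
Definition enclosed J : set (R * R) :=
  J `|` [set p | ~ J p /\ bounded_set (connected_component (~` J) p)].

(* A and B alternate around p: some homeomorphism h from the square
   [-1, 1]^2 onto a neighbourhood of p carries the two coordinate axes to A and
   B, so that the four branches leaving p belong to A, B, A, B in cyclic
   order. *)
Definition alternate A B p : Prop :=
  exists h : R * R -> R * R,
    let Q := [set z : R * R | `|z| <= 1] in
    [/\ {within Q, continuous h} /\ {in Q &, injective h},
        h 0 = p,
        nbhs p (h @` Q),
        A `&` h @` Q = h @` [set z | Q z /\ z.2 = 0]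
      & B `&` h @` Q = h @` [set z | Q z /\ z.1 = 0]].

Definition components A : set (set (R * R)) := connected_component A @` A.

Record graph_drawing n (e : rel 'I_n) (pt : 'I_n -> R * R)
    (curve : 'I_n * 'I_n -> set (R * R)) : Prop := GraphDrawing {
  gd_inj : injective pt;
  gd_curve : forall a, a \in edges e -> open_curve (pt a.1) (pt a.2) (curve a);
  gd_vertex : forall a v, a \in edges e -> ~ curve a (pt v)
}.

Definition planar n (e : rel 'I_n) : Prop :=
  exists pt curve, graph_drawing e pt curve /\
    {in edges e &, forall a b, a != b -> curve a `&` curve b = set0}.

Record drawing (n m : nat) := Drawing {
  dpoint : 'I_n -> R * R;
  dcurve : 'I_n * 'I_n -> set (R * R);
  dborder : 'I_m -> set (R * R)
}.

Definition region n m (D : drawing n m) (k : 'I_m) : set (R * R) :=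
  enclosed (dborder D k).

Definition curves n m (D : drawing n m) (i : 'I_n * 'I_n + 'I_m) :
    set (R * R) :=
  match i with inl a => dcurve D a | inr k => dborder D k end.

Definition is_curve n m (C : cgraph n m) (i : 'I_n * 'I_n + 'I_m) : Prop :=
  if i is inl a then a \in edges (adj C) else True.

Record is_drawing n m (C : cgraph n m) (D : drawing n m) : Prop := IsDrawing {
  dr_graph : graph_drawing (adj C) (dpoint D) (dcurve D);
  dr_border : forall k, simple_closed_curve (dborder D k);
  dr_cluster : forall k v, region D k (dpoint D v) <-> v \in vcluster C k;
  dr_border_vertex : forall k v, ~ dborder D k (dpoint D v);
  dr_nested : forall k l, ancestor (parent C) k (inr l) ->
    region D l `<=` region D k;
  dr_isolated : forall i j, is_curve C i -> is_curve C j -> i <> j ->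
    curves D i `&` curves D j `<=` isolated (curves D i `&` curves D j);
  dr_alternate : forall i j, is_curve C i -> is_curve C j -> i <> j ->
    curves D i `&` curves D j `<=` alternate (curves D i) (curves D j);
  dr_no_three : forall i j l, is_curve C i -> is_curve C j -> is_curve C l ->
    i <> j -> i <> l -> j <> l ->
    curves D i `&` curves D j `&` curves D l = set0
}.

Local Open Scope card_scope.

(* no point lies on three curves, so counting crossings between two edges is
   counting the points common to two edges *)
Definition edge_edge_crossings n m (C : cgraph n m) (D : drawing n m)
    (alpha : nat) : Prop :=
  [set p | exists a b, [/\ a \in edges (adj C), b \in edges (adj C), a <> b,
                           dcurve D a p & dcurve D b p]] #= `I_alpha.

Definition edge_region_crossings n m (C : cgraph n m) (D : drawing n m)
    (beta : nat) : Prop :=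
  exists2 x : 'I_n * 'I_n -> 'I_m -> nat,
    forall a k, a \in edges (adj C) -> dcurve D a `&` dborder D k #= `I_(x a k)
    & beta = (\sum_(a in edges (adj C)) \sum_(k < m) (x a k)./2)%N.

(* each unordered pair of incomparable clusters is counted once; the number of
   components is the same for R(k) \ R(l) and R(l) \ R(k) *)
Definition region_region_crossings n m (C : cgraph n m) (D : drawing n m)
    (gamma : nat) : Prop :=
  let incomparable k l :=
    ~~ ancestor (parent C) k (inr l) && ~~ ancestor (parent C) l (inr k) in
  exists2 x : 'I_m -> 'I_m -> nat,
    forall k l, incomparable k l ->
      components (region D k `\` region D l) #= `I_(x k l)
    & gamma =
      (\sum_(k < m) \sum_(l < m | (k < l)%N && incomparable k l) (x k l).-1)%N.

Definition abc_drawing n m (C : cgraph n m) (alpha beta gamma : nat)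
    (D : drawing n m) : Prop :=
  [/\ is_drawing C D, edge_edge_crossings C D alpha,
      edge_region_crossings C D beta & region_region_crossings C D gamma].

Definition segment p q : set (R * R) :=
  [set (1 - t) *: p + t *: q | t in `[0, 1]%classic].

Fixpoint polyline p (s : seq (R * R)) : set (R * R) :=
  if s is q :: s' then segment p q `|` polyline q s' else set0.

Definition polygon (s : seq (R * R)) : set (R * R) :=
  if s is p :: s' then polyline p (rcons s' p) else set0.

Definition rat_point (p : rat * rat) : R * R := (ratr p.1, ratr p.2).

End Plane.

Record polydrawing (n m : nat) := PolyDrawing {
  positions : 'I_n -> rat * rat;
  bends : 'I_n -> 'I_n -> seq (rat * rat);
  corners : 'I_m -> seq (rat * rat)
}.

(* what a program returns; the entry (u, v) of the table of bends is relevant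
   only for edges with u < v *)
Definition polydrawing_code n m (P : polydrawing n m) : nat :=
  pickle ([seq positions P v | v <- enum 'I_n],
          [seq [seq bends P u v | v <- enum 'I_n] | u <- enum 'I_n],
          [seq corners P k | k <- enum 'I_m]).

Definition realize (R : realType) n m (P : polydrawing n m) : drawing R n m :=
  let pt v := rat_point R (positions P v) in
  Drawing pt
    (fun a => polyline (pt a.1)
                (rcons (map (rat_point R) (bends P a.1 a.2)) (pt a.2))
              `\` [set pt a.1; pt a.2])
    (fun k => polygon (map (rat_point R) (corners P k))).

(* Main.v *)
Require Import Defs.
From mathcomp Require Import all_boot all_order all_algebra.
From mathcomp Require Import all_classical all_reals all_analysis.

(* A planar drawing is refined to a drawing on a fine grid, and walking around a
   spanning tree of G adapted to the clusters (each cluster induces a subtree,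
   by c-connectedness) lists the vertices so that each subtree occupies an
   interval of columns and the remaining edges become noncrossing chords over
   the columns. Only this combinatorial layout has to be found by the program,
   which it does by unbounded search; the drawing is then given by explicit
   formulas. The tree is drawn upwards by depth, the chords leave their ends
   upwards and run above everything else, and the region of a cluster is the
   part below a piecewise linear function that is just above its subtree. A tree
   edge then meets each boundary at most once, and a chord crosses the boundary
   of a cluster once for each of its ends in the cluster. There are O(n) chords,
   since the columns form O(n) blocks with the same covering vertices, and a
   vertex lies in at most n + 1 clusters, or in at most 2 if C is flat. *)


(** The search may stop at any layout, not at one that comes from a planar drawing. Hence the two
    halves of the proof meet only in the bounded formula [layout]: planarity shows that some layout
    exists, and every layout has to give a correct drawing with few crossings. The topology of the
    plane is made elementary on both sides: chords of the tour do not cross by a parity argument on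
    closed lattice walks, and the inside of a region, lying below the graph of a function, is found
    with vertical rays. The geometry rests on one proportion. A level is higher than all columns
    together are wide, so an edge rises from a vertex with inverse slope in [0, 1]; less than
    [2 * unit_] below the next level it is within [2 * unit_] of its column, where every boundary is
    flat. Each crossing is then one of a horizontal line with a straight segment, which makes
    counting and alternation easy. The sizes of the clusters, less than [unit_], serve as offsets
    that separate the boundaries of nested clusters without disturbing this picture. *)

(** * Closure properties of the functions computed by [murec] programs *)

Module MuRecursive.
From mathcomp Require Import all_boot all_order all_algebra.
From mathcomp Require Import zify.

Set Implicit Arguments.
Unset Strict Implicit.
Unset Printing Implicit Defensive.

(** The length is fixed because a program forwards a fixed number of projections. Functions are
    written below with [head 0 (iter j behead s)] for variable number [j], so that entering a binder
    means consing one entry in front of [s]. *)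
Definition mu (k : nat) (F : seq nat -> nat) : Prop :=
  exists c, forall s, size s = k -> computes c s (F s).

Lemma computes_comp c cs s ys y :
  size cs = size ys ->
  (forall i, i < size cs -> computes (nth MZero cs i) s (nth 0 ys i)) ->
  computes c ys y -> computes (MComp c cs) s y.
Proof.
move=> sz Hi Hc; exists ys => // {Hc}.
elim: cs ys sz Hi => [|g gs IH] [|z ys] //= [sz] Hi; split; first exact: (Hi 0).
by apply: IH => // i ltig; apply: (Hi i.+1).
Qed.

Lemma computes_prim c d s h :
  computes c (behead s) (h 0) ->
  (forall i, i < head 0 s -> computes d [:: i, h i & behead s] (h i.+1)) ->
  computes (MPrim c d) s (h (head 0 s)).
Proof. by exists h. Qed.

Lemma mu_ext k F G : F =1 G -> mu k F -> mu k G.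
Proof. by move=> eFG [c Hc]; exists c => s sz; rewrite -eFG; apply: Hc. Qed.

Lemma mu_nth k i : mu k (fun s => nth 0 s i).
Proof. by exists (MProj i). Qed.

Lemma mu_var k j : mu k (fun s => head 0 (iter j behead s)).
Proof.
apply: mu_ext (mu_nth k j) => s; rewrite -nth0; elim: j s => // j IH s.
by rewrite iterSr -IH nth_behead.
Qed.

Lemma mu_const k n : mu k (fun=> n).
Proof.
elim: n => [|n [c Hc]]; first by exists MZero.
exists (MComp MSucc [:: c]) => s sz.
by apply: (@computes_comp _ _ _ [:: n]) => //= -[|i] //= _; apply: Hc.
Qed.

Lemma mu_app1 k (F : nat -> nat) g :
  mu 1 (fun s => F (head 0 s)) -> mu k g -> mu k (fun s => F (g s)).
Proof.
move=> [c Hc] [d Hd]; exists (MComp c [:: d]) => s sz.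
apply: (@computes_comp _ _ _ [:: g s]) => //= [[|i] //= _|]; first exact: Hd.
exact: (Hc [:: g s]).
Qed.

Lemma mu_app2 k (F : nat -> nat -> nat) g h :
  mu 2 (fun s => F (head 0 s) (head 0 (behead s))) -> mu k g -> mu k h ->
  mu k (fun s => F (g s) (h s)).
Proof.
move=> [c Hc] [d Hd] [e He]; exists (MComp c [:: d; e]) => s sz.
apply: (@computes_comp _ _ _ [:: g s; h s]) => //=.
  by case=> [|[|i]] //= _; [apply: Hd | apply: He].
exact: (Hc [:: g s; h s]).
Qed.

(** Needed under binders: a body [F] expects its bound variable directly in front of the parameters,
    whereas [MPrim] passes the counter and the accumulated value. Here [j] entries are discarded and
    the variable [h s] takes their place. *)
Lemma mu_cons k j F h :
  mu k.+1 F -> mu (j + k) h -> mu (j + k) (fun s => F (h s :: drop j s)).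
Proof.
move=> [c Hc] [d Hd].
exists (MComp c (d :: mkseq (fun i => MProj (j + i)) k)) => s sz.
have szd : size (drop j s) = k by rewrite size_drop sz addKn.
apply: (@computes_comp _ _ _ (h s :: drop j s)); rewrite /= ?size_mkseq ?szd //.
  case=> [_|i]; first exact: Hd.
  by rewrite ltnS => ltik /=; rewrite nth_mkseq //= nth_drop.
by apply: Hc; rewrite /= szd.
Qed.

Lemma mu_weak k F j : mu k F -> mu (j + k) (fun s => F (drop j s)).
Proof.
move=> [c Hc]; exists (MComp c (mkseq (fun i => MProj (j + i)) k)) => s sz.
apply: (@computes_comp _ _ _ (drop j s)); rewrite ?size_mkseq ?size_drop ?sz ?addKn //.
  by move=> i ltik; rewrite nth_mkseq //= nth_drop.
by apply: Hc; rewrite size_drop sz addKn.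
Qed.

Lemma mu_iteri k a (g : nat -> nat -> seq nat -> nat) nn :
  mu k a ->
  mu k.+2 (fun s => g (head 0 s) (head 0 (behead s)) (behead (behead s))) ->
  mu k nn -> mu k (fun s => iteri (nn s) (fun i h => g i h s) (a s)).
Proof.
move=> [ca Ha] [cg Hg] [cn Hn].
(* [MPrim] recurses on its first argument, so the bound is computed beforehand and consed to a copy
   of all arguments. *)
exists (MComp (MPrim ca cg) (cn :: mkseq MProj k)) => s sz.
have sE : mkseq (nth 0 s) k = s by rewrite -sz mkseq_nth.
apply: (@computes_comp _ _ _ (nn s :: s)) => /=; first by rewrite size_mkseq sz.
  case=> [_|i] /=; first exact: Hn.
  by rewrite size_mkseq ltnS => ltik; rewrite nth_mkseq.
apply: (@computes_prim _ _ (nn s :: s)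
         (fun j => iteri j (fun i h => g i h s) (a s))) => /=; first exact: Ha.
by move=> i _; apply: (Hg [:: i, _ & s]); rewrite /= sz.
Qed.

Lemma mu_succ k g : mu k g -> mu k (fun s => (g s).+1).
Proof. by apply: (mu_app1 (F := S)); exists MSucc. Qed.

Ltac muvar :=
  first [ exact: (mu_var _ 0) | exact: (mu_var _ 1) | exact: (mu_var _ 2)
        | exact: (mu_var _ 3) | exact: (mu_var _ 4) | exact: (mu_var _ 5)
        | exact: (mu_var _ 6) | exact: (mu_var _ 7) | exact: (mu_var _ 8)
        | exact: (mu_var _ 9) | exact: (mu_var _ 10) | exact: (mu_var _ 11)
        | exact: (mu_var _ 12) | exact: (mu_var _ 13) | exact: (mu_var _ 14) ].

Lemma mu_add k g h : mu k g -> mu k h -> mu k (fun s => g s + h s).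
Proof.
apply: mu_app2.
apply: (@mu_ext _ (fun s => iteri (head 0 s) (fun _ h => h.+1) (head 0 (behead s)))).
  by move=> s /=; elim: (head 0 s) => //= n ->.
by apply: mu_iteri; [muvar | apply: mu_succ; muvar | muvar].
Qed.

Lemma mu_pred k g : mu k g -> mu k (fun s => (g s).-1).
Proof.
apply: mu_app1.
apply: (@mu_ext _ (fun s => iteri (head 0 s) (fun i _ => i) 0)).
  by move=> s /=; case: (head 0 s).
by apply: mu_iteri; [exact: mu_const | muvar | muvar].
Qed.

Lemma mu_sub k g h : mu k g -> mu k h -> mu k (fun s => g s - h s).
Proof.
apply: mu_app2.
apply: (@mu_ext _ (fun s => iteri (head 0 (behead s)) (fun _ h => h.-1) (head 0 s))).
  by move=> s /=; elim: (head 0 (behead s)) => [|n /= ->]; rewrite ?subn0 ?subnS.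
by apply: mu_iteri; [muvar | apply: mu_pred; muvar | muvar].
Qed.

Lemma mu_mul k g h : mu k g -> mu k h -> mu k (fun s => g s * h s).
Proof.
apply: mu_app2.
apply: (@mu_ext _ (fun s => iteri (head 0 s) (fun _ h => head 0 (behead s) + h) 0)).
  by move=> s /=; elim: (head 0 s) => //= n ->; rewrite mulSn.
by apply: mu_iteri; [exact: mu_const | apply: mu_add; muvar | muvar].
Qed.

Lemma mu_exp k g h : mu k g -> mu k h -> mu k (fun s => g s ^ h s).
Proof.
apply: mu_app2.
apply: (@mu_ext _ (fun s => iteri (head 0 (behead s)) (fun _ h => head 0 s * h) 1)).
  by move=> s /=; elim: (head 0 (behead s)) => //= n ->; rewrite expnS.
by apply: mu_iteri; [exact: mu_const | apply: mu_mul; muvar | muvar].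
Qed.

Lemma mu_double k g : mu k g -> mu k (fun s => (g s).*2).
Proof. by move=> Hg; apply: mu_ext (mu_add Hg Hg) => s; rewrite addnn. Qed.

Definition mub k (P : seq nat -> bool) := mu k (fun s => P s : nat).

Lemma mub_leq k g h : mu k g -> mu k h -> mub k (fun s => g s <= h s).
Proof.
move=> Hg Hh; apply: mu_ext (mu_sub (mu_const k 1) (mu_sub Hg Hh)) => s.
by rewrite -subn_eq0; case: (g s - h s) => // d; rewrite subSS sub0n.
Qed.

Lemma mub_neg k P : mub k P -> mub k (fun s => ~~ P s).
Proof.
by move=> HP; apply: mu_ext (mu_sub (mu_const k 1) HP) => s; case: (P s).
Qed.

Lemma mub_and k P Q : mub k P -> mub k Q -> mub k (fun s => P s && Q s).
Proof. by move=> HP HQ; apply: mu_ext (mu_mul HP HQ) => s; rewrite mulnb. Qed.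

Lemma mub_ext k P Q : P =1 Q -> mub k P -> mub k Q.
Proof. by move=> e; apply: mu_ext => s; rewrite e. Qed.

Lemma mub_or k P Q : mub k P -> mub k Q -> mub k (fun s => P s || Q s).
Proof.
move=> /mub_neg HP /mub_neg HQ.
by apply: mub_ext (mub_neg (mub_and HP HQ)) => s; rewrite negb_and !negbK.
Qed.

Lemma mub_impl k P Q : mub k P -> mub k Q -> mub k (fun s => P s ==> Q s).
Proof.
move=> /mub_neg HP HQ.
by apply: mub_ext (mub_or HP HQ) => s; rewrite implybE.
Qed.

Lemma mub_eq k g h : mu k g -> mu k h -> mub k (fun s => g s == h s).
Proof.
move=> Hg Hh; apply: mub_ext (mub_and (mub_leq Hg Hh) (mub_leq Hh Hg)) => s.
by rewrite eqn_leq.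
Qed.

Lemma mu_if k P g h : mub k P -> mu k g -> mu k h ->
  mu k (fun s => if P s then g s else h s).
Proof.
move=> HP Hg Hh.
apply: mu_ext (mu_add (mu_mul HP Hg) (mu_mul (mub_neg HP) Hh)) => s.
by case: (P s); rewrite ?mul1n ?mul0n ?addn0.
Qed.

Definition bsum n (g : nat -> nat) := \sum_(i < n) g i.
Definition ball n (P : pred nat) := all P (iota 0 n).
Definition bex n (P : pred nat) := has P (iota 0 n).
Definition bmin n (P : pred nat) := find P (iota 0 n).

Lemma ballP n (P : pred nat) : reflect (forall i, i < n -> P i) (ball n P).
Proof.
apply: (iffP allP) => H i; first by move=> ltin; apply: H; rewrite mem_iota.
by rewrite mem_iota; apply: H.
Qed.

Lemma bexP n (P : pred nat) : reflect (exists2 i, i < n & P i) (bex n P).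
Proof.
apply: (iffP hasP) => -[i Hi Pi]; exists i => //; first by rewrite mem_iota in Hi.
by rewrite mem_iota.
Qed.

Lemma bminP n (P : pred nat) : bex n P -> bmin n P < n /\ P (bmin n P).
Proof.
move=> H; have lt : bmin n P < n by rewrite /bmin -[X in _ < X](size_iota 0) -has_find.
by split => //; rewrite -[bmin n P](@nth_iota 0 0 n) //; apply: nth_find.
Qed.

Lemma mu_bsum k (g : nat -> seq nat -> nat) nn :
  mu k.+1 (fun s => g (head 0 s) (behead s)) -> mu k nn ->
  mu k (fun s => bsum (nn s) (fun i => g i s)).
Proof.
move=> Hg Hn.
apply: (@mu_ext _ (fun s => iteri (nn s) (fun i h => h + g i s) 0)).
  by move=> s; rewrite /bsum; elim: (nn s) => [|m /= ->];
     rewrite ?big_ord0 ?big_ord_recr.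
apply: mu_iteri => //; first exact: mu_const.
apply: mu_add; first by muvar.
by apply: mu_ext (mu_cons (j := 2) Hg (mu_var _ 0)) => -[|i [|h s]] //=; rewrite drop0.
Qed.

Lemma mub_ball k (P : nat -> seq nat -> bool) nn :
  mub k.+1 (fun s => P (head 0 s) (behead s)) -> mu k nn ->
  mub k (fun s => ball (nn s) (fun i => P i s)).
Proof.
move=> /mub_neg HP Hn.
apply: mub_ext (mub_eq (mu_bsum (g := fun i s => ~~ P i s) HP Hn) (mu_const k 0)) => s.
rewrite /bsum /ball /=; apply/eqP/idP.
  move/eqP; rewrite sum_nat_eq0 => /forallP H; apply/ballP => i ltin.
  by have := H (Ordinal ltin); rewrite /= eqb0 negbK.
by move/ballP=> H; rewrite big1 // => i _; rewrite H.
Qed.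

Lemma mub_bex k (P : nat -> seq nat -> bool) nn :
  mub k.+1 (fun s => P (head 0 s) (behead s)) -> mu k nn ->
  mub k (fun s => bex (nn s) (fun i => P i s)).
Proof.
move=> /mub_neg HP Hn.
apply: mub_ext (mub_neg (mub_ball (P := fun i s => ~~ P i s) HP Hn)) => s.
by rewrite /ball /bex -has_predC; apply: eq_has => i /=; rewrite negbK.
Qed.

(** The least witness is the number of [i < n] such that no [j <= i] satisfies [P]; this turns a
    bounded search into a bounded sum. *)
Lemma mu_bmin k (P : nat -> seq nat -> bool) nn :
  mub k.+1 (fun s => P (head 0 s) (behead s)) -> mu k nn ->
  mu k (fun s => bmin (nn s) (fun i => P i s)).
Proof.
move=> HP Hn.
have eqF s n : bmin n (fun i => P i s) = bsum n (fun i => ball i.+1 (fun j => ~~ P j s)).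
  elim: n => [|n IH]; first by rewrite /bsum big_ord0.
  rewrite /bsum big_ord_recr /= -/(bsum n (fun i => ball i.+1 (fun j => ~~ P j s))) -IH.
  rewrite /bmin /ball -[n.+1]addn1 iotaD find_cat size_iota add0n all_cat /=.
  rewrite -[all _ _]/(all (predC (P^~ s)) _) all_predC.
  case: hasP => // H /=; first by rewrite addn0.
  rewrite [find _ (iota 0 n)]hasNfind ?size_iota; last by apply/hasP.
  by case: (P n s).
apply: mu_ext (fun s => esym (eqF s (nn s))) _.
apply: mu_bsum => //; apply: (mub_ball (P := fun j s => ~~ P j (behead s))).
  apply: mub_neg.
  by apply: mu_ext (mu_cons (j := 2) HP (mu_var _ 0)) => -[|i [|h s]] //=; rewrite drop0.
by apply: mu_succ; muvar.
Qed.

(** The cons operation of [CodeSeq.code], on which the pickling of sequences, pairs and options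
    rests; pickled data can thus be read and written by arithmetic. *)
Definition consc x c := 2 ^ x * c.*2.+1.
(** Decoding is a bounded search, since [ltn_consc] makes head and tail smaller than the code. On
    the code 0 of the empty list both [hdc] and [tlc] give 0, so that [nthc] agrees with [nth 0]
    also beyond the end. *)
Definition hdc c := bmin c (fun h => bex c (fun t => c == consc h t)).
Definition tlc c := bmin c (fun t => c == consc (hdc c) t).
Definition nthc c i := hdc (iter i tlc c).
Definition codef n g := CodeSeq.code (mkseq g n).

Lemma consc_inj x c y d : consc x c = consc y d -> x = y /\ c = d.
Proof.
have E z e : consc z e = CodeSeq.code (z :: CodeSeq.decode e).
  by rewrite /= CodeSeq.decodeK.
by rewrite !E => /(can_inj CodeSeq.codeK) [-> /(can_inj CodeSeq.decodeK)].
Qed.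

Lemma ltn_consc x c : x < consc x c /\ c < consc x c.
Proof.
rewrite /consc; have : x < 2 ^ x by rewrite ltn_expl.
by move: (2 ^ x) => y; nia.
Qed.

Lemma hd_tl_consc x c : hdc (consc x c) = x /\ tlc (consc x c) = c.
Proof.
have [ltx ltc] := ltn_consc x c.
have hE : hdc (consc x c) = x.
  have H : bex (consc x c) (fun h => bex (consc x c) (fun t => consc x c == consc h t)).
    by apply/bexP; exists x => //; apply/bexP; exists c.
  by have [_ /bexP[t _ /eqP/consc_inj[]]] := bminP H.
split=> //; rewrite /tlc hE.
have H : bex (consc x c) (fun t => consc x c == consc x t).
  by apply/bexP; exists c.
by have [_ /eqP/consc_inj[]] := bminP H.
Qed.

Lemma nthcE c i : nthc c i = nth 0 (CodeSeq.decode c) i.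
Proof.
rewrite -{1}[c]CodeSeq.decodeK /nthc; elim: i (CodeSeq.decode c) => [|i IH] [|x s] //=.
- by rewrite -/(consc _ _) (hd_tl_consc _ _).1.
- by rewrite -iterS iterSr -[tlc 0]/(CodeSeq.code [::]) IH nth_nil.
- by rewrite -iterS iterSr -/(consc _ _) (hd_tl_consc _ _).2 IH.
Qed.

Lemma mu_consc k g h : mu k g -> mu k h -> mu k (fun s => consc (g s) (h s)).
Proof.
move=> Hg Hh; apply: mu_mul; last by apply/mu_succ/mu_double.
by apply: mu_exp => //; apply: mu_const.
Qed.

Lemma mu_hdc k g : mu k g -> mu k (fun s => hdc (g s)).
Proof.
apply: mu_app1; apply: (mu_bmin (P := fun h s => bex (head 0 s) (fun t => head 0 s == consc h t))); last by muvar.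
apply: (mub_bex (P := fun t s => head 0 (behead s) == consc (head 0 s) t)); last by muvar.
by apply: mub_eq; [muvar | apply: mu_consc; muvar].
Qed.

Lemma mu_tlc k g : mu k g -> mu k (fun s => tlc (g s)).
Proof.
apply: mu_app1.
apply: (mu_bmin (P := fun t s => head 0 s == consc (hdc (head 0 s)) t)); last by muvar.
by apply: mub_eq; [muvar | apply: mu_consc; [apply: mu_hdc; muvar | muvar]].
Qed.

Lemma mu_nthc k g h : mu k g -> mu k h -> mu k (fun s => nthc (g s) (h s)).
Proof.
apply: mu_app2; apply: mu_hdc.
apply: (@mu_ext _ (fun s => iteri (head 0 (behead s)) (fun _ h => tlc h) (head 0 s))).
  by move=> s /=; elim: (head 0 (behead s)) => //= n ->.
by apply: mu_iteri; [muvar | apply: mu_tlc; muvar | muvar].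
Qed.

Lemma mu_half k g : mu k g -> mu k (fun s => (g s)./2).
Proof.
apply: mu_app1; apply: (@mu_ext _ (fun s => bmin (head 0 s).+1 (fun t => head 0 s <= t.*2.+1))).
  move=> s; set n := head 0 s; have : bex n.+1 (fun t => n <= t.*2.+1).
    by apply/bexP; exists n; lia.
  move=> H; have [_ le] := bminP H.
  have [//|ne] := eqVneq (bmin n.+1 (fun t => n <= t.*2.+1)) n./2.
  have lt : n./2 < bmin n.+1 (fun t => n <= t.*2.+1) by lia.
  have := before_find 0 lt; rewrite nth_iota; last by lia.
  by rewrite add0n; lia.
apply: (mu_bmin (P := fun t s => head 0 s <= t.*2.+1)); last by apply: mu_succ; muvar.
by apply: mub_leq; [muvar | apply/mu_succ/mu_double; muvar].
Qed.

Lemma mub_odd k g : mu k g -> mub k (fun s => odd (g s)).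
Proof.
move=> Hg; apply: mub_ext (mub_eq Hg (mu_succ (mu_double (mu_half Hg)))) => s.
by lia.
Qed.

Lemma mu_codef k (g : nat -> seq nat -> nat) nn :
  mu k.+1 (fun s => g (head 0 s) (behead s)) -> mu k nn ->
  mu k (fun s => codef (nn s) (fun i => g i s)).
Proof.
move=> Hg Hn.
(* A list is coded starting from its last entry, so step [i] conses entry number [nn s - i.+1]. *)
apply: (@mu_ext _ (fun s => iteri (nn s) (fun i h => consc (g (nn s - i.+1) s) h) 0)).
  move=> s; rewrite /codef; set n := nn s.
  suff H m : m <= n -> iteri m (fun i h => consc (g (n - i.+1) s) h) 0 =
     CodeSeq.code [seq g i s | i <- iota (n - m) m] by rewrite H // subnn.
  elim: m => //= m IH ltmn; rewrite IH 1?ltnW // /consc -subSn // subSS //.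
apply: mu_iteri => //; first exact: mu_const.
apply: mu_consc; last by muvar.
have Hi : mu (2 + k) (fun s => nn (drop 2 s) - (head 0 s).+1).
  by apply: mu_sub; [apply: mu_weak | apply: mu_succ; muvar].
by apply: mu_ext (mu_cons (j := 2) Hg Hi) => -[|i [|h s]] //=; rewrite drop0.
Qed.

End MuRecursive.

(** * Layouts, the explicit formulas of the drawing, and the search program *)

Module LayoutDefs.
Import MuRecursive.
From mathcomp Require Import all_boot all_order all_algebra.
From mathcomp Require Import zify.

Set Implicit Arguments.
Unset Strict Implicit.
Unset Printing Implicit Defensive.

Section Layout.
Variables (n m : nat) (a mem : nat -> nat -> bool).
Variables (f l : nat -> nat) (p : nat -> nat -> nat).

(** The subtree of [u] occupies the columns from [f u] to [l u], with [u] itself at [f u]; [p u v]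
    is the column in which the chord between [u] and [v] rises on the side of [u]. Ancestry is not a
    separate datum but is read off from these intervals. *)
Definition cov u i := (f u <= i) && (i <= l u).
Definition anc u v := cov u (f v).
Definition par u v :=
  [&& anc u v, u != v & ball n (fun w => anc w v && (w != v) ==> anc w u)].
Definition chord u v := a u v && ~~ (par u v || par v u).
(** [v] is the deepest vertex over column [c], so that a chord of [v] can rise in that column
    without meeting the tree. *)
Definition top c v := cov v c && ball n (fun w => cov w c ==> anc w v).

(** Only bounded quantifiers occur, so that [mutac] can compile the formula. Laminarity and the
    fourth condition make the intervals those of a spanning tree of [a]; the fifth makes every
    cluster a subtree, closed under passing to vertices between its root and a member. The
    conditions on chords range over oriented pairs, each chord being listed in both directions. *)
Definition layout : bool :=
  [&& ball n (fun u => f u <= l u),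
      ball n (fun u => ball n (fun v => (f u == f v) ==> (u == v))),
      ball n (fun u => ball n (fun v => anc u v ==> (l v <= l u))),
      ball n (fun v => ball n (fun u => anc v u)
                       || bex n (fun u => par u v && a u v)),
      ball m (fun k => bex n (fun r => mem r k && ball n (fun v =>
         mem v k ==> anc r v && ball n (fun u => anc r u && anc u v ==> mem u k)))),
      ball n (fun u => ball n (fun v => chord u v ==>
         top (p u v) u && ball n (fun w => p u v != f w))),
      ball n (fun u => ball n (fun v => ball n (fun u' => ball n (fun v' =>
         [&& chord u v, chord u' v' & p u v == p u' v'] ==>
         (u == u') && (v == v')))))
    & ball n (fun u => ball n (fun v => ball n (fun u' => ball n (fun v' =>
         chord u v && chord u' v' ==>
         ~~ [&& p u v < p u' v', p u' v' < p v u & p v u < p v' u']))))].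

(** Exceeds the size of every cluster, as sizes are used as offsets. A column is 10 units wide: 4 on
    each side of its centre, where the top of a region is flat, and 2 for the passage to the flat
    part of the next column. *)
Definition unit_ := n.+1.
Definition colw := 10 * unit_.
(** At least the abscissa of every column covered by a vertex, see [Hr1_ge]; an edge rising by one
    level therefore moves sideways by at most its rise. *)
Definition lvlh := colw * (bsum n l).+1.
Definition colx c := colw * c.+1.
Definition depth v := bsum n (fun u => anc u v).
Definition size_ k := bsum n (fun u => mem u k).
Definition croot k := bmin n (fun r => mem r k && ball n (fun v => mem v k ==> anc r v)).
(** In a layout, the members of [k] over a column of its root form a tree path that starts at the
    root. So [depth (croot k) + height k i] is one more than the depth of the deepest member over
    column [i]. *)
Definition height k i := bsum n (fun u => mem u k && cov u i).
(** A larger cluster has a lower base, higher caps and, in [cx], sides further out, which keeps the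
    boundaries of nested clusters disjoint. As sizes are less than [unit_], the base is less than
    one unit below the root, and a cap is between one and two units below its level. *)
Definition base k := lvlh * depth (croot k) - size_ k.
Definition cap k i := lvlh * (depth (croot k) + height k i) - (2 * unit_ - size_ k).

Definition vx v := colx (f v).
Definition vy v := lvlh * depth v.

(** The two truncated differences add up to the distance of the two columns: of two nested chords
    the longer one runs higher. All vertices and caps are below [n + 3] levels. *)
Definition topy u v := lvlh * (n + 3) + ((p u v - p v u) + (p v u - p u v)).

(** Two corners on the base, and for each column of the root the two ends of a flat piece. *)
Definition ncorner k := (l (croot k) - f (croot k)).*2 + 4.
Definition ccol k j := f (croot k) + j.-1./2.
(** The sides have horizontal extent 1 instead of being vertical, hence the predecessor of
    [2 * size_ k]. The abscissae of the corners then increase strictly, and the upper boundary is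
    the graph of a function. *)
Definition cx k j :=
  if j == 0 then colx (f (croot k)) - (2 * unit_ + 2 * size_ k) else
  if j.+1 == ncorner k then colx (l (croot k)) + (2 * unit_ + 2 * size_ k) else
  if odd j then
    colx (ccol k j) - (if ccol k j == f (croot k) then 2 * unit_ + (2 * size_ k).-1 else 4 * unit_)
  else colx (ccol k j) + (if ccol k j == l (croot k) then 2 * unit_ + (2 * size_ k).-1 else 4 * unit_).
Definition cy k j :=
  if (j == 0) || (j.+1 == ncorner k) then base k else cap k (ccol k j).

End Layout.

Definition code2 x y := consc x (consc y 0).
(** The pickling of a natural number in [rat]: the pair of the numerator and the denominator 1, each
    an integer coded as a left summand, that is as a pair of [Some] and [None]. *)
Definition natq_code x := code2 (code2 (consc x 0) 0) (code2 (consc 1 0) 0).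
Definition point_code x y := code2 (natq_code x) (natq_code y).

Definition adjF A u v := nthc (nthc A u) v == 1.
(** The tables [B] and [C] hold coded options, 0 for [None] and [consc k 0] for [Some k]. The
    iteration climbs from the parent of [v]; fewer than [m] further steps reach every ancestor. *)
Definition memF m B C v k :=
  bex m (fun j => iteri j (fun _ c => if c == 0 then 0 else nthc C (hdc c))
                    (nthc B v) == consc k 0).
Definition fF z u := nthc (nthc z 0) u.
Definition lF z u := nthc (nthc z 1) u.
Definition pF z u v := nthc (nthc (nthc z 2) u) v.

Definition layoutF z n m A B C :=
  layout n m (adjF A) (memF m B C) (fF z) (lF z) (pF z).

Definition drawF z n m A B C :=
  let a := adjF A in let mem := memF m B C in
  let f := fF z in let l := lF z in let p := pF z in
  code2 (code2 (codef n (fun v => point_code (vx n f v) (vy n f l v)))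
    (codef n (fun u => codef n (fun v => if chord n a f l u v then
        consc (point_code (colx n (p u v)) (lvlh n l * (depth n f l u).+1))
       (consc (point_code (colx n (p u v)) (topy n l p u v))
       (consc (point_code (colx n (p v u)) (topy n l p u v))
       (consc (point_code (colx n (p v u)) (lvlh n l * (depth n f l v).+1)) 0)))
      else 0))))
   (codef m (fun k => codef (ncorner n mem f l k)
      (fun j => point_code (cx n mem f l k j) (cy n mem f l k j)))).

(** Recursion on the syntax of the unfolded function: the patterns [@?A s] abstract every subterm
    over the argument list. A conditional is what remains in the last case. *)
Ltac mutac :=
  repeat (cbv beta; first
  [ apply: mu_const
  | lazymatch goal with
    | |- mu _ (fun s => head 0 _) => muvar
    | |- mu _ (fun s => @?A s + @?B s) => apply: (mu_add (g := A) (h := B))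
    | |- mu _ (fun s => @?A s - @?B s) => apply: (mu_sub (g := A) (h := B))
    | |- mu _ (fun s => @?A s * @?B s) => apply: (mu_mul (g := A) (h := B))
    | |- mu _ (fun s => (@?A s).+1) => apply: (mu_succ (g := A))
    | |- mu _ (fun s => (@?A s).-1) => apply: (mu_pred (g := A))
    | |- mu _ (fun s => (@?A s).*2) => apply: (mu_double (g := A))
    | |- mu _ (fun s => (@?A s)./2) => apply: (mu_half (g := A))
    | |- mu _ (fun s => consc (@?A s) (@?B s)) => apply: (mu_consc (g := A) (h := B))
    | |- mu _ (fun s => nthc (@?A s) (@?B s)) => apply: (mu_nthc (g := A) (h := B))
    | |- mu _ (fun s => hdc (@?A s)) => apply: (mu_hdc (g := A))
    | |- mu _ (fun s => bsum (@?N s) (@?G s)) => refine (@mu_bsum _ (fun i s => G s i) N _ _)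
    | |- mu _ (fun s => codef (@?N s) (@?G s)) => refine (@mu_codef _ (fun i s => G s i) N _ _)
    | |- mu _ (fun s => bmin (@?N s) (@?G s)) => refine (@mu_bmin _ (fun i s => G s i) N _ _)
    | |- mu _ (fun s => iteri (@?N s) (@?G s) (@?A s)) => refine (@mu_iteri _ A (fun i h s => G s i h) N _ _ _)
    | |- mu ?k (fun s => nat_of_bool (@?P s)) => change (mub k P)
    | |- mub _ (fun s => @?A s <= @?B s) => apply: (mub_leq (g := A) (h := B))
    | |- mub _ (fun s => @?A s == @?B s) => apply: (mub_eq (g := A) (h := B))
    | |- mub _ (fun s => @?A s && @?B s) => apply: (mub_and (P := A) (Q := B))
    | |- mub _ (fun s => @?A s || @?B s) => apply: (mub_or (P := A) (Q := B))
    | |- mub _ (fun s => @?A s ==> @?B s) => apply: (mub_impl (P := A) (Q := B))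
    | |- mub _ (fun s => ~~ @?A s) => apply: (mub_neg (P := A))
    | |- mub _ (fun s => odd (@?A s)) => apply: (mub_odd (g := A))
    | |- mub _ (fun s => ball (@?N s) (@?G s)) => refine (@mub_ball _ (fun i s => G s i) N _ _)
    | |- mub _ (fun s => bex (@?N s) (@?G s)) => refine (@mub_bex _ (fun i s => G s i) N _ _)
    | |- mu _ _ => apply: mu_if
    end ]).

Definition ap6 T (F : nat -> nat -> nat -> nat -> nat -> nat -> T) (s : seq nat) :=
  F (head 0 s) (head 0 (iter 1 behead s)) (head 0 (iter 2 behead s))
    (head 0 (iter 3 behead s)) (head 0 (iter 4 behead s)) (head 0 (iter 5 behead s)).

Lemma mub_layoutF : mub 6 (ap6 layoutF).
Proof.
cbv beta delta [ap6 layoutF layout chord top par anc cov adjF memF fF lF pF].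
cbn [iter].
mutac.
Qed.

Lemma mu_drawF : mu 6 (ap6 drawF).
Proof.
cbv beta zeta delta [ap6 drawF cx cy ccol ncorner topy vx vy base cap height croot size_
  depth colx lvlh colw unit_ chord top par anc cov adjF memF fF lF pF
  point_code natq_code code2].
cbn [iter].
mutac.
Qed.

(** [MMin] looks for a zero, hence is applied to the negation of [P]. It also demands that its body
    halt with a positive value at all smaller arguments, which holds as [P] is decided by a program
    that always halts. *)
Lemma mu_search k P F :
  mub k.+1 P -> mu k.+1 F ->
  exists c, forall s, size s = k -> (exists z, P (z :: s)) ->
    exists2 z, P (z :: s) & computes c s (F (z :: s)).
Proof.
move=> /mub_neg[c Hc] [d Hd].
exists (MComp d (MMin c :: mkseq MProj k)) => s sz exP.
pose z := ex_minn exP; exists z; first by rewrite /z; case: ex_minnP.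
apply: (@computes_comp _ _ _ (z :: s)); rewrite /= ?size_mkseq ?sz //; last first.
  by apply: Hd; rewrite /= sz.
case=> [_|i]; last by rewrite ltnS => ltik /=; rewrite nth_mkseq.
rewrite /=; split.
  have -> : 0 = ~~ P (z :: s) by rewrite /z; case: ex_minnP => y ->.
  by apply: Hc; rewrite /= sz.
move=> i ltiz; exists 0.
have -> : 1 = ~~ P (i :: s).
  by case Pi : (P _) => //; move: ltiz; rewrite /z; case: ex_minnP => y _ /(_ _ Pi); lia.
by apply: Hc; rewrite /= sz.
Qed.

End LayoutDefs.

(** * Agreement of the arithmetic with the pickled input and output *)

Module LayoutCode.
Import MuRecursive LayoutDefs.
From mathcomp Require Import all_boot all_order all_algebra.
From mathcomp Require Import all_classical.
From mathcomp Require Import zify.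

Set Implicit Arguments.
Unset Strict Implicit.
Unset Printing Implicit Defensive.
Import GRing.Theory.

Definition natpt (x y : nat) : rat * rat := (x%:R%R, y%:R%R).

Definition layout_drawing n m (a mem : nat -> nat -> bool)
    (f l : nat -> nat) (p : nat -> nat -> nat) : polydrawing n m :=
  PolyDrawing
    (fun v : 'I_n => natpt (vx n f v) (vy n f l v))
    (fun u v : 'I_n => if chord n a f l u v then
       [:: natpt (colx n (p u v)) (lvlh n l * (depth n f l u).+1);
           natpt (colx n (p u v)) (topy n l p u v);
           natpt (colx n (p v u)) (topy n l p u v);
           natpt (colx n (p v u)) (lvlh n l * (depth n f l v).+1)]
     else [::])
    (fun k : 'I_m => mkseq (fun j => natpt (cx n mem f l k j) (cy n mem f l k j))
                      (ncorner n mem f l k)).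

Lemma pickle_natpt x y : pickle (natpt x y) = point_code x y.
Proof.
have E (z : nat) : pickle (z%:R%R : rat) = natq_code z.
  have vE : valq (z%:R%R : rat) = (z%:Z, 1%Z)%R.
    by rewrite pmulrn [LHS]surjective_pairing -/(numq _) -/(denq _) numq_int denq_int.
  by change (pickle (valq (z%:R%R : rat)) = natq_code z); rewrite vE.
by change (CodeSeq.code [:: pickle (x%:R%R : rat); pickle (y%:R%R : rat)] = point_code x y); rewrite !E.
Qed.

Lemma pickle_seqE (T : countType) (s : seq T) : pickle s = CodeSeq.code (map pickle s).
Proof. by []. Qed.

Lemma map_enum_ord n T (g : nat -> T) : [seq g (val i) | i <- enum 'I_n] = mkseq g n.
Proof. by rewrite (map_comp g val) val_enum_ord. Qed.

Lemma code_enum_ord n (T : countType) (F : 'I_n -> T) (g : nat -> nat) :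
  (forall i : 'I_n, pickle (F i) = g i) ->
  pickle [seq F i | i <- enum 'I_n] = codef n g.
Proof.
move=> FE; rewrite pickle_seqE -map_comp /codef -map_enum_ord.
by congr CodeSeq.code; apply: eq_map => i /=; rewrite FE.
Qed.

Lemma drawF_code z n m A B C :
  drawF z n m A B C = polydrawing_code
    (layout_drawing n m (adjF A) (memF m B C) (fF z) (lF z) (pF z)).
Proof.
rewrite /drawF /polydrawing_code; apply: esym.
have E2 (T U : countType) (x : T) (y : U) : pickle (x, y) = code2 (pickle x) (pickle y).
  by [].
rewrite !E2; congr (code2 (code2 _ _) _).
- by apply: code_enum_ord => i /=; rewrite pickle_natpt.
- apply: (@code_enum_ord _ _ _ (fun u => codef n _)) => u.
  apply: (@code_enum_ord _ _ _ (fun v => if _ then _ else _)) => v /=.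
  case: ifP => _ //; rewrite pickle_seqE [map _ _]/= !pickle_natpt.
  by [].
- apply: (@code_enum_ord _ _ _ (fun k => codef (ncorner n (memF m B C) (fF z) (lF z) k) _)) => k /=.
  rewrite pickle_seqE -map_comp /codef; congr CodeSeq.code.
  by apply: eq_map => j /=; rewrite pickle_natpt.
Qed.

(** Extension by 0 is what [nthc] reads from the code of a table, so functions of this form are
    equal, not just on ['I_n], to those tested by the search. *)
Definition ext n (F : 'I_n -> nat) (u : nat) : nat := oapp F 0 (insub u).
Definition ext2 n (F : 'I_n -> 'I_n -> nat) (u v : nat) : nat :=
  oapp (fun i => ext (F i) v) 0 (insub u).

Lemma ext_ord n (F : 'I_n -> nat) (u : 'I_n) : ext F u = F u.
Proof. by rewrite /ext valK. Qed.

Lemma ext2_ord n F (u v : 'I_n) : @ext2 n F u v = F u v.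
Proof. by rewrite /ext2 valK /= ext_ord. Qed.

Lemma nthc_map_enum n (T : countType) (F : 'I_n -> T) u :
  nthc (pickle [seq F i | i <- enum 'I_n]) u = ext (fun i => pickle (F i)) u.
Proof.
rewrite nthcE pickle_seqE CodeSeq.codeK -map_comp /ext; case: insubP => [i _ <-|] /=.
  rewrite (nth_map i) ?size_enum_ord ?ltn_ord //= nth_ord_enum //.
by rewrite -leqNgt => le; rewrite nth_default // size_map size_enum_ord.
Qed.

Section Codes.
Variables (n m : nat) (C : cgraph n m).

Let A := pickle [seq [seq adj C u v | v <- enum 'I_n] | u <- enum 'I_n].
Let B := pickle [seq parent C (inl v) | v <- enum 'I_n].
Let D := pickle [seq parent C (inr k) | k <- enum 'I_m].

Definition adjC := adjF A.
Definition memC := memF m B D.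

Lemma adjC_ord (u v : 'I_n) : adjC u v = adj C u v.
Proof.
rewrite /adjC /adjF nthc_map_enum ext_ord nthc_map_enum ext_ord.
by change ((adj C u v : nat) == 1 = adj C u v); rewrite eqb1.
Qed.

Definition upo (x : option 'I_m) := obind (fun k => parent C (inr k)) x.
Let oc (x : option 'I_m) : nat := pickle x.

(** A path without repetitions visits only clusters after its start, hence has at most [m] steps,
    the first of which is [parent C x]. This justifies the bound in [memF]. *)
Lemma ancestor_iter x k :
  ancestor (parent C) k x -> x <> inr k ->
  exists2 j, j < m & iter j upo (parent C x) = Some k.
Proof.
move=> /connectP[q]; case/shortenP => q' pq' uq' _ e ne.
have all_r : exists ks, q' = map inr ks.
  elim: q' x pq' {uq' e ne} => [|y q' IH] x /=; first by exists [::].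
  by case: y => // k' /andP[_ /IH[ks ->]]; exists (k' :: ks).
case: all_r => ks qE; subst q'; case: ks pq' uq' e => [_ _ /= e|k0 ks /= /andP[/eqP e0 pk]]; first by case: ne.
case/andP=> _ uq e.
have uk : uniq (k0 :: ks).
  by rewrite -(map_inj_uniq (f := @inr 'I_n 'I_m)) // => ? ? [].
exists (size ks).
  by have := max_card (mem (k0 :: ks)); rewrite (card_uniqP uk) card_ord.
rewrite e0; elim: ks k0 pk e {uk uq e0} => [|k1 ks IH] k0 /=; first by move=> _ [->].
by case/andP=> /eqP e1 pk e; rewrite -iterS iterSr /= e1; apply: IH.
Qed.

Lemma iter_ancestor x j k :
  iter j upo (parent C x) = Some k -> ancestor (parent C) k x.
Proof.
elim: j x => [|j IH] x /=.
  by move=> e; apply: connect1; rewrite /tree_up e.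
rewrite -iterS iterSr; case e : (parent C x) => [k'|] /=; last first.
  by have -> : iter j upo None = None by elim: j {IH} => //= j ->.
move=> /IH; apply: connect_trans; apply: connect1; by rewrite /tree_up e.
Qed.

Lemma memC_ord (v : 'I_n) (k : 'I_m) : memC v k = (v \in vcluster C k).
Proof.
have ocE j : iteri j (fun _ c => if c == 0 then 0 else nthc D (hdc c)) (nthc B v) =
             oc (iter j upo (parent C (inl v))).
  elim: j => [|j /= ->]; first by rewrite nthc_map_enum ext_ord.
  case: (iter _ _ _) => [k'|//] /=.
  have -> : oc (Some k') = consc k' 0 by [].
  have [-> _] := hd_tl_consc k' 0.
  by rewrite ifN ?nthc_map_enum ?ext_ord // -lt0n; apply: leq_ltn_trans (ltn_consc k' 0).1.
rewrite inE /memC /memF; apply/bexP/idP => [[j _]|/ancestor_iter[//|j ltj e]].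
  rewrite ocE; case e : (iter _ _ _) => [k'|/=].
    by move=> /eqP /consc_inj[/val_inj ek _]; apply: (@iter_ancestor _ j); rewrite e ek.
  by move=> /eqP e0; have := (ltn_consc k 0).1; rewrite -e0.
by exists j; rewrite // ocE e.
Qed.

End Codes.

(** The hypothesis only makes the search stop. The layout in the conclusion is the one with the
    least code and may differ from the given one. *)
Lemma layout_program :
  exists A : murec, forall n m (C : cgraph n m),
    (exists F L P, layout n m (adjC C) (memC C) (@ext n F) (@ext n L) (@ext2 n P)) ->
    exists f l p, layout n m (adjC C) (memC C) f l p /\
      computes A (cgraph_code C)
        (polydrawing_code (layout_drawing n m (adjC C) (memC C) f l p)).
Proof.
have [A HA] := mu_search mub_layoutF mu_drawF; exists A => n m C [F [L [P lay]]].
have [|z Pz] := HA (cgraph_code C) erefl; last first.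
  rewrite /ap6 /= drawF_code => Hc.
  by exists (fF z), (lF z), (pF z); split.
exists (pickle [:: pickle [seq F i | i <- enum 'I_n]; pickle [seq L i | i <- enum 'I_n];
  pickle [seq [seq P u v | v <- enum 'I_n] | u <- enum 'I_n]]).
rewrite /ap6 /layoutF /= -/(adjC C) -/(memC C).
have N z s i : nthc (pickle (z :: s : seq nat)) i = nth 0 (z :: s) i.
  by rewrite nthcE pickle_seqE CodeSeq.codeK map_id.
congr (is_true (layout _ _ _ _ _ _ _)): lay; apply/funext => u; rewrite /fF /lF /pF ?N /=.
- by rewrite nthc_map_enum.
- by rewrite nthc_map_enum.
- apply/funext => v; rewrite nthc_map_enum /ext2 /ext; case: (insub u) => //= [i|].
    by rewrite nthc_map_enum.
  by rewrite nthcE nth_nil.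
Qed.

End LayoutCode.

(** * Darts of the square grid and the tour around a grid tree *)

Module GridTour.
From mathcomp Require Import all_boot all_order all_algebra.
From mathcomp Require Import zify.

Set Implicit Arguments.
Unset Strict Implicit.
Unset Printing Implicit Defensive.
Import GRing.Theory Order.TTheory.
Local Open Scope ring_scope.

Notation gpoint := (int * int)%type.
(* direction (h, s): horizontal if h, towards increasing coordinates if s *)
Notation dart := (gpoint * (bool * bool))%type.

Definition sgnd (s : bool) : int := if s then 1 else -1.
Definition tgt (e : dart) : gpoint :=
  let: ((i, j), (h, s)) := e in if h then (i + sgnd s, j) else (i, j + sgnd s).
Definition rev_dart (e : dart) : dart := (tgt e, (e.2.1, ~~ e.2.2)).
(** A quarter turn to the left: its iterates list the darts of a point counterclockwise. *)
Definition turn (e : dart) : dart :=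
  (e.1, (~~ e.2.1, if e.2.1 then e.2.2 else ~~ e.2.2)).
(* the unit square [i, i+1] x [j, j+1] is the face (i, j) *)
Definition lface (e : dart) : gpoint :=
  let: ((i, j), d) := e in
  match d with (true, true) => (i, j) | (false, true) => (i - 1, j)
             | (true, false) => (i - 1, j - 1) | (false, false) => (i, j - 1) end.
Definition rface (e : dart) : gpoint :=
  let: ((i, j), d) := e in
  match d with (true, true) => (i, j - 1) | (false, true) => (i, j)
             | (true, false) => (i - 1, j) | (false, false) => (i - 1, j - 1) end.

Lemma rev_dartK : involutive rev_dart.
Proof. by case=> [[i j] [[] []]]; rewrite /rev_dart /=; congr (_, _, _); lia. Qed.

Lemma tgt_rev e : tgt (rev_dart e) = e.1.
Proof. by rewrite -[in RHS](rev_dartK e). Qed.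

Lemma rface_turn e : rface (turn e) = lface e.
Proof. by case: e => [[i j] [[] []]]. Qed.

Lemma lface_rev e : lface (rev_dart e) = rface e.
Proof. by case: e => [[i j] [[] []]] /=; congr (_, _); lia. Qed.

Lemma rface_rev e : rface (rev_dart e) = lface e.
Proof. by rewrite -lface_rev rev_dartK. Qed.

Lemma turn4 e : turn (turn (turn (turn e))) = e.
Proof. by case: e => [[i j] [[] []]]. Qed.

(* whether the downward ray from the centre of the face F crosses e *)
Definition below (F : gpoint) (e : dart) : bool :=
  let: ((i, j), (h, s)) := e in
  [&& h, (if s then i else i - 1) == F.1 & j <= F.2].
Definition same_edge (e e' : dart) : bool := (e' == e) || (e' == rev_dart e).

Lemma same_edgeC e e' : same_edge e e' = same_edge e' e.
Proof.
rewrite /same_edge eq_sym; congr (_ || _).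
by apply/eqP/eqP => ->; rewrite rev_dartK.
Qed.

Fixpoint walk (x : gpoint) (w : seq dart) (y : gpoint) : bool :=
  if w is e :: w' then (e.1 == x) && walk (tgt e) w' y else x == y.

Lemma walk_cat x w y w' z : walk x w y -> walk y w' z -> walk x (w ++ w') z.
Proof.
by elim: w x => [|e w IH] x /=; [move=> /eqP -> | case/andP=> -> /IH H /H ->].
Qed.

(** For a closed walk, its winding number around the face modulo 2. *)
Definition colour w F := \big[addb/false]_(e <- w) below F e.

(** If [e] is horizontal, the two faces are in one column and their rays differ exactly by the edge
    of [e]. If [e] is vertical, the rays run on both sides of a vertical line; apart from the edge
    of [e], a dart of the walk contributes the change between its ends of the indicator [chi] of the
    points of this line up to the lower end of [e]. These changes cancel around a closed walk. *)
Lemma colour_across w x e :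
  walk x w x ->
  colour w (lface e) (+) colour w (rface e) =
  \big[addb/false]_(e' <- w) same_edge e e'.
Proof.
pose chi (i j : int) (z : gpoint) := (z.1 == i) && (z.2 <= j).
have [ij loc] : exists ij : option gpoint, forall e',
    below (lface e) e' (+) below (rface e) e' (+) same_edge e e' =
    if ij is Some (i, j) then chi i j e'.1 (+) chi i j (tgt e') else false.
  case: e => [[i j] [[] s]].
    exists None => -[[i' j'] [[] s']]; rewrite /same_edge /rev_dart /chi !xpair_eqE /=;
      by case: s; case: s' => /=; lia.
  exists (Some (i, if s then j else j - 1)) => -[[i' j'] [[] s']];
    rewrite /same_edge /rev_dart /chi !xpair_eqE /=;
    by case: s; case: s' => /=; lia.
move=> wxx; apply/eqP; rewrite -subr_eq0 -[_ - _]/(_ (+) _); apply/eqP.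
rewrite /colour -!big_split /= (eq_bigr _ (fun e' _ => loc e')).
case: ij {loc} => [[i j]|]; last by rewrite big1.
suff H z y : walk z w y ->
    \big[addb/false]_(e' <- w) (chi i j e'.1 (+) chi i j (tgt e')) =
    chi i j z (+) chi i j y by rewrite (H _ _ wxx) addbb.
elim: w z {wxx} => [|e' w IH] z /=; first by rewrite big_nil => /eqP ->; rewrite addbb.
by case/andP=> /eqP <- /IH E; rewrite big_cons E addbA addbK.
Qed.

(** A dart outside the tree is followed by [turn p]; a tree dart is traversed and followed by
    [turn (rev_dart p)]. Only the effect on the face to the right is recorded, which is what the
    parity argument consumes. *)
Definition next_in (tr : seq dart) (p q : dart) : bool :=
  rface q == if p \in tr then rface p else lface p.

(** The closed tour is cut open somewhere and kept as a list of all four darts of each visited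
    point, including the darts that are not in the tree. *)
Record tour (l tr : seq dart) : Prop := Tour {
  tour_uniq : uniq l;
  tour_full : forall x d d', (x, d) \in l -> (x, d') \in l;
  tour_rev : forall e, e \in tr -> rev_dart e \in tr;
  tour_sub : {subset tr <= l};
  tour_next : sorted (next_in tr) l;
  tour_conn : forall x y d d', (x, d) \in l -> (y, d') \in l ->
    exists2 w, walk x w y & {subset w <= tr}
}.

(* Colour the faces by the parity of the closed walk formed by e and the tree
   path joining its ends: along the tour the colour to the right changes exactly
   when passing e or its reverse, while both sides of e' have the same colour. *)
Lemma tour_noncrossing l tr e e' : tour l tr ->
  e \in l -> rev_dart e \in l -> e' \in l -> rev_dart e' \in l ->
  e \notin tr -> e' \notin tr -> ~~ same_edge e e' ->
  ~~ [&& index e l < index e' l, index e' l < index (rev_dart e) l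
       & index (rev_dart e) l < index (rev_dart e') l]%N.
Proof.
move=> T el rel e'l re'l etr e'tr ne; apply/negP => /and3P[lt1 lt2 lt3].
have [w wk wtr] : exists2 w, walk (tgt e) w e.1 & {subset w <= tr}.
  apply: (tour_conn T (d := (rev_dart e).2) (d' := e.2)); last by rewrite -surjective_pairing.
  by move: rel; rewrite /rev_dart.
have wc : walk e.1 (e :: w) e.1 by rewrite /= eqxx.
pose c := colour (e :: w); pose E d := (d == e) || (d == rev_dart e).
have revN d : d \notin tr -> rev_dart d \notin tr.
  by apply: contra => /(tour_rev T); rewrite rev_dartK.
have cE d : d \notin tr -> c (lface d) (+) c (rface d) = E d.
  move=> dtr; rewrite (colour_across _ wc) big_cons big1_seq ?addbF => [|d' /andP[_ d'w]].
    exact: same_edgeC.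
  apply/negbTE; rewrite /same_edge negb_or; apply/andP; split.
    by apply: contraNneq dtr => <-; apply: wtr.
  by apply: contraNneq (revN _ dtr) => <-; apply: wtr.
have step p q : next_in tr p q -> c (rface q) = c (rface p) (+) (if p \in tr then false else E p).
  rewrite /next_in => /eqP ->; case: ifPn => ptr; rewrite ?addbF //.
  by rewrite -cE // addbC addbK.
have Etr p : p \in tr -> E p = false.
  move=> ptr; apply/negbTE; rewrite negb_or; apply/andP; split.
    by apply: contraNneq etr => <-.
  by apply: contraNneq (revN _ etr) => <-.
have {}step p q : next_in tr p q -> c (rface q) = c (rface p) (+) E p.
  by move=> /step ->; case: ifP => // /Etr ->.
case: l T el rel e'l re'l lt1 lt2 lt3 => // p0 l T el rel e'l re'l lt1 lt2 lt3.
set L := p0 :: l in T el rel e'l re'l lt1 lt2 lt3.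
have col i : (i < size L)%N -> c (rface (nth p0 L i)) =
    c (rface p0) (+) (index e L < i)%N (+) (index (rev_dart e) L < i)%N.
  elim: i => [_|i IH lti]; first by rewrite !ltn0 !addbF.
  rewrite (@step (nth p0 L i) (nth p0 L i.+1)); last first.
    by move/(pathP p0): (tour_next T) => /(_ i); apply.
  rewrite (IH (ltnW lti)).
  have idx d : d \in L -> (nth p0 L i == d) = (index d L == i).
    move=> dL; apply/eqP/eqP => [<-|<-]; last exact: nth_index.
    by rewrite index_uniq ?(tour_uniq T) // ltnW.
  have ner : e != rev_dart e by apply: contraTneq (ltn_trans lt1 lt2) => <-; rewrite ltnn.
  have ltS d : (index d L < i.+1)%N = (index d L == i) || (index d L < i)%N.
    by rewrite ltnS leq_eqVlt.
  rewrite /E !idx // !ltS.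
  have ne_i : index e L <> index (rev_dart e) L.
    by move=> ei; move: (ltn_trans lt1 lt2); rewrite ei ltnn.
  move: ne_i; move: (index e L) (index (rev_dart e) L) => A B.
  by case: (ltngtP A i) => [||->]; case: (ltngtP B i) => [||->] //= _; case: (c _).
have := col _ (etrans (index_mem _ _) e'l); have := col _ (etrans (index_mem _ _) re'l).
rewrite !nth_index // => c2 c1.
have := cE _ e'tr; rewrite -[lface e']rface_rev.
rewrite c1 c2 lt1 lt3 (ltn_trans (ltn_trans lt1 lt2) lt3) ltnNge (ltnW lt2) /=.
by rewrite (negbTE ne : E e' = false); case: (c _).
Qed.

Fixpoint insert_after (p : dart) (b l : seq dart) : seq dart :=
  if l is q :: l' then if q == p then q :: b ++ l' else q :: insert_after p b l'
  else [::].

Lemma insert_after_cat p b s1 s2 : p \notin s1 ->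
  insert_after p b (s1 ++ p :: s2) = s1 ++ p :: b ++ s2.
Proof.
elim: s1 => [|q s1 IH] /=; first by rewrite eqxx.
by rewrite inE negb_or eq_sym => /andP[/negbTE-> /IH ->].
Qed.

Lemma insert_after_catl p b s1 s2 : p \in s1 ->
  insert_after p b (s1 ++ s2) = insert_after p b s1 ++ s2.
Proof.
elim: s1 => //= q s1 IH; rewrite inE; case: (eqVneq q p) => [_ _|ne].
  by rewrite catA.
by move=> /= /IH ->.
Qed.

Lemma insert_after_catr p b s1 s2 : p \notin s1 ->
  insert_after p b (s1 ++ s2) = s1 ++ insert_after p b s2.
Proof.
elim: s1 => //= q s1 IH; rewrite inE negb_or eq_sym => /andP[/negbTE-> /IH ->] //.
Qed.

Lemma mem_insert_after p b l e : p \in l ->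
  (e \in insert_after p b l) = (e \in b) || (e \in l).
Proof.
move=> /splitPr[s1 s2]; elim: s1 => [|q s1 IH] /=.
  by rewrite eqxx !(inE, mem_cat) orbCA.
case: eqP => [->|_]; first by rewrite inE mem_cat [in RHS]inE orbCA.
by rewrite inE IH [in RHS]inE orbCA.
Qed.

(* the four darts at the far end of p, in the order in which the tour meets them *)
Definition leaf_block (p : dart) : seq dart :=
  let q := rev_dart p in [:: turn q; turn (turn q); turn (turn (turn q)); q].

Lemma mem_leaf_block p e : (e \in leaf_block p) = (e.1 == tgt p).
Proof.
case: p => [[i j] [h s]]; case: e => [[i' j'] [h' s']].
rewrite !inE !xpair_eqE /=; case: h; case: s; case: h'; case: s' => /=; lia.
Qed.

Lemma turn_neq e : (turn e != e) && (turn (turn e) != e) && (turn (turn (turn e)) != e).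
Proof. by case: e => [[i j] [[] []]]; rewrite /turn /= !xpair_eqE !andbF. Qed.

Lemma uniq_leaf_block p : uniq (leaf_block p).
Proof.
rewrite /leaf_block; case: (rev_dart p) => [[i j] [[] []]];
by rewrite /turn /= !inE !xpair_eqE !andbF.
Qed.

Lemma sorted_catP (T : Type) (r : rel T) (s1 s2 : seq T) p :
  sorted r (s1 ++ p :: s2) -> sorted r (s1 ++ [:: p]) /\ path r p s2.
Proof.
by case: s1 => [|x s1] /=; [split | rewrite !cat_path /= andbT => /and3P[-> -> ->]].
Qed.

Arguments turn : simpl never.
Arguments rev_dart : simpl never.
Arguments rface : simpl never.
Arguments lface : simpl never.

Lemma split_first (T : eqType) (p : T) l : p \in l ->
  exists s1 s2, l = s1 ++ p :: s2 /\ p \notin s1.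
Proof.
move=> pl; exists (take (index p l) l), (drop (index p l).+1 l); split.
  by rewrite -[X in _ ++ X :: _](nth_index p pl) -drop_nth ?index_mem // cat_take_drop.
by apply/negP => /index_ltn; rewrite ltnn.
Qed.

(** The tour is interrupted right after [p]: it now runs along [p], around the new point and back
    along [rev_dart p]. The face then on the right is the left face of [p], as it was when [p] was
    outside the tree, so the rest of the tour continues unchanged. *)
Lemma tour_insert l tr p d : tour l tr -> p \in l -> (tgt p, d) \notin l ->
  tour (insert_after p (leaf_block p) l) [:: p, rev_dart p & tr].
Proof.
move=> T pl yl.
have yN e : e.1 = tgt p -> e \notin l.
  case: e => y d' /= ->; apply: contra yl; exact: (tour_full T).
have revN : rev_dart p \notin l by apply: yN.
have pN : p \notin tr.
  by apply: contra revN => /(tour_rev T)/(tour_sub T).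
have memL e : (e \in insert_after p (leaf_block p) l) = (e.1 == tgt p) || (e \in l).
  by rewrite mem_insert_after // mem_leaf_block.
have conn_x x d' : (x, d') \in insert_after p (leaf_block p) l ->
    exists x' w w', [/\ (x', p.2) \in l, walk x w x', walk x' w' x,
      {subset w <= [:: p, rev_dart p & tr]} & {subset w' <= [:: p, rev_dart p & tr]}].
  rewrite memL /= => /orP[/eqP ->|xl].
    exists p.1, [:: rev_dart p], [:: p].
    split; first by rewrite -surjective_pairing.
    - by apply/andP; split; [exact: eqxx | rewrite tgt_rev; exact: eqxx].
    - by rewrite /= !eqxx.
    - by move=> e; rewrite !inE => /eqP ->; rewrite eqxx orbT.
    - by move=> e; rewrite !inE => /eqP ->; rewrite eqxx.
  by exists x, [::], [::]; rewrite /= eqxx; split => //; apply: (tour_full T) xl.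
split.
- have [s1 [s2 [lE pS]]] := split_first pl; have := tour_uniq T.
  rewrite lE in yN * => U.
  have PE : perm_eq (s1 ++ p :: leaf_block p ++ s2) (leaf_block p ++ s1 ++ p :: s2).
    by rewrite -[p :: leaf_block p ++ s2]cat1s -[p :: s2]cat1s catA perm_catCA -catA.
  rewrite insert_after_cat // (perm_uniq PE) cat_uniq uniq_leaf_block U andbT /=.
  apply/hasPn => e eU; rewrite mem_leaf_block; apply: contraL eU => /eqP; exact: yN.
- move=> x d1 d2; rewrite !memL /= => /orP[->//|/(tour_full T) ->]; exact: orbT.
- move=> e; rewrite !inE => /or3P[/eqP->|/eqP->|/(tour_rev T)->].
  + by rewrite eqxx orbT.
  + by rewrite rev_dartK eqxx.
  + by rewrite !orbT.
- move=> e; rewrite !inE memL => /or3P[/eqP->|/eqP->|/(tour_sub T)->]; rewrite ?orbT //.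
    by rewrite pl orbT.
  by rewrite eqxx.
- have [s1 [s2 [lE pS]]] := split_first pl; have := tour_uniq T; have := tour_next T.
  rewrite lE in revN * => N U.
  have pS2 : p \notin s2 by move: U; rewrite cat_uniq /= => /and3P[_ _ /andP[]].
  rewrite insert_after_cat //.
  set tr' := [:: p, _ & tr].
  have trE e : e != p -> e \in s1 ++ p :: s2 -> (e \in tr') = (e \in tr).
    by move=> ne el; rewrite !inE (negbTE ne) /= orb_idl // => /eqP er; rewrite -er el in revN.
  have trB e : e.1 = tgt p -> e != rev_dart p -> (e \in tr') = false.
    move=> ey ne; rewrite !inE (negbTE ne) /=; apply/negbTE; rewrite negb_or.
    have eN := yN _ ey; apply/andP; split; first by apply: contraNneq eN => ->.
    by apply: contra eN; apply: tour_sub.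
  have nxt e q : e != p -> e \in s1 ++ p :: s2 -> next_in tr e q -> next_in tr' e q.
    by move=> ne el; rewrite /next_in trE.
  have [N1 N2] := sorted_catP N.
  have pathS e s : path (next_in tr) e s -> {subset e :: s <= s1 ++ p :: s2} ->
     p \notin belast e s -> path (next_in tr') e s.
    elim: s e => //= q s IH e /andP[Nq Ns] sub; rewrite inE negb_or eq_sym => /andP[ne pn].
    rewrite nxt ?IH //; last by apply: sub; rewrite inE eqxx.
    by move=> z zs; apply: sub; rewrite inE zs orbT.
  have P1 : sorted (next_in tr') (s1 ++ [:: p]).
    case: s1 N1 pS {U N pl revN trE nxt T yl yN pN memL conn_x trB N2 lE} pathS => //= e s N1 pS pathS.
    apply: pathS => //; first by move=> z; rewrite !(inE, mem_cat) => /or3P[->|->|/eqP->] //; rewrite ?eqxx ?orbT.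
    by rewrite belast_cat /= cats1 -lastI.
  have P2 : path (next_in tr') p (leaf_block p ++ s2).
    have /andP[/andP[n1 n2] n3] := turn_neq (rev_dart p).
    have np : p \in tr' by rewrite inE eqxx.
    have nr : rev_dart p \in tr' by rewrite !inE eqxx orbT.
    have r4 : rface (rev_dart p) = lface (turn (turn (turn (rev_dart p)))).
      by rewrite -rface_turn turn4.
    rewrite /leaf_block cat_path /= /next_in np !trB // !rface_turn lface_rev r4 !eqxx /=.
    case: s2 N2 pS2 {U N pl revN trE nxt T yl yN memL conn_x trB N1 P1 lE} pathS => //= q s2 /andP[Nq Ns] pS2 pathS.
    move: Nq; rewrite /next_in (negbTE pN) => /eqP ->; rewrite nr rface_rev eqxx /=.
    apply: pathS => //.
      by move=> z zs; rewrite mem_cat !inE; move: zs; rewrite inE => /orP[]->; rewrite ?orbT.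
    by apply: contra pS2; apply: mem_belast.
  move: P1 P2; case: (s1) => [|e s] /=; first by [].
  by rewrite !cat_path /= andbT => /andP[-> ->] ->.
- move=> x y d1 d2 /conn_x[x' [w1 [w1' [x'l W1 W1' S1 S1']]]] /conn_x[y' [w2 [w2' [y'l W2 W2' S2 S2']]]].
  have [w W Sw] := tour_conn T x'l y'l.
  exists (w1 ++ w ++ w2'); first by apply: walk_cat W1 _; apply: walk_cat W W2'.
  move=> e; rewrite !mem_cat => /or3P[/S1|/Sw|/S2'] //.
  by rewrite !inE => ->; rewrite !orbT.
Qed.

(* the darts whose source satisfies D are contiguous in l, and e comes first *)
Definition block (D : pred gpoint) (e : dart) (l : seq dart) : Prop :=
  exists s1 s2 s3, [/\ l = s1 ++ (e :: s2) ++ s3, all (D \o fst) (e :: s2),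
    ~~ has (D \o fst) s1 & ~~ has (D \o fst) s3].

Lemma block_insert D e l p b : uniq l -> p \in l ->
  {in b, forall q, D q.1 = D p.1} -> block D e l ->
  block D e (insert_after p b l).
Proof.
move=> U pl Db [s1 [s2 [s3 [lE D2 D1 D3]]]].
have insall s P : p \in s -> (forall q, q \in b -> P q = P p) -> all P s ->
    all P (insert_after p b s).
  move=> ps Pb /allP As; apply/allP => q; rewrite mem_insert_after // => /orP[/Pb->|]; exact: As.
have inshas s P : p \in s -> (forall q, q \in b -> P q = P p) -> ~~ has P s ->
    ~~ has P (insert_after p b s).
  by rewrite -!all_predC => ps Pb; apply: insall => // q /Pb /= ->.
move: pl; rewrite lE mem_cat; case: (boolP (p \in s1)) => [ps1 _|pns1].
  rewrite insert_after_catl //; exists (insert_after p b s1), s2, s3; split => //.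
  by apply: inshas.
rewrite insert_after_catr // orFb mem_cat; case: (boolP (p \in e :: s2)) => [ps2 _|pns2 ps3].
  rewrite insert_after_catl //.
  have [s2' E] : exists s2', insert_after p b (e :: s2) = e :: s2'.
    by rewrite /=; case: eqP => _; eexists.
  by rewrite E; exists s1, s2', s3; split => //; rewrite -E; apply: insall.
rewrite orFb in ps3; rewrite insert_after_catr //; exists s1, s2, (insert_after p b s3); split => //.
by apply: inshas.
Qed.

Lemma block_new D l p : p \in l -> ~~ has (D \o fst) l -> D (tgt p) ->
  block D (turn (rev_dart p)) (insert_after p (leaf_block p) l).
Proof.
move=> pl; rewrite -all_predC => /allP DN Dt.
have [s1' [s2' [E pS]]] := split_first pl; rewrite E in DN *.
rewrite insert_after_cat //.
exists (rcons s1' p), [:: turn (turn (rev_dart p)); turn (turn (turn (rev_dart p))); rev_dart p], s2'.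
rewrite cat_rcons /= Dt; split => //; rewrite -all_predC; apply/allP => q qs; apply: DN.
  by move: qs; rewrite mem_rcons mem_cat !inE => /orP[->|->]; rewrite ?orbT.
by rewrite mem_cat inE qs !orbT.
Qed.

End GridTour.

(** * Growing a spanning tree adapted to the clusters along the tour *)

Module GridGrowth.
Import MuRecursive LayoutDefs LayoutCode GridTour.
From mathcomp Require Import all_boot all_order all_algebra.
From mathcomp Require Import zify.

Set Implicit Arguments.
Unset Strict Implicit.
Unset Printing Implicit Defensive.
Import GRing.Theory Order.TTheory.

Lemma walk_exit (P : pred gpoint) x w y : walk x w y -> P x -> ~~ P y ->
  exists e, [/\ e \in w, P e.1 & ~~ P (tgt e)].
Proof.
elim: w x => [|e w IH] x /=; first by move=> /eqP -> ->.
case/andP=> /eqP <- ww Px Py; case: (boolP (P (tgt e))) => Pt; last first.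
  by exists e; rewrite inE eqxx.
by have [e' [ew ? ?]] := IH _ ww Pt Py; exists e'; rewrite inE ew orbT.
Qed.

Lemma connect_exit (T : finType) (e : rel T) (P : pred T) x y :
  connect e x y -> P x -> ~~ P y -> exists a b, [/\ e a b, P a & ~~ P b].
Proof.
case/connectP => q; elim: q x => [|z q IH] x /=; first by move=> _ -> ->.
case/andP=> exz pq yE Px Py; case: (boolP (P z)) => Pz; first exact: IH pq yE Pz Py.
by exists x, z.
Qed.

Definition linked (B : seq gpoint) (x y : gpoint) : Prop :=
  exists2 w, walk x w y & all (fun e => (e.1 \in B) && (tgt e \in B)) w.

(** Points of the connected set [B] are attached as leaves, by induction on the number of those not
    yet visited; a walk from [x] to such a point must somewhere leave the visited part. A predicate
    [D] constant on [B] keeps its block at each insertion. *)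
Lemma tour_fill (B : seq gpoint) l tr x d : tour l tr -> (x, d) \in l ->
  (forall y, y \in B -> linked B x y) -> x \in B ->
  exists l' tr', [/\ tour l' tr',
    forall y d', ((y, d') \in l') = (y \in B) || ((y, d') \in l),
    forall e, e \in tr' -> e \in tr \/ (e.1 \in B /\ tgt e \in B)
    & forall D e, {in B &, forall y z, D y = D z} -> block D e l -> block D e l'].
Proof.
move=> T xl conn xB; move: {2}(count _ B) (leqnn (count (fun y => (y, d) \notin l) B)) => N.
elim: N l tr T xl => [|N IH] l tr T xl leN.
  have allB y : y \in B -> (y, d) \in l.
    move=> yB; move: leN; rewrite leqn0 -leqn0 -[_ <= _]negbK -ltnNge -has_count => /hasPn/(_ y yB).
    by rewrite negbK.
  exists l, tr; split => //; last by left.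
  move=> y d'; case: (boolP (y \in B)) => [/allB/(tour_full T)->//|//].
case: (boolP (all (fun y => (y, d) \in l) B)) => [/allP allB|].
  exists l, tr; split => //; last by left.
  by move=> y d'; case: (boolP (y \in B)) => [/allB/(tour_full T)->//|//].
rewrite -has_predC => /hasP[y yB /= yl].
have [w wxy /allP wB] := conn _ yB.
have [p [pw pl pt]] := walk_exit (P := fun z => (z, d) \in l) wxy xl yl.
have /andP[p1B ptB] := wB _ pw.
have p_l : p \in l by rewrite [p]surjective_pairing; apply: (tour_full T) pl.
have T1 := tour_insert T p_l pt.
have mem1 z d' : ((z, d') \in insert_after p (leaf_block p) l) = (z == tgt p) || ((z, d') \in l).
  by rewrite mem_insert_after // mem_leaf_block.
have [||l' [tr' [T' m' tr'E bl']]] := IH _ _ T1.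
- by rewrite mem1 xl orbT.
- rewrite -ltnS; apply: leq_trans leN.
  elim: (B) ptB => //= z B' IHB; rewrite inE => /orP[/eqP <-|/IHB].
    rewrite mem1 eqxx pt /= add0n ltnS; apply: sub_count => z' /=.
    by rewrite mem1; apply: contra => ->; rewrite orbT.
  rewrite mem1 => lt; rewrite -addnS leq_add //.
  by case: ((z, d) \in l); rewrite ?orbT //; case: (z == _).
exists l', tr'; split => //.
- move=> z d'; rewrite m' mem1; case: (eqVneq z (tgt p)) => //= ->.
  by rewrite ptB.
- move=> e /tr'E[|]; last by right.
  rewrite !inE => /or3P[/eqP->|/eqP->|]; [right|right|by left] => //.
  by rewrite tgt_rev.
- move=> D e Dc be; apply: bl' => //; apply: block_insert => //; first exact: (tour_uniq T).
  by move=> q; rewrite mem_leaf_block => /eqP ->; apply: Dc.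
Qed.

Lemma eq_block D D' e l : {in l, forall q, D q.1 = D' q.1} ->
  block D e l -> block D' e l.
Proof.
move=> DE [s1 [s2 [s3 [lE D2 D1 D3]]]]; exists s1, s2, s3.
have sub (s : seq dart) : {subset s <= l} -> {in s, (D \o fst) =1 (D' \o fst)}.
  by move=> sl q /sl /DE.
have sub1 : {subset s1 <= l} by move=> q; rewrite lE mem_cat => ->.
have sub2 : {subset e :: s2 <= l} by move=> q; rewrite lE !mem_cat => ->; rewrite orbT.
have sub3 : {subset s3 <= l} by move=> q; rewrite lE !mem_cat => ->; rewrite !orbT.
split => //.
- by rewrite -(eq_in_all (sub _ sub2)).
- by rewrite -(eq_in_has (sub _ sub1)).
- by rewrite -(eq_in_has (sub _ sub3)).
Qed.

(** The graph as a minor of the grid: disjoint connected branch sets [B v], and for each edge a dart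
    joining those of its ends. *)
Record grid_model n (e : rel 'I_n) (B : 'I_n -> seq gpoint)
    (W : 'I_n -> 'I_n -> dart) : Prop := GridModel {
  gm_disj : forall x u v, x \in B u -> x \in B v -> u = v;
  gm_ne : forall v, exists x, x \in B v;
  gm_conn : forall v x y, x \in B v -> y \in B v -> linked (B v) x y;
  gm_wit : forall u v, e u v -> (W u v).1 \in B u /\ tgt (W u v) \in B v;
  gm_rev : forall u v, e u v -> W v u = rev_dart (W u v)
}.

(** The alternative in [cl_top] covers the tree that consists of a single leaf and has no
    cluster. *)
Record clustering n m (e : rel 'I_n) (cl : 'I_m -> {set 'I_n}) : Prop := Clustering {
  cl_laminar : forall k j v, v \in cl k -> v \in cl j ->
    (cl k \subset cl j) || (cl j \subset cl k);
  cl_ne : forall k, exists v, v \in cl k;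
  cl_conn : forall k, {in cl k &, forall u v,
    connect [rel x y | [&& e x y, x \in cl k & y \in cl k]] u v};
  cl_top : (forall u v : 'I_n, u = v) \/ exists k, cl k = setT
}.

(** The edge leaves [A] inside a smallest cluster [k] that meets [A] without being contained in it.
    Any other cluster [j] of [w] that meets [A] is of this kind and comparable with [k]; by
    minimality it contains [k], hence [u]. Attaching [w] to [u] thus keeps the visited part of each
    cluster a subtree. *)
Lemma next_vertex n m (e : rel 'I_n) (cl : 'I_m -> {set 'I_n}) (A : {set 'I_n}) r z :
  clustering e cl -> r \in A -> z \notin A ->
  exists u w, [/\ u \in A, w \notin A, e u w &
    forall k, w \in cl k -> (exists2 v, v \in A & v \in cl k) -> u \in cl k].
Proof.
move=> C rA zA.
pose P k := (A :&: cl k != set0) && ~~ (cl k \subset A).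
have [k0 Pk0] : exists k0, P k0.
  case: (cl_top C) => [eqV|[k kE]]; first by rewrite (eqV r z) (negbTE zA) in rA.
  exists k; rewrite /P kE setIT; apply/andP; split; first by apply/set0Pn; exists r.
  by apply/subsetPn; exists z.
case: (arg_minnP (fun k => #|cl k|) Pk0) => k /andP[/set0Pn[u0]] /setIP[u0A u0k] /subsetPn[z0 z0k z0A] kmin.
have [u [w [/and3P[euw uk wk] uA wA]]] := connect_exit (P := mem A) (cl_conn C u0k z0k) u0A z0A.
exists u, w; split => // j wj [v vA vj].
have Pj : P j.
  apply/andP; split; first by apply/set0Pn; exists v; rewrite inE vA.
  by apply/subsetPn; exists w.
case/orP: (cl_laminar C wk wj) => [/subsetP/(_ u uk)//|sub].
have : cl j == cl k by rewrite eqEcard sub kmin.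
by move=> /eqP ->.
Qed.

Section Growth.
Variables (n m : nat) (e : rel 'I_n) (cl : 'I_m -> {set 'I_n}).
Variables (B : 'I_n -> seq gpoint) (W : 'I_n -> 'I_n -> dart).
Hypothesis (GM : grid_model e B W) (CL : clustering e cl).

Definition desc (anc : rel 'I_n) v : pred gpoint :=
  fun x => [exists u, anc v u && (x \in B u)].

Lemma descE (anc : rel 'I_n) v u x : x \in B u -> desc anc v x = anc v u.
Proof.
move=> xu; apply/existsP/idP => [[u' /andP[a xu']]|a]; last by exists u; rewrite a.
by rewrite (gm_disj GM xu xu').
Qed.

(** The visited vertices [A] form a tree given by [par] and [anc]. The descendants of [v] own a
    contiguous stretch of the tour starting with [e0 v], and by [g_tr] the grid tree passes from one
    branch set to another only along witness darts of tree edges. *)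
Record grown (A : {set 'I_n}) r (par : 'I_n -> 'I_n) (anc : rel 'I_n) l tr
    (e0 : 'I_n -> dart) : Prop := Grown {
  g_tour : tour l tr;
  g_vis : forall x d, (x, d) \in l <-> exists2 v, v \in A & x \in B v;
  g_r : r \in A;
  g_dom : forall x y, anc x y -> x \in A /\ y \in A;
  g_refl : forall v, v \in A -> anc v v;
  g_root : forall v, v \in A -> anc r v;
  g_par : forall v, v \in A -> v != r ->
    [/\ par v \in A, e (par v) v, anc (par v) v, par v != v
      & forall x, anc x v -> x != v -> anc x (par v)];
  g_clu : forall k, (exists2 v, v \in A & v \in cl k) ->
    exists q, [/\ q \in A, q \in cl k & forall v, v \in A -> v \in cl k ->
      anc q v /\ forall u, anc q u -> anc u v -> u \in cl k];
  g_trans : forall x y z, anc x y -> anc y z -> anc x z;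
  g_block : forall v, v \in A -> block (desc anc v) (e0 v) l /\ (e0 v).1 \in B v;
  g_tr : forall q, q \in tr -> (exists v, q.1 \in B v /\ tgt q \in B v) \/
    exists v, [/\ v \in A, v != r & q = W (par v) v \/ q = W v (par v)]
}.

Lemma grown_start r : exists l tr e0, grown [set r] r id (fun x y => (x == r) && (y == r)) l tr e0.
Proof.
have [x xr] := gm_ne GM r.
pose d0 := (true, true); pose l0 : seq dart := [:: (x, d0); turn (x, d0); turn (turn (x, d0)); turn (turn (turn (x, d0)))].
have l0E y d : ((y, d) \in l0) = (y == x).
  case: d => [h s]; rewrite /l0 !inE !xpair_eqE /=; case: h; case: s; by rewrite ?andbT ?andbF ?orbF /=; case: (y == x).
have T0 : tour l0 [::].
  split => //.
  - by rewrite /= !inE /turn /= !xpair_eqE !andbF.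
  - by move=> y d d'; rewrite !l0E.
  - by rewrite /= /next_in /= !rface_turn !eqxx.
  - by move=> y z d d'; rewrite !l0E => /eqP -> /eqP ->; exists [::] => //=.
have [||l [tr [T mE trE bl]]] := tour_fill (B := B r) (x := x) (d := d0) T0 _ _ xr.
- by rewrite l0E.
- by move=> y yr; apply: gm_conn GM _ _ _ xr yr.
exists l, tr, (fun _ => (x, d0)); split => //.
- move=> y d; rewrite mE l0E; split.
    by case/orP=> [yr|/eqP->]; exists r; rewrite ?inE.
  by case=> v; rewrite inE => /eqP -> ->.
- by rewrite inE.
- by move=> y z /andP[/eqP-> /eqP->]; rewrite inE.
- by move=> v; rewrite inE => ->.
- by move=> v; rewrite inE eqxx.
- by move=> v; rewrite inE => ->.
- move=> k [v]; rewrite inE => /eqP -> rk; exists r; rewrite inE eqxx; split => // v'.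
  rewrite inE => /eqP -> _; rewrite eqxx; split => // u; by case/andP=> _ /eqP ->.
- by move=> y z t /andP[-> _] /andP[_ ->].
- move=> v; rewrite inE => /eqP ->; split => //.
  apply: bl; first by move=> y z yr zr; rewrite !(@descE _ _ r).
  exists [::], (behead l0), [::]; split => //.
  have D0 : desc (fun x0 y : 'I_n => (x0 == r) && (y == r)) r x.
    by rewrite (@descE _ _ r) // eqxx.
  by rewrite /= D0.
- move=> q /trE[//|[q1 q2]]; left; by exists r.
Qed.

(** The tour is extended across the dart [p] from [u] to [w] and then fills [B w]. The new darts
    come after a dart of [B u], so they enlarge exactly the blocks of the ancestors of [u], and they
    form the block of [w]. *)
Lemma grown_step A r par anc l tr e0 u w :
  grown A r par anc l tr e0 -> u \in A -> w \notin A -> e u w ->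
  (forall k, w \in cl k -> (exists2 v, v \in A & v \in cl k) -> u \in cl k) ->
  exists par' anc' l' tr' e0', grown (w |: A) r par' anc' l' tr' e0'.
Proof.
move=> G uA wA euw Huw; have T := g_tour G.
have [p1 pt] := gm_wit GM euw; set p := W u w in p1 pt.
have nwA v : v \in A -> v != w by move=> vA; apply: contraNneq wA => <-.
have uw := nwA _ uA.
have pl : p \in l.
  by rewrite [p]surjective_pairing; apply/(g_vis G); exists u.
have ptl : (tgt p, p.2) \notin l.
  apply/negP => /(g_vis G)[v vA xv]; move: (nwA _ vA).
  by rewrite (gm_disj GM xv pt) eqxx.
have T1 := tour_insert T pl ptl.
have mem1 z d' : ((z, d') \in insert_after p (leaf_block p) l) = (z == tgt p) || ((z, d') \in l).
  by rewrite mem_insert_after // mem_leaf_block.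
have [||l' [tr' [T' mE trE bl]]] := tour_fill (B := B w) (x := tgt p) (d := p.2) T1 _ _ pt.
- by rewrite mem1 eqxx.
- by move=> y yw; apply: gm_conn GM _ _ _ pt yw.
pose anc' x y := if y == w then (x == w) || anc x u else anc x y.
have ancA x y : y \in A -> anc' x y = anc x y.
  by move=> /nwA/negbTE; rewrite /anc' => ->.
have ancN y : anc w y = false.
  by apply/negP => /(g_dom G)[]; rewrite (negbTE wA).
exists [eta par with w |-> u], anc', l', tr', [eta e0 with w |-> turn (rev_dart p)].
have dom' x y : anc' x y -> x \in w |: A /\ y \in w |: A.
  rewrite /anc' !inE; case: eqP => [->|_] /=; last by move=> /(g_dom G)[-> ->]; rewrite orbT.
  by case/orP=> [->|/(g_dom G)[-> _]]; rewrite ?orbT.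
have ancwA x : anc' x w -> x != w -> anc x u by rewrite /anc' eqxx => /orP[->|].
split => //.
- move=> x d; rewrite mE mem1; split.
    case/or3P=> [xw|/eqP->|/(g_vis G)[v vA xv]]; [exists w|exists w|exists v] => //;
      by rewrite !inE ?eqxx ?vA ?orbT.
  case=> v; rewrite !inE => /orP[/eqP->->//|vA xv]; apply/orP; right; apply/orP; right.
  by apply/(g_vis G); exists v.
- by rewrite inE (g_r G) orbT.
- move=> v; rewrite !inE /anc'; case: eqP => [->|_ /= /(g_refl G)//]; rewrite ?eqxx //.
- move=> v; rewrite !inE /anc'; case: eqP => [_ _|_ /= /(g_root G)//].
  by rewrite (g_root G) ?orbT.
- move=> v; rewrite !inE /=; case: (eqVneq v w) => [->|vw] /= vA vr.
    split; rewrite ?uA ?orbT //.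
    + by rewrite /anc' eqxx (g_refl G) ?orbT.
    + by move=> x /ancwA H xw; rewrite ancA ?H.
  have [? ? ? ? H] := g_par G vA vr; split; rewrite ?ancA ?inE //; first by apply/orP; right.
  by move=> x; rewrite !ancA //; apply: H.
(* A cluster visited before keeps its root: if it contains [w] it contains [u], and everything
   between the root and [w] is [w] or lies above [u]. A cluster met for the first time gets the root
   [w]. *)
- move=> k [v0 v0A v0k]; case: (boolP [exists v, (v \in A) && (v \in cl k)]) => [/existsP[v1 /andP[v1A v1k]]|/existsPn noA].
    have exA : exists2 v, v \in A & v \in cl k by exists v1.
    have [q [qA qk qH]] := g_clu G exA; exists q; rewrite inE qA orbT qk; split => // v.
    rewrite !inE => /orP[/eqP->|vA] vk.
      have uk := Huw _ vk exA; have [qu qB] := qH _ uA uk.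
      split; first by rewrite /anc' eqxx qu orbT.
      move=> x; case: (eqVneq x w) => [->//|xw] qx /ancwA/(_ xw) xu.
      by apply: qB => //; rewrite -(ancA q x) //; case: (g_dom G xu).
    have [qv qB] := qH _ vA vk; rewrite ancA //; split => // x qx; rewrite ancA // => xv.
    apply: qB => //; rewrite -(ancA q x) //; by case: (g_dom G xv).
  have v0w : v0 = w.
    by move: v0A (noA v0); rewrite !inE v0k andbT => /orP[/eqP//|->].
  rewrite v0w in v0k; exists w; rewrite !inE eqxx v0k; split => // v.
  rewrite !inE => /orP[/eqP->|vA] vk; last by move: (noA v); rewrite vA vk.
  split; first by rewrite /anc' eqxx.
  move=> x; rewrite {1}/anc'; case: eqP => [->//|_]; by rewrite ancN.
- move=> x y z; rewrite /anc'; case: (eqVneq z w) => [_|zw].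
    case: (eqVneq y w) => [_ xy _//|yw /= xy yu].
    by rewrite (g_trans G xy yu) orbT.
  case: (eqVneq y w) => [->|yw]; first by rewrite ancN.
  exact: (g_trans G).
- move=> v; rewrite !inE /=; case: (eqVneq v w) => [->|vw] /= vA.
    split; last by rewrite /=.
    apply: bl; first by move=> y z yw zw; rewrite !(@descE _ _ w).
    apply: block_new => //; last by rewrite (@descE _ _ w) // /anc' eqxx.
    apply/hasPn => q ql /=; rewrite [q]surjective_pairing in ql.
    have [v' v'A qv'] := (g_vis G _ _).1 ql.
    by rewrite (@descE _ _ v') // ancA // ancN.
  have [be be1] := g_block G vA; split => //.
  apply: bl; first by move=> y z yw zw; rewrite !(@descE _ _ w).
  apply: block_insert => //; first exact: (tour_uniq T).
    move=> q; rewrite mem_leaf_block => /eqP ->.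
    have aw : anc' v w = anc v u by rewrite /anc' eqxx (negbTE vw).
    by rewrite (@descE _ _ w) // (@descE _ _ u) // aw ancA.
  apply: eq_block be => q; rewrite [q]surjective_pairing => /(g_vis G)[v' v'A qv'].
  by rewrite !(@descE _ _ v') // ancA.
- move=> q /trE[|[q1 q2]]; last by left; exists w.
  rewrite !inE => /or3P[/eqP->|/eqP->|/(g_tr G)[|[v [vA vr qE]]]]; [right|right|by left|right].
  + by exists w; rewrite !inE eqxx /= eqxx; split => //; [rewrite eq_sym; apply/nwA/(g_r G)|left].
  + exists w; rewrite !inE eqxx /= eqxx; split => //; first by rewrite eq_sym; apply/nwA/(g_r G).
    by right; rewrite (gm_rev GM).
  + by exists v; rewrite !inE vA orbT /= (negbTE (nwA _ vA)).
Qed.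

Lemma grown_all r : exists par anc l tr e0, grown setT r par anc l tr e0.
Proof.
suff H N (A : {set 'I_n}) par anc l tr e0 : #|~: A| <= N -> grown A r par anc l tr e0 ->
    exists par anc l tr e0, grown setT r par anc l tr e0.
  by have [l [tr [e0 /(H _ _ _ _ _ _ _ (leqnn _))]]] := grown_start r.
elim: N A par anc l tr e0 => [|N IH] A par anc l tr e0 leN G.
  move: leN; rewrite leqn0 cards_eq0 => /eqP E.
  have AE : A = setT by rewrite -[A]setCK E setC0.
  by rewrite AE in G; exists par, anc, l, tr, e0.
case: (boolP (A == setT)) => [/eqP AE|]; first by rewrite AE in G; exists par, anc, l, tr, e0.
rewrite -subTset => /subsetPn[z _ zA].
have [u [w [uA wA euw Huw]]] := next_vertex CL (g_r G) zA.
have [par' [anc' [l' [tr' [e0' G']]]]] := grown_step G uA wA euw Huw.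
apply: IH G'; rewrite -ltnS; apply: leq_trans leN.
have -> : ~: (w |: A) = (~: A) :\ w by apply/setP => x; rewrite !inE negb_or.
by rewrite (cardsD1 w (~: A)) inE wA.
Qed.

End Growth.

End GridGrowth.

(** * Reading a layout off the tour *)

Module LayoutFromGrid.
Import MuRecursive LayoutDefs LayoutCode GridTour GridGrowth.
From mathcomp Require Import all_boot all_order all_algebra.
From mathcomp Require Import zify.

Set Implicit Arguments.
Unset Strict Implicit.
Unset Printing Implicit Defensive.
Import GRing.Theory Order.TTheory.

Lemma ballO n (P : pred nat) : (forall u : 'I_n, P u) -> ball n P.
Proof. by move=> H; apply/ballP => i lti; apply: (H (Ordinal lti)). Qed.

Lemma bexO n (P : pred nat) : (exists u : 'I_n, P u) -> bex n P.
Proof. by case=> u Pu; apply/bexP; exists u. Qed.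

Lemma block_range D e l p0 : uniq l -> block D e l ->
  exists hi, [/\ index e l <= hi, hi < size l, e \in l &
    forall i, i < size l -> (index e l <= i <= hi) = D (nth p0 l i).1].
Proof.
move=> U [s1 [s2 [s3 [lE D2 D1 D3]]]].
have e1 : e \notin s1.
  apply: contra D1 => es1; apply/hasP; exists e => //.
  by move: D2 => /= /andP[].
have iE : index e l = size s1.
  by rewrite lE index_cat (negbTE e1) /= eqxx addn0.
exists (size s1 + size s2); rewrite iE; split.
- exact: leq_addr.
- by rewrite lE !size_cat /=; lia.
- by rewrite lE !(mem_cat, inE) eqxx orbT.
move=> i lti; rewrite lE nth_cat.
case: ltnP => [lt1|ge1] /=.
  symmetry; apply/negbTE; move: D1; rewrite -all_predC => /allP/(_ _ (mem_nth p0 lt1)).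
  by [].
rewrite -cat_cons nth_cat /=; case: ltnP => [lt2|ge2].
  move/allP: D2 => /(_ (nth p0 (e :: s2) (i - size s1))) /= ->; first by lia.
  by rewrite mem_nth.
have lt3 : i - size s1 - (size s2).+1 < size s3 by move: lti; rewrite lE !size_cat /=; lia.
have -> : (i <= size s1 + size s2) = false by lia.
symmetry; apply/negbTE; move: D3; rewrite -all_predC => /allP/(_ _ (mem_nth p0 lt3)).
by [].
Qed.

Lemma layout_of_model n m (e : rel 'I_n) (cl : 'I_m -> {set 'I_n}) B W
    (a mem : nat -> nat -> bool) :
  grid_model e B W -> clustering e cl -> symmetric e -> irreflexive e -> 0 < n ->
  (forall u v : 'I_n, a u v = e u v) ->
  (forall (v : 'I_n) (k : 'I_m), mem v k = (v \in cl k)) ->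
  exists F L P, layout n m a mem (@ext n F) (@ext n L) (@ext2 n P).
Proof.
move=> GM CL sym irr n0 aE memE; pose r : 'I_n := Ordinal n0.
have [pr [anc [l [tr [e0 G]]]]] := grown_all GM CL r.
have T := g_tour G; have U := tour_uniq T.
have inT (v : 'I_n) : v \in [set: 'I_n] by rewrite inE.
pose p0 : dart := ((0%R, 0%R), (true, true)).
have H (v : 'I_n) : exists hi, [/\ index (e0 v) l <= hi, hi < size l, e0 v \in l &
    forall i, i < size l -> (index (e0 v) l <= i <= hi) = desc B anc v (nth p0 l i).1].
  by have [b _] := g_block G (inT v); apply: block_range.
have [hi {}H] := fin_all_exists H.
pose lo v := index (e0 v) l.
(* Position [i] of the tour becomes the two columns [2 * i] and [2 * i + 1]. Vertices take even
   columns and chords odd ones, so they never coincide; intervals end at an odd column to include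
   both columns of their last position. *)
pose F v := (lo v).*2; pose L v := (hi v).*2.+1.
pose P u v := (index (W u v) l).*2.+1.
exists F, L, P; set f := ext F; set g := ext L; set p := ext2 P.
have fE (v : 'I_n) : f v = (lo v).*2 by rewrite /f ext_ord.
have gE (v : 'I_n) : g v = (hi v).*2.+1 by rewrite /g ext_ord.
have pE (u v : 'I_n) : p u v = (index (W u v) l).*2.+1 by rewrite /p ext2_ord.
have covE (u v : 'I_n) q : q \in l -> q.1 \in B v ->
    (cov f g u (index q l).*2 = anc u v) * (cov f g u (index q l).*2.+1 = anc u v).
  move=> ql qv; have [_ _ _ Hu] := H u.
  have iq : index q l < size l by rewrite index_mem.
  have := Hu _ iq; rewrite nth_index // (descE GM _ _ qv) => <-.
  by rewrite /cov fE gE -/(lo u); split; lia.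
have ancE (u v : 'I_n) : LayoutDefs.anc f g u v = anc u v.
  have [_ e0v] := g_block G (inT v); have [_ _ e0l _] := H v.
  by rewrite /LayoutDefs.anc fE; case: (covE u v _ e0l e0v).
have parE (v : 'I_n) : v != r -> par n f g (pr v) v.
  move=> vr; have [_ _ a1 a2 a3] := g_par G (inT v) vr.
  rewrite /par ancE a1 a2 /=; apply: ballO => w; rewrite !ancE.
  by apply/implyP => /andP[aw nw]; apply: a3.
have Wl (u v : 'I_n) : e u v -> W u v \in l.
  move=> euv; have [W1 _] := gm_wit GM euv.
  by rewrite [W u v]surjective_pairing; apply/(g_vis G); exists u.
(* The dart of a chord is outside the grid tree: by [g_tr], a tree dart between different branch
   sets is the witness of a parent edge in one of its directions, and then [par] would hold for its
   ends. *)
have eir (u v : 'I_n) : chord n a f g u v -> [/\ e u v, W u v \in l, W v u \in l,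
    W u v \notin tr & W v u = rev_dart (W u v)].
  move=> /andP[]; rewrite aE negb_or => euv /andP[nt1 nt2].
  split; rewrite ?Wl // 1?sym //; last exact: (gm_rev GM euv).
  have [W1 W2] := gm_wit GM euv.
  apply/negP => /(g_tr G)[[v' [b1 b2]]|[w [_ wr qE]]].
    have uv : u = v by rewrite (gm_disj GM W1 b1) (gm_disj GM W2 b2).
    by rewrite uv irr in euv.
  have [_ ew _ _ _] := g_par G (inT w) wr; have pw := parE _ wr.
  case: qE => qE.
    have [Z1 Z2] := gm_wit GM ew; rewrite -qE in Z1 Z2.
    by move: nt1; rewrite (gm_disj GM W1 Z1) (gm_disj GM W2 Z2) pw.
  have ew' : e w (pr w) by rewrite sym.
  have [Z1 Z2] := gm_wit GM ew'; rewrite -qE in Z1 Z2.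
  by move: nt2; rewrite (gm_disj GM W1 Z1) (gm_disj GM W2 Z2) pw.
have lo_inj (u v : 'I_n) : lo u = lo v -> u = v.
  move=> E; have [_ eu] := g_block G (inT u); have [_ ev] := g_block G (inT v).
  have [_ _ ul _] := H u; have [_ _ vl _] := H v.
  have : e0 u = e0 v by rewrite -(nth_index p0 ul) -(nth_index p0 vl) -!/(lo _) E.
  by move=> E'; rewrite E' in eu; apply: (gm_disj GM eu ev).
have Wnth (u v : 'I_n) : W u v \in l -> nth p0 l (index (W u v) l) = W u v by apply: nth_index.
apply/and5P; split; last (apply/and4P; split).
- by apply: ballO => u; rewrite fE gE; have [le _ _ _] := H u; rewrite /lo; lia.
- apply: ballO => u; apply: ballO => v; rewrite !fE; apply/implyP => E.
  by apply/eqP; congr val; apply: lo_inj; lia.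
- apply: ballO => u; apply: ballO => v; rewrite ancE !gE; apply/implyP => auv.
  have [_ hv _ Hv] := H v; have [_ _ _ Hu] := H u.
  have := Hv _ hv; rewrite leqnn andbT; have [-> _ _ _] := H v => /esym /existsP[x /andP[avx xB]].
  have : desc B anc u (nth p0 l (hi v)).1 by apply/existsP; exists x; rewrite (g_trans G auv avx).
  by rewrite -Hu // => /andP[_ lehi]; lia.
- apply: ballO => v; case: (eqVneq v r) => [->|vr].
    by apply/orP; left; apply: ballO => u; rewrite ancE; apply: (g_root G).
  apply/orP; right; apply: bexO; exists (pr v); rewrite parE // aE.
  by have [_ -> _ _ _] := g_par G (inT v) vr.
- apply: ballO => k; apply: bexO.
  have [v0 v0k] := cl_ne CL k.
  have [|q [_ qk qH]] := g_clu G (k := k); first by exists v0.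
  exists q; rewrite memE qk /=; apply: ballO => v; rewrite memE; apply/implyP => vk.
  have [qv qB] := qH _ (inT v) vk; rewrite ancE qv /=; apply: ballO => u; rewrite !ancE memE.
  by apply/implyP => /andP[]; apply: qB.
- apply: ballO => u; apply: ballO => v; apply/implyP => /eir[euv Wuv _ _ _].
  have [W1 _] := gm_wit GM euv.
  apply/andP; split; last by apply: ballO => w; rewrite pE fE; lia.
  rewrite /top pE (covE u u) // (g_refl G) //=; apply: ballO => w.
  by rewrite ancE (covE w u) // implybb.
- apply: ballO => u; apply: ballO => v; apply: ballO => u'; apply: ballO => v'.
  apply/implyP => /and3P[/eir[euv Wuv _ _ _] /eir[euv' Wuv' _ _ _]]; rewrite !pE => /eqP E.
  have EW : W u v = W u' v' by rewrite -(Wnth _ _ Wuv) -(Wnth _ _ Wuv'); congr nth; lia.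
  have [W1 W2] := gm_wit GM euv; have [W1' W2'] := gm_wit GM euv'; rewrite -EW in W1' W2'.
  by rewrite (gm_disj GM W1 W1') (gm_disj GM W2 W2') !eqxx.
- apply: ballO => u; apply: ballO => v; apply: ballO => u'; apply: ballO => v'.
  apply/implyP => /andP[/eir[euv Wuv Wvu Wt Wr] /eir[euv' Wuv' Wvu' Wt' Wr']]; rewrite !pE.
  rewrite !ltnS !ltn_double Wr Wr' in Wvu Wvu' *.
  apply/negP => /and3P[l1 l2 l3].
  have ne : ~~ same_edge (W u v) (W u' v').
    apply/negP; rewrite /same_edge => /orP[/eqP E|/eqP E]; first by rewrite E ltnn in l1.
    by rewrite E ltnn in l2.
  by have := tour_noncrossing T Wuv Wvu Wuv' Wvu' Wt Wt' ne; rewrite l1 l2 l3.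
Qed.

End LayoutFromGrid.

(** * Facts on the tree of clusters *)

Module ClusterTrees.
Import MuRecursive LayoutDefs LayoutCode GridTour GridGrowth LayoutFromGrid.
From mathcomp Require Import all_boot all_order all_algebra.
From mathcomp Require Import zify.

Set Implicit Arguments.
Unset Strict Implicit.
Unset Printing Implicit Defensive.

Section ClusterTreeFacts.
Variables (n m : nat) (C : cgraph n m).

Lemma ancestor_subset k j : ancestor (parent C) j (inr k) ->
  vcluster C k \subset vcluster C j.
Proof.
move=> jk; apply/fintype.subsetP => v; rewrite !inE => vk.
exact: connect_trans vk jk.
Qed.

(** Both clusters are on the only upward path from [v]. *)
Lemma vcluster_chain v k j : v \in vcluster C k -> v \in vcluster C j ->
  ancestor (parent C) k (inr j) \/ ancestor (parent C) j (inr k).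
Proof.
rewrite !inE => /ancestor_iter[//|i _ ik] /ancestor_iter[//|i' _ ij].
wlog le : i i' k j ik ij / i <= i' => [H|].
  case/orP: (leq_total i i') => le; first exact: H ik ij le.
  by have [|] := H _ _ _ _ ij ik le; [right|left].
right; move: ij; rewrite -(subnK le) iterD ik; case: (i' - i) => [[->]|d].
  exact: connect0.
by rewrite iterSr /=; apply: iter_ancestor.
Qed.

(** A child of an empty cluster is an empty cluster too, hence the same one by injectivity. A
    cluster that is its own parent can reach no other node, so it would be the root, which has no
    parent. *)
Lemma vcluster_neq0 k : exists v, v \in vcluster C k.
Proof.
case: (boolP (vcluster C k == set0)) => [/eqP k0|/set0Pn//].
have [[v|k'] pk] := cgraph_internal C k.
  by exists v; rewrite inE; apply: connect1; rewrite /tree_up pk eqxx.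
have ak : ancestor (parent C) k (inr k') by apply: connect1; rewrite /tree_up pk eqxx.
have k'0 : vcluster C k' = set0.
  by apply/eqP; rewrite -subset0 -k0; apply: ancestor_subset.
have kk : k' = k by apply: (@cgraph_inj _ _ C); rewrite -!/(vcluster C _) k0 k'0.
rewrite kk in pk.
have [r pr rc] := cgraph_tree C.
have /connectP[q pq rE] := rc (inr k).
suff rk : r = inr k by rewrite rk pk in pr.
rewrite rE; elim: q pq {rE} => //= y q IH /andP[]; rewrite {1}/tree_up.
by case: y => // j; rewrite pk => /eqP[<-]; apply: IH.
Qed.

Lemma vcluster_top : (forall u v : 'I_n, u = v) \/ exists2 k, parent C (inr k) = None & vcluster C k = setT.
Proof.
have [[r|k] pr rc] := cgraph_tree C; last first.
  by right; exists k => //; apply/setP => v; rewrite !inE; apply: rc.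
left; suff H u : u = r by move=> u v; rewrite (H u) (H v).
have /connectP[q pq rE] := rc (inl u); case/lastP: q pq rE => [_ [->]//|q y].
rewrite last_rcons => + rE; rewrite -rE rcons_path => /andP[_]; by rewrite /tree_up.
Qed.

Lemma cgraph_order_gt0 : 0 < n.
Proof.
have [[r|k] pr rc] := cgraph_tree C; first exact: leq_ltn_trans (ltn_ord r).
by have [v _] := vcluster_neq0 k; apply: leq_ltn_trans (ltn_ord v).
Qed.

Lemma clustering_of_cgraph : c_connected C -> clustering (adj C) (vcluster C).
Proof.
move=> cc; split.
- move=> k j v vk vj; case: (vcluster_chain vk vj) => /ancestor_subset ->; rewrite ?orbT //.
- exact: vcluster_neq0.
- exact: cc.
- by case: vcluster_top => [|[k _ kE]]; [left | right; exists k].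
Qed.

End ClusterTreeFacts.

Lemma layout_exists n m (C : cgraph n m) B W : c_connected C ->
  grid_model (adj C) B W ->
  exists F L P, layout n m (adjC C) (memC C) (@ext n F) (@ext n L) (@ext2 n P).
Proof.
move=> cc GM.
apply: layout_of_model GM (clustering_of_cgraph cc) (@cgraph_sym _ _ C) (@cgraph_irr _ _ C)
  (cgraph_order_gt0 C) _ _.
- exact: adjC_ord.
- exact: memC_ord.
Qed.

End ClusterTrees.

(** * Following curves by walks on a fine grid *)

Module MeshWalks.
Import GridTour GridGrowth.
From mathcomp Require Import all_boot all_order all_algebra.
From mathcomp Require Import all_classical all_reals all_analysis.
From mathcomp Require Import zify lra.

Set Implicit Arguments.
Unset Strict Implicit.
Unset Printing Implicit Defensive.
Import Order.TTheory GRing.Theory Num.Theory.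
Import numFieldNormedType.Exports.
Local Open Scope classical_set_scope.
Local Open Scope ring_scope.

Section Mesh.
Variable R : realType.
Implicit Types (p q : R * R) (K L : set (R * R)).

Lemma prod_norm_le p (c : R) : (`|p| <= c) = (`|p.1| <= c) && (`|p.2| <= c).
Proof. by rewrite prod_normE ge_max. Qed.

Lemma prod_norm_lt p (c : R) : (`|p| < c) = (`|p.1| < c) && (`|p.2| < c).
Proof. by rewrite prod_normE gt_max. Qed.

Lemma compact_separated K L : compact K -> compact L -> K `&` L = set0 ->
  exists2 d : R, 0 < d & forall x y, K x -> L y -> d <= `|x - y|.
Proof.
move=> cK cL KL.
have clL : closed L by apply: compact_closed => //; exact: norm_hausdorff.
have : \forall d \near (0 : R)^'+, K `<=` (fun x => forall y, L y -> d <= `|x - y|).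
  move/compact_near_coveringP: cK; apply => x Kx.
  have nLx : ~ L x by move=> Lx; have : (K `&` L) x by []; rewrite KL.
  have : nbhs x (~` L) by apply: open_nbhs_nbhs; split => //; exact: closed_openC.
  move=> /nbhs_ballP[r /= r0 rL].
  near=> x' d => y Ly /=.
  have h1 : `|x - x'| < r / 2.
    have : ball x (r / 2) x' by near: x'; apply: nbhsx_ballx; rewrite divr_gt0.
    by rewrite -ball_normE.
  have h2 : r <= `|x - y|.
    rewrite leNgt; apply/negP => lt; apply: (rL y) => //.
    by rewrite -ball_normE.
  have h3 : d < r / 2 by near: d; apply: nbhs_right_lt; rewrite divr_gt0.
  have h4 : `|x - y| <= `|x - x'| + `|x' - y|.
    by rewrite -[x - y](subrKA x') ler_normD.
  lra.
move=> H; near (0 : R)^'+ => d; exists d => //.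
by move=> x y Kx Ly; apply: (near H d).
Unshelve. all: by end_near. Qed.

Definition node (h : R) (z : gpoint) : R * R := (h * z.1%:~R, h * z.2%:~R).
(** A point is represented by the lower left corner of its square of side [h], so [cell] takes
    values among the grid points. *)
Definition cell (h : R) p : gpoint := (Num.floor (p.1 / h), Num.floor (p.2 / h)).
Definition nodes (x : gpoint) (w : seq dart) : seq gpoint := x :: map tgt w.

Lemma floor_close (h x : R) : 0 < h -> `|h * (Num.floor (x / h))%:~R - x| <= h.
Proof.
move=> h0; have /andP[l1 l2] := floor_itv (x / h).
move: l2; rewrite intrD => l2; set c := (Num.floor _)%:~R in l1 l2 *.
have e : x = h * (x / h) by rewrite mulrCA divff ?mulr1 // gt_eqF.
rewrite e -mulrBr normrM (gtr0_norm h0) -[leRHS]mulr1 ler_pM2l // ler_norml.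
by apply/andP; split; lra.
Qed.

Lemma floor_step (h x y : R) : 0 < h -> `|x - y| < h ->
  let i := Num.floor (x / h) in let j := Num.floor (y / h) in
  [\/ i = j, j = i + 1 | i = j + 1].
Proof.
move=> h0 xy i j; have := floor_itv (x / h); have := floor_itv (y / h); rewrite -/i -/j.
move=> /andP[a1 a2] /andP[b1 b2].
have : `|x / h - y / h| < 1 by rewrite -mulrBl normrM normfV (gtr0_norm h0) ltr_pdivrMr // mul1r.
rewrite ltr_norml => /andP[c1 c2].
have d1 : i%:~R < j%:~R + 2%:R :> R by move: a2; rewrite intrD; lra.
have d2 : j%:~R < i%:~R + 2%:R :> R by move: b2; rewrite intrD; lra.
have e1 : i < j + 2.
  by rewrite -(ltr_int R) intrD.
have e2 : j < i + 2.
  by rewrite -(ltr_int R) intrD.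
case: (ltgtP i j) => cij; [apply: Or32|apply: Or33|apply: Or31] => //; clear -e1 e2 cij; lia.
Qed.

(** The floors differ by at most 1 in each coordinate, so one horizontal and one vertical step
    suffice. *)
Lemma cell_step (h : R) p q : 0 < h -> `|p - q| < h ->
  exists2 w, walk (cell h p) w (cell h q) &
    forall z, z \in nodes (cell h p) w -> `|node h z - q| <= 2 * h.
Proof.
move=> h0; rewrite prod_norm_lt => /andP[l1 l2].
have close1 x y : `|x - y| < h -> `|h * (Num.floor (x / h))%:~R - y| <= 2 * h.
  move=> xy; rewrite -[_ - y](subrKA x).
  by apply: le_trans (ler_normD _ _) _; have := floor_close x h0; lra.
have close0 y : `|h * (Num.floor (y / h))%:~R - y| <= 2 * h.
  by have := floor_close y h0; lra.
have hor (i i' j : int) : [\/ i = i', i' = i + 1 | i = i' + 1] ->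
    exists2 w, walk (i, j) w (i', j) & map tgt w = [::] /\ i = i' \/ map tgt w = [:: (i', j)].
  case=> [->|->|->]; first by exists [::] => //=; left.
    by exists [:: ((i, j), (true, true))]; rewrite /= ?eqxx //; right.
  exists [:: ((i' + 1, j), (true, false))] => /=; first by rewrite eqxx /= addrK eqxx.
  by right; rewrite addrK.
have ver (i j j' : int) : [\/ j = j', j' = j + 1 | j = j' + 1] ->
    exists2 w, walk (i, j) w (i, j') & map tgt w = [::] /\ j = j' \/ map tgt w = [:: (i, j')].
  case=> [->|->|->]; first by exists [::] => //=; left.
    by exists [:: ((i, j), (false, true))]; rewrite /= ?eqxx //; right.
  exists [:: ((i, j' + 1), (false, false))] => /=; first by rewrite eqxx /= addrK eqxx.
  by right; rewrite addrK.
have [w1 W1 N1] := hor _ _ (Num.floor (p.2 / h)) (floor_step h0 l1).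
have [w2 W2 N2] := ver (Num.floor (q.1 / h)) _ _ (floor_step h0 l2).
exists (w1 ++ w2); first exact: walk_cat W1 W2.
move=> z; rewrite inE map_cat mem_cat => zin.
have : [\/ z = cell h p, z = (Num.floor (q.1 / h), Num.floor (p.2 / h)) | z = cell h q].
  case/or3P: zin => [/eqP ->|z1|z2]; first exact: Or31.
    by case: N1 z1 => [[->]//|->]; rewrite inE => /eqP ->; apply: Or32.
  by case: N2 z2 => [[->]//|->]; rewrite inE => /eqP ->; apply: Or33.
by case=> ->; rewrite prod_norm_le /= ?close0 ?close1.
Qed.

(** Connectedness of the interval replaces a uniform subdivision: since closeness of [g t] and
    [g t'] is symmetric, the parameters reached by good walks and those not reached both form
    relatively open sets. *)
Lemma curve_walk (g : R -> R * R) (a b h : R) : 0 < h -> a <= b ->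
  {within `[a, b], continuous g} ->
  exists2 w, walk (cell h (g a)) w (cell h (g b)) &
    forall z, z \in nodes (cell h (g a)) w ->
      exists2 t, a <= t <= b & `|node h z - g t| <= 2 * h.
Proof.
move=> h0 ab cg.
pose good t := exists2 w, walk (cell h (g a)) w (cell h (g t)) &
    forall z, z \in nodes (cell h (g a)) w ->
      exists2 t, a <= t <= b & `|node h z - g t| <= 2 * h.
have step t t' : a <= t' <= b -> `|g t - g t'| < h -> good t -> good t'.
  move=> t'ab gt [w W N]; have [w' W' N'] := cell_step h0 gt.
  exists (w ++ w'); first exact: walk_cat W W'.
  move=> z; rewrite inE map_cat mem_cat orbA => /orP[zw|zw]; first exact: N.
  by exists t' => //; apply: N'; rewrite inE zw orbT.
have loc t : a <= t <= b -> exists2 r : R, 0 < r & forall t', a <= t' <= b -> `|t - t'| < r -> `|g t - g t'| < h.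
  move=> tab; have := (iffLR (subspace_continuousP _ _) cg) t; rewrite /= in_itv /= => /(_ tab).
  move=> /cvgrPdist_lt/(_ _ h0); rewrite near_withinE => /nbhs_ballP[r /= r0 rP].
  by exists r => // t' t'ab tt'; apply: rP; rewrite /= ?in_itv.
pose A := `[a, b]%classic; pose Bs := A `&` [set t | good t].
have ball_open (P : set R) : exists2 C, open C & A `&` P `<=` C /\ forall t', A t' -> C t' ->
   exists t, [/\ (A `&` P) t, `|g t - g t'| < h & `|g t' - g t| < h].
  pose C := \bigcup_(u in [set u : R * R | (A `&` P) u.1 /\ 0 < u.2 /\ forall t', a <= t' <= b -> `|u.1 - t'| < u.2 -> `|g u.1 - g t'| < h]) ball u.1 u.2.
  exists C; first by apply: bigcup_open => -[t r] _; exact: ball_open.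
  split => [t [At Pt]|t' At' [[t r]] /= [APt [r0 rP]] tt'].
    have tab : a <= t <= b by move: At; rewrite /A /= in_itv.
    have [r r0 rP] := loc _ tab; exists (t, r) => //=; exact: ballxx.
  exists t; have H : `|g t - g t'| < h.
    by apply: rP; [move: At'; rewrite /A /= in_itv | rewrite -ball_normE in tt'].
  by split => //; rewrite distrC.
have Bs_eq : Bs = A.
  apply: (@segment_connected R a b).
  - exists a; split; first by rewrite /A /= in_itv /= lexx ab.
    exists [::]; first by rewrite /= eqxx.
    move=> z; rewrite inE => /eqP ->; exists a; first by rewrite lexx ab.
    have [w _ N] := @cell_step h (g a) (g a) h0 (eq_ind_r (fun x => x < h) h0 (etrans (congr1 _ (subrr (g a))) (normr0 _))).
    by apply: N; rewrite inE eqxx.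
  - have [C oC [sub H]] := ball_open [set t | good t]; exists C => //.
    apply/seteqP; split => [t [At gt]|t [At Ct]]; first by split => //; apply: sub.
    split => //; have [s [[As gs] l1 l2]] := H _ At Ct.
    by apply: step gs => //; move: At; rewrite /A /= in_itv.
  - have [C oC [sub H]] := ball_open [set t | ~ good t]; exists (~` C); first exact: open_closedC.
    apply/seteqP; split => [t [At gt]|t [At nCt]].
      split => // Ct; have [s [[As ngs] l1 l2]] := H _ At Ct; apply: ngs.
      by apply: step gt => //; move: As; rewrite /A /= in_itv.
    by split => //; apply: contrapT => ngt; apply: nCt; apply: sub.
have : Bs b by rewrite Bs_eq /A /= in_itv /= lexx ab.
by case.
Qed.

End Mesh.

End MeshWalks.

(** * A grid model from a planar drawing *)

Module PlanarToGrid.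
Import GridTour GridGrowth MeshWalks.
From mathcomp Require Import all_boot all_order all_algebra.
From mathcomp Require Import all_classical all_reals all_analysis.
From mathcomp Require Import zify lra.

Set Implicit Arguments.
Unset Strict Implicit.
Unset Printing Implicit Defensive.
Import Order.TTheory GRing.Theory Num.Theory.
Import numFieldNormedType.Exports.
Local Open Scope classical_set_scope.
Local Open Scope ring_scope.

Lemma linked_refl B x : linked B x x.
Proof. by exists [::]; rewrite /= ?eqxx. Qed.

Lemma linked_trans B y x z : linked B x y -> linked B y z -> linked B x z.
Proof.
move=> [w W A] [w' W' A']; exists (w ++ w'); first exact: walk_cat W W'.
by rewrite all_cat A A'.
Qed.

Lemma linked_sym B x y : linked B x y -> linked B y x.
Proof.
case=> w; elim: w x => [|e w IH] x /=; first by move=> /eqP -> _; apply: linked_refl.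
case/andP=> /eqP <- W /andP[/andP[e1 et] A]; apply: linked_trans (IH _ W A) _.
exists [:: rev_dart e].
  by apply/andP; split; [exact: eqxx | rewrite tgt_rev; exact: eqxx].
by apply/andP; split => //; rewrite tgt_rev e1 et.
Qed.

Lemma linked_mono B B' x y : {subset B <= B'} -> linked B x y -> linked B' x y.
Proof.
move=> sub [w W A]; exists w => //; apply: sub_all A => e /andP[/sub -> /sub ->] //.
Qed.

Lemma linked_nodes B x w y : walk x w y -> {subset nodes x w <= B} ->
  forall z, z \in nodes x w -> linked B x z.
Proof.
elim: w x => [|e w IH] x /=; first by move=> _ _ z; rewrite inE => /eqP ->; apply: linked_refl.
case/andP=> /eqP <- W sub z; rewrite inE => /orP[/eqP ->|zw]; first exact: linked_refl.
have sub' : {subset nodes (tgt e) w <= B} by move=> t tw; apply: sub; rewrite inE tw orbT.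
apply: linked_trans (IH _ W sub' _ zw); exists [:: e]; first by rewrite /= !eqxx.
by rewrite /= sub ?inE ?eqxx // sub ?inE ?eqxx ?orbT.
Qed.

Lemma walk_last x w y : walk x w y -> y \in nodes x w.
Proof.
elim: w x => [|e w IH] x /=; first by move=> /eqP ->; rewrite inE.
by case/andP=> _ /IH; rewrite inE => H; apply/orP; right.
Qed.

Lemma walk_first_hit (P : pred gpoint) x w y : walk x w y -> ~~ P x -> P y ->
  exists w1 e, [/\ walk x w1 e.1, {subset nodes x w1 <= nodes x w},
    {in nodes x w1, forall z, ~~ P z} & P (tgt e)].
Proof.
elim: w x => [|e w IH] x /=; first by move=> /eqP -> /negbTE ->.
case/andP=> /eqP ex W Px Py; case: (boolP (P (tgt e))) => Pt.
  exists [::], e; rewrite /= ex; split => //; first by move=> z; rewrite !inE => ->.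
  by move=> z; rewrite inE => /eqP ->.
have [w1 [e' [W1 sub nP Pe]]] := IH _ W Pt Py.
exists (e :: w1), e'; rewrite /= ex eqxx; split => //.
  by move=> z; rewrite !inE => /orP[->//|/sub]; rewrite inE => ->; rewrite orbT.
by move=> z; rewrite inE => /orP[/eqP ->//|]; apply: nP.
Qed.

Lemma seq_lower_bound (R : realType) (T : eqType) (D : T -> R) (s : seq T) :
  (forall x, 0 < D x) -> exists2 d, 0 < d & {in s, forall x, d <= D x}.
Proof.
move=> D0; elim: s => [|x s [d d0 H]]; first by exists 1.
exists (Num.min d (D x)); first by rewrite lt_min d0 D0.
by move=> y; rewrite inE ge_min => /orP[/eqP ->|/H ->//]; rewrite lexx orbT.
Qed.

Section PlanarGrid.
Variables (R : realType) (n : nat) (e : rel 'I_n).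
Hypotheses (e_sym : symmetric e) (e_irr : irreflexive e).
Variables (pt : 'I_n -> R * R) (curve : 'I_n * 'I_n -> set (R * R)).
Hypothesis GD : graph_drawing e pt curve.
Hypothesis disj : {in edges e &, forall a b, a != b -> curve a `&` curve b = set0}.
Variable G : 'I_n * 'I_n -> R -> R * R.
Hypothesis HG : forall a, a \in edges e ->
  [/\ {within `[0, 1], continuous (G a)}, {in `[0, 1] &, injective (G a)},
      G a 0 = pt a.1, G a 1 = pt a.2 & curve a = G a @` `]0, 1[].

Lemma interior_curve a t : a \in edges e -> 0 < t < 1 -> curve a (G a t).
Proof. by move=> /HG[_ _ _ _ ->] t01; exists t; rewrite //= in_itv. Qed.

Lemma curve_at_vertex a t w : a \in edges e -> 0 <= t <= 1 -> G a t = pt w ->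
  (t = 0 /\ a.1 = w) \/ (t = 1 /\ a.2 = w).
Proof.
move=> aE /andP[t0 t1] E; have [_ _ G0 G1 _] := HG aE.
case: (eqVneq t 0) => [tE|tn0].
  by left; split => //; apply: (gd_inj GD); rewrite -G0 -E tE.
case: (eqVneq t 1) => [tE|tn1].
  by right; split => //; apply: (gd_inj GD); rewrite -G1 -E tE.
case: (gd_vertex GD (v := w) aE); rewrite -E; apply: interior_curve => //.
by rewrite !lt_neqAle t0 t1 tn1 eq_sym tn0.
Qed.

Lemma curves_meet a b t s : a \in edges e -> b \in edges e -> a != b ->
  0 <= t <= 1 -> 0 <= s <= 1 -> G a t = G b s -> exists w, G a t = pt w.
Proof.
move=> aE bE ab /andP[t0 t1] /andP[s0 s1] E.
have [_ _ G0 G1 _] := HG aE; have [_ _ G0' G1' _] := HG bE.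
case: (eqVneq t 0) => [->|tn0]; first by exists a.1.
case: (eqVneq t 1) => [->|tn1]; first by exists a.2.
case: (eqVneq s 0) => [sE|sn0]; first by exists b.1; rewrite E sE.
case: (eqVneq s 1) => [sE|sn1]; first by exists b.2; rewrite E sE.
have : (curve a `&` curve b) (G a t).
  split; [|rewrite E]; apply: interior_curve => //;
    by rewrite !lt_neqAle ?t0 ?t1 ?s0 ?s1 ?tn1 ?sn1 eq_sym ?tn0 ?sn0.
by rewrite disj.
Qed.

Let third (j : nat) : R := j%:R / 3%:R.

(** Curves are cut into thirds: an outer third belongs to the star of its end and the middle third
    stays separate. Different stars are disjoint, so are different middle thirds, and a middle third
    meets no star but those of its own ends. *)
Definition star u (x : R * R) : Prop := x = pt u \/
  exists a t, [/\ a \in edges e, x = G a t &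
    (0 <= t <= third 1 /\ a.1 = u) \/ (third 2 <= t <= 1 /\ a.2 = u)].
Definition mid a (x : R * R) : Prop := exists2 t, third 1 <= t <= third 2 & x = G a t.

Lemma star_vertex u w : star u (pt w) -> u = w.
Proof.
case=> [/(gd_inj GD)//|[a [t [aE E H]]]].
have t01 : 0 <= t <= 1 by case: H => -[/andP[]]; rewrite /third => *; lra.
case: (curve_at_vertex aE t01 (esym E)) => -[tE <-]; case: H => -[/andP[l1 l2] <-] //;
  by exfalso; move: l1 l2; rewrite tE /third; lra.
Qed.

Lemma star_disjoint u v x : star u x -> star v x -> u = v.
Proof.
case=> [->|[a [t [aE E H]]]]; first by move=> /star_vertex.
case=> [xE|[b [s [bE E' H']]]].
  by apply: star_vertex; rewrite -xE; right; exists a, t.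
have t01 : 0 <= t <= 1 by case: H => -[/andP[]]; rewrite /third => *; lra.
have s01 : 0 <= s <= 1 by case: H' => -[/andP[]]; rewrite /third => *; lra.
case: (eqVneq a b) => [ab|ab].
  have [_ inj _ _ _] := HG aE.
  have ts : t = s by apply: inj; rewrite ?in_itv //= -E E' ab.
  case: H => -[/andP[h1 h2] <-]; case: H' => -[/andP[h3 h4] <-]; rewrite ab // ; exfalso;
    move: h1 h2 h3 h4; rewrite ts /third; lra.
have [w xw] := curves_meet aE bE ab t01 s01 (etrans (esym E) E').
have -> : u = w by apply: star_vertex; rewrite -xw -E; right; exists a, t.
by symmetry; apply: star_vertex; rewrite -xw -E; right; exists b, s.
Qed.

Lemma mid_star a v x : a \in edges e -> mid a x -> star v x -> a.1 = v \/ a.2 = v.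
Proof.
move=> aE [t /andP[t1 t2] E] S; rewrite /third in t1 t2.
have t01 : 0 <= t <= 1 by lra.
have nv w : G a t <> pt w.
  by move=> /(curve_at_vertex aE t01)[] [tE _]; move: t1 t2; rewrite tE; lra.
case: S => [xv|[b [s [bE E' H]]]]; first by case: (nv v); rewrite -E.
have s01 : 0 <= s <= 1 by case: H => -[/andP[]]; rewrite /third => *; lra.
case: (eqVneq a b) => [->|ab]; first by case: H => -[_ ->]; [left|right].
by have [w /nv] := curves_meet aE bE ab t01 s01 (etrans (esym E) E').
Qed.

Lemma mid_disjoint a b x : a \in edges e -> b \in edges e -> mid a x -> mid b x -> a = b.
Proof.
move=> aE bE [t /andP[t1 t2] E] [s /andP[s1 s2] E']; rewrite /third in t1 t2 s1 s2.
have t01 : 0 <= t <= 1 by lra.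
have s01 : 0 <= s <= 1 by lra.
case: (eqVneq a b) => // ab.
have [w] := curves_meet aE bE ab t01 s01 (etrans (esym E) E').
by move=> /(curve_at_vertex aE t01)[] [tE _]; exfalso; move: t1 t2; rewrite tE; lra.
Qed.

Let piece : Type := (('I_n * 'I_n) * 'I_3 + 'I_n)%type.
Let K (i : piece) : set (R * R) :=
  match i with
  | inl (a, j) => if a \in edges e then G a @` `[third j, third j.+1] else set0
  | inr v => [set pt v] end.

Lemma third_itv (j : 'I_3) : 0 <= third j <= third j.+1 /\ third j.+1 <= 1.
Proof. by case: j => [[|[|[|]]]] //= _; rewrite /third; split; lra. Qed.

Lemma piece_continuous a (j : 'I_3) : a \in edges e ->
  {within `[third j, third j.+1], continuous (G a)}.
Proof.
move=> aE; have [c _ _ _ _] := HG aE; apply: continuous_subspaceW c.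
move=> t /=; rewrite !in_itv /=; have [/andP[h1 h2] h3] := third_itv j.
by move=> /andP[h4 h5]; apply/andP; split; lra.
Qed.

Lemma piece_compact i : compact (K i).
Proof.
case: i => [[a j]|v] /=; last exact: compact_set1.
case: ifP => [aE|_]; last exact: compact0.
by apply: continuous_compact; [exact: piece_continuous | exact: segment_compact].
Qed.

(** [N v] collects the grid walks along the star of [v]. The branch set [B v] adds, for each edge
    whose smaller end is [v], the walk along the middle third cut off just before it first enters
    [N] of the other end; the entering dart is the witness of the edge. *)
Lemma planar_grid : exists B W, grid_model e B W.
Proof.
have Hd (ij : piece * piece) : exists d : R, 0 < d /\ (K ij.1 `&` K ij.2 = set0 ->
    forall x y, K ij.1 x -> K ij.2 y -> d <= `|x - y|).
  case: (pselect (K ij.1 `&` K ij.2 = set0)) => [E|nE]; last by exists 1; split.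
  have [d d0 H] := compact_separated (@piece_compact ij.1) (@piece_compact ij.2) E.
  by exists d.
have [D HD] := choice Hd.
have [d d0 Hmin] := seq_lower_bound (enum {: piece * piece}) (fun ij => (HD ij).1).
(* Two pieces that are both within [2 * h] of one node are at distance at most [4 * h < d], and by
   the choice of [d] they then intersect. *)
pose h := d / 5%:R.
have h0 : 0 < h by rewrite divr_gt0.
pose near i z := exists2 x, K i x & `|node h z - x| <= 2 * h.
have sep i j z : near i z -> near j z -> exists x, K i x /\ K j x.
  move=> [x Kx lx] [y Ky ly]; case: (pselect (K i `&` K j = set0)) => [E|/eqP/set0P[t [? ?]]]; last by exists t.
  have := (HD (i, j)).2 E x y Kx Ky.
  have := Hmin (i, j); rewrite mem_enum => /(_ isT) => l1 l2.
  have l3 : `|x - y| <= `|node h z - x| + `|node h z - y|.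
    by rewrite (distrC (node h z) x) -[x - y](subrKA (node h z)) ler_normD.
  by rewrite /h in lx ly; lra.
pose st a (j : nat) := cell h (G a (third j)).
have Hw (aj : ('I_n * 'I_n) * 'I_3) : exists w, aj.1 \in edges e ->
    walk (st aj.1 aj.2) w (st aj.1 aj.2.+1) /\
    forall z, z \in nodes (st aj.1 aj.2) w -> near (inl aj) z.
  case: (boolP (aj.1 \in edges e)) => [aE|_]; last by exists [::].
  have [/andP[_ le] _] := third_itv aj.2.
  have [w W N] := curve_walk h0 le (@piece_continuous _ aj.2 aE).
  exists w => _; split => // z /N[t tE lt]; exists (G aj.1 t) => //.
  by case: aj aE tE {le W N lt} => a j /= -> tE; exists t; rewrite //= in_itv.
have [wk Hwk] := choice Hw.
pose j0 : 'I_3 := @Ordinal 3 0 isT; pose j1 : 'I_3 := @Ordinal 3 1 isT; pose j2 : 'I_3 := @Ordinal 3 2 isT.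
pose E1 v := [seq a <- enum (edges e) | a.1 == v].
pose E2 v := [seq a <- enum (edges e) | a.2 == v].
have E1P v a : (a \in E1 v) = (a.1 == v) && (a \in edges e) by rewrite mem_filter mem_enum.
have E2P v a : (a \in E2 v) = (a.2 == v) && (a \in edges e) by rewrite mem_filter mem_enum.
pose N v := cell h (pt v) ::
  flatten [seq nodes (st a 0) (wk (a, j0)) | a <- E1 v] ++
  flatten [seq nodes (st a 2) (wk (a, j2)) | a <- E2 v].
have NP v z : z \in N v -> exists i, near i z /\ forall x, K i x -> star v x.
  rewrite inE mem_cat => /or3P[/eqP ->|/flatten_mapP[a]|/flatten_mapP[a]].
  - exists (inr v); split; last by move=> x /= ->; left.
    exists (pt v) => //; have lt : `|pt v - pt v| < h by rewrite subrr normr0.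
    by have [w _] := cell_step h0 lt; apply; rewrite inE eqxx.
  - rewrite E1P => /andP[/eqP <- aE] zw; have [_ H] := Hwk (a, j0) aE.
    exists (inl (a, j0)); split; first exact: H.
    move=> x /=; rewrite aE => -[t]; rewrite /= in_itv /= => t01 <-; right; exists a, t.
    by split => //; left; split => //; move: t01; rewrite /third; lra.
  - rewrite E2P => /andP[/eqP <- aE] zw; have [_ H] := Hwk (a, j2) aE.
    exists (inl (a, j2)); split; first exact: H.
    move=> x /=; rewrite aE => -[t]; rewrite /= in_itv /= => t01 <-; right; exists a, t.
    by split => //; right; split => //; move: t01; rewrite /third; lra.
have Ndisj u v z : z \in N u -> z \in N v -> u = v.
  move=> /NP[i [zi si]] /NP[j [zj sj]]; have [x [/si xu /sj xv]] := sep _ _ _ zi zj.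
  exact: star_disjoint xu xv.
have st0 a : a \in edges e -> st a 0 = cell h (pt a.1).
  by move=> aE; have [_ _ G0 _ _] := HG aE; rewrite /st /third mul0r G0.
have st3 a : a \in edges e -> st a 3 = cell h (pt a.2).
  by move=> aE; have [_ _ _ G1 _] := HG aE; rewrite /st (_ : third 3 = 1) ?G1 // /third divff.
have sub0 a : a \in edges e -> {subset nodes (st a 0) (wk (a, j0)) <= N a.1}.
  move=> aE z zw; rewrite inE mem_cat; apply/orP; right; apply/orP; left.
  by apply/flatten_mapP; exists a; rewrite ?E1P ?eqxx.
have sub2 a : a \in edges e -> {subset nodes (st a 2) (wk (a, j2)) <= N a.2}.
  move=> aE z zw; rewrite inE mem_cat; apply/orP; right; apply/orP; right.
  by apply/flatten_mapP; exists a; rewrite ?E2P ?eqxx.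
have st1N a : a \in edges e -> st a 1 \in N a.1.
  by move=> aE; apply: (sub0 _ aE); apply: walk_last (Hwk (a, j0) aE).1.
have st2N a : a \in edges e -> st a 2 \in N a.2.
  by move=> aE; apply: (sub2 _ aE); rewrite inE eqxx.
have Nlink v z : z \in N v -> linked (N v) (cell h (pt v)) z.
  rewrite {1}inE mem_cat => /or3P[/eqP ->|/flatten_mapP[a]|/flatten_mapP[a]].
  - exact: linked_refl.
  - rewrite E1P => /andP[/eqP <- aE] zw; rewrite -st0 //.
    exact: linked_nodes (Hwk (a, j0) aE).1 (sub0 _ aE) _ zw.
  - rewrite E2P => /andP[/eqP <- aE] zw; rewrite -st3 //.
    have W := (Hwk (a, j2) aE).1.
    apply: linked_trans (linked_nodes W (sub2 _ aE) zw).
    by apply: linked_sym; apply: linked_nodes W (sub2 _ aE) _ (walk_last W).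
have Hpre a : exists we : seq dart * dart, a \in edges e -> [/\ walk (st a 1) we.1 we.2.1,
    forall z, z \in nodes (st a 1) we.1 -> near (inl (a, j1)) z,
    {in nodes (st a 1) we.1, forall z, z \notin N a.2} & tgt we.2 \in N a.2].
  case: (boolP (a \in edges e)) => [aE|_]; last by exists ([::], ((0, 0), (true, true))).
  have [W H] := Hwk (a, j1) aE.
  have nP : st a 1 \notin N a.2.
    apply/negP => /(Ndisj _ _ _ (st1N _ aE)) E.
    by move: aE; rewrite inE E ltnn.
  have [w1 [q [W1 sub nw Pq]]] := walk_first_hit (P := mem (N a.2)) W nP (st2N _ aE).
  by exists (w1, q) => _; split => // z /sub; apply: H.
have [pre {}Hpre] := choice Hpre.
pose B v := N v ++ flatten [seq nodes (st a 1) (pre a).1 | a <- E1 v].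
have NB v : {subset N v <= B v} by move=> z; rewrite mem_cat => ->.
have preB a : a \in edges e -> {subset nodes (st a 1) (pre a).1 <= B a.1}.
  move=> aE z zw; rewrite mem_cat; apply/orP; right.
  by apply/flatten_mapP; exists a; rewrite ?E1P ?eqxx.
have BP v z : z \in B v -> z \in N v \/ exists2 a, a \in edges e /\ a.1 = v & z \in nodes (st a 1) (pre a).1.
  rewrite mem_cat => /orP[|/flatten_mapP[a]]; first by left.
  by rewrite E1P => /andP[/eqP av aE] zw; right; exists a.
(* A node of the middle walk of [a] that lies in [N u] makes [u] an end of [a]; it is not the second
   end, because the walk was cut before [N a.2]. *)
have mixed u a z : a \in edges e -> z \in N u -> z \in nodes (st a 1) (pre a).1 -> u = a.1.
  move=> aE zu zw; have [_ H nP _] := Hpre a aE.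
  have [i [zi si]] := NP _ _ zu; have [x [/si xu xa]] := sep _ _ _ zi (H _ zw).
  have ma : mid a x.
    by move: xa; rewrite /= aE => -[t]; rewrite /= in_itv /= => t01 <-; exists t.
  case: (mid_star aE ma xu) => [//|E]; by move: (nP _ zw); rewrite E zu.
have Blink v z : z \in B v -> linked (B v) (cell h (pt v)) z.
  case/BP=> [/Nlink|[a [aE <-] zw]]; first exact: linked_mono.
  have [W _ _ _] := Hpre a aE.
  apply: linked_trans (linked_nodes W (preB _ aE) zw).
  by apply: linked_mono (@NB _) _; apply: Nlink; apply: st1N.
exists B, (fun u v : 'I_n => if (u < v)%N then (pre (u, v)).2 else rev_dart (pre (v, u)).2).
have wit (u v : 'I_n) : e u v -> (u < v)%N -> (pre (u, v)).2.1 \in B u /\ tgt (pre (u, v)).2 \in B v.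
  move=> uv ltuv; have aE : (u, v) \in edges e by rewrite inE /= ltuv.
  have [W _ _ T] := Hpre _ aE; split; last exact: NB.
  by apply: (preB _ aE); apply: walk_last W.
split.
- move=> z u v /BP[zu|[a [aE <-] za]] /BP[zv|[b [bE <-] zb]].
  + exact: Ndisj zu zv.
  + exact: mixed zu zb.
  + by symmetry; apply: mixed zv za.
  + have [_ Ha _ _] := Hpre a aE; have [_ Hb _ _] := Hpre b bE.
    have [x [xa xb]] := sep _ _ _ (Ha _ za) (Hb _ zb).
    have ma : mid a x.
      by move: xa; rewrite /= aE => -[t]; rewrite /= in_itv /= => t01 <-; exists t.
    have mb : mid b x.
      by move: xb; rewrite /= bE => -[t]; rewrite /= in_itv /= => t01 <-; exists t.
    by rewrite (mid_disjoint aE bE ma mb).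
- by move=> v; exists (cell h (pt v)); rewrite inE eqxx.
- by move=> v x y /Blink Hx /Blink Hy; apply: linked_trans Hy; apply: linked_sym.
- move=> u v uv; case: ltnP => [lt|le]; first exact: wit.
  have lt : (v < u)%N.
    by rewrite ltn_neqAle le andbT; apply: contraTneq uv => /val_inj ->; rewrite e_irr.
  have [H1 H2] := wit v u (etrans (e_sym _ _) uv) lt; split; first exact: H2.
  by rewrite tgt_rev.
- move=> u v uv; case: (ltngtP u v) => [lt|lt|/val_inj E].
  + by [].
  + by rewrite rev_dartK.
  + by rewrite E e_irr in uv.
Qed.

End PlanarGrid.

Lemma planar_grid_model (R : realType) n (e : rel 'I_n) :
  symmetric e -> irreflexive e -> planar R e -> exists B W, grid_model e B W.
Proof.
move=> sym irr [pt [curve [GD disj]]].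
have H a : exists g : R -> R * R, a \in edges e ->
  [/\ {within `[0, 1], continuous g}, {in `[0, 1] &, injective g},
      g 0 = pt a.1, g 1 = pt a.2 & curve a = g @` `]0, 1[].
  case: (boolP (a \in edges e)) => [aE|_]; last by exists (fun=> 0).
  by have [g Hg] := gd_curve GD aE; exists g.
have [G HG] := choice H.
exact: (planar_grid sym irr GD disj HG).
Qed.

End PlanarToGrid.

(** * Arcs, closed curves and piecewise linear functions *)

Module Curves.
Import MeshWalks.
From mathcomp Require Import all_boot all_order all_algebra.
From mathcomp Require Import all_classical all_reals all_analysis.
From mathcomp Require Import zify ring lra.

Set Implicit Arguments.
Unset Strict Implicit.
Unset Printing Implicit Defensive.
Import Order.TTheory GRing.Theory Num.Theory.
Import numFieldNormedType.Exports.
Local Open Scope classical_set_scope.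
Local Open Scope ring_scope.

Section Arcs.
Variable R : realType.
Implicit Types (p q r z : R * R) (A B J : set (R * R)).

(** Continuity is asked on the whole line, so that parametrizations can be combined by [glue]
    without subspace topologies. *)
Definition arc p q A : Prop :=
  exists g : R -> R * R,
    [/\ continuous g, {in `[0, 1] &, injective g},
        g 0 = p, g 1 = q & A = g @` `[0, 1]].

Lemma continuous_pairf (T : topologicalType) (f g : T -> R) :
  continuous f -> continuous g -> continuous (fun t => (f t, g t) : R * R).
Proof. by move=> cf cg t; apply: (@cvg_pair _ _ _ _ (nbhs (f t)) (nbhs (g t))); [exact: cf | exact: cg]. Qed.

Lemma segmentP p q z : segment p q z <->
  exists2 t, 0 <= t <= 1 & z = (p.1 + t * (q.1 - p.1), p.2 + t * (q.2 - p.2)).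
Proof.
split=> [[t]|[t t01 ->]].
  rewrite /= in_itv /= => t01 <-; exists t => //.
  by rewrite /GRing.scale /=; congr (_, _) => /=; rewrite /GRing.scale /=; ring.
exists t; first by rewrite /= in_itv.
by rewrite [LHS]surjective_pairing /=; congr (_, _) => /=; rewrite /GRing.scale /=; ring.
Qed.

Lemma arc_segment p q : p <> q -> arc p q (segment p q).
Proof.
move=> pq; pose g (t : R) : R * R := (p.1 + t * (q.1 - p.1), p.2 + t * (q.2 - p.2)).
exists g; split.
- apply: continuous_pairf => t; apply: cvgD; try exact: cvg_cst;
    by apply: cvgMr_tmp; exact: cvg_id.
- move=> s t _ _ [e1 e2]; apply: contrapT => st; apply: pq.
  have st' : s - t != 0 by apply/eqP; lra.
  have H (x y : R) : x + s * (y - x) = x + t * (y - x) -> x = y.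
    move=> e; have /eqP : (s - t) * (y - x) = 0 by move: e; lra.
    by rewrite mulf_eq0 (negbTE st') /= subr_eq0 => /eqP.
  by rewrite [p]surjective_pairing [q]surjective_pairing (H _ _ e1) (H _ _ e2).
- by rewrite /g !mul0r !addr0 -surjective_pairing.
- by rewrite /g !mul1r !subrKC -surjective_pairing.
- apply/seteqP; split => z; first by move=> /segmentP[t t01 ->]; exists t; rewrite //= in_itv.
  by move=> [t]; rewrite /= in_itv /= => t01 <-; apply/segmentP; exists t.
Qed.

(* f followed by k: the truncated arguments make one of the two terms constant *)
Definition glue (f k : R -> R * R) (q : R * R) (t : R) : R * R :=
  f (Num.min 1 (2 * t)) + k (Num.max 0 (2 * t - 1)) - q.

Lemma glue_left f k q t : k 0 = q -> t <= 1 / 2 -> glue f k q t = f (2 * t).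
Proof.
move=> kq t2; rewrite /glue min_r ?max_l ?kq ?addrK //; lra.
Qed.

Lemma glue_right f k q t : f 1 = q -> 1 / 2 <= t -> glue f k q t = k (2 * t - 1).
Proof.
by move=> fq t2; rewrite /glue min_l ?max_r ?fq ?[q + _]addrC ?addrK //; lra.
Qed.

Lemma glue_continuous f k q : continuous f -> continuous k -> continuous (glue f k q).
Proof.
move=> cf ck t; have c2 : continuous (fun t : R => 2 * t).
  by move=> s; apply: cvgMl_tmp; exact: cvg_id.
have c1 : continuous (f \o (fun t => Num.min 1 (2 * t))).
  move=> s; apply: continuous_comp; last exact: cf.
  by apply: continuous_min; [exact: cvg_cst | exact: c2].
have c3 : continuous (k \o (fun t => Num.max 0 (2 * t - 1))).
  move=> s; apply: continuous_comp; last exact: ck.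
  apply: continuous_max; first exact: cvg_cst.
  by apply: cvgB; [exact: c2 | exact: cvg_cst].
apply: cvgB; last exact: cvg_cst.
by apply: cvgD; [exact: c1 | exact: c3].
Qed.

Lemma glue_image f k q : k 0 = q -> f 1 = q ->
  glue f k q @` `[0, 1] = (f @` `[0, 1]) `|` (k @` `[0, 1]).
Proof.
move=> kq fq; apply/seteqP; split => z.
  move=> [t]; rewrite /= in_itv /= => t01 <-; case: (lerP t (1 / 2)) => t2.
    by left; exists (2 * t); rewrite ?glue_left //= in_itv /=; lra.
  by right; exists (2 * t - 1); rewrite ?glue_right //= ?in_itv /=; lra.
case=> -[t]; rewrite /= in_itv /= => t01 <-.
  exists (t / 2); first by rewrite /= in_itv /=; lra.
  by rewrite glue_left //; [congr f; lra | lra].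
exists ((t + 1) / 2); first by rewrite /= in_itv /=; lra.
by rewrite glue_right //; [congr k; lra | lra].
Qed.

Lemma arc_cat p q r A B : arc p q A -> arc q r B -> A `&` B `<=` [set q] ->
  arc p r (A `|` B).
Proof.
move=> [f [cf fi f0 f1 fA]] [k [ck ki k0 k1 kB]] AB.
exists (glue f k q); split.
- exact: glue_continuous.
- have H s t : 0 <= s <= 1 / 2 -> 1 / 2 < t <= 1 -> f (2 * s) <> k (2 * t - 1).
    move=> /andP[s0 s2] /andP[t2 t1] E.
    have : (A `&` B) (f (2 * s)).
      split; first by rewrite fA; exists (2 * s); rewrite //= in_itv /=; lra.
      by rewrite E kB; exists (2 * t - 1); rewrite //= in_itv /=; lra.
    move=> /AB /= fq; rewrite fq -k0 in E.
    have : 0 = 2 * t - 1 by apply: ki => //; rewrite in_itv /=; lra.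
    lra.
  move=> s t; rewrite !in_itv /= => s01 t01.
  case: (lerP s (1 / 2)) => s2; case: (lerP t (1 / 2)) => t2.
  + rewrite !glue_left // => /fi E.
    have : 2 * s = 2 * t by apply: E; rewrite in_itv /=; lra.
    lra.
  + rewrite glue_left // glue_right // ?ltW // => /H[]; lra.
  + rewrite glue_right ?ltW // glue_left // => /esym/H[]; lra.
  + rewrite !glue_right ?ltW // => /ki E.
    have : 2 * s - 1 = 2 * t - 1 by apply: E; rewrite in_itv /=; lra.
    lra.
- rewrite glue_left ?mulr0 //; lra.
- rewrite glue_right //; last lra.
  by rewrite -k1; congr k; lra.
- by rewrite glue_image // -fA -kB.
Qed.

Lemma arc_closed p q A B : arc p q A -> arc q p B -> A `&` B `<=` [set p; q] ->
  simple_closed_curve (A `|` B).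
Proof.
move=> [f [cf fi f0 f1 fA]] [k [ck ki k0 k1 kB]] AB.
have g0 : glue f k q 0 = p by rewrite glue_left ?mulr0 //; lra.
have g1 : glue f k q 1 = p.
  rewrite glue_right //; last lra.
  by rewrite -k1; congr k; lra.
exists (glue f k q); split.
- by apply: continuous_subspaceT; exact: glue_continuous.
- have H s t : 0 <= s <= 1 / 2 -> 1 / 2 < t < 1 -> f (2 * s) <> k (2 * t - 1).
    move=> /andP[s0 s2] /andP[t2 t1] E.
    have : (A `&` B) (f (2 * s)).
      split; first by rewrite fA; exists (2 * s); rewrite //= in_itv /=; lra.
      by rewrite E kB; exists (2 * t - 1); rewrite //= in_itv /=; lra.
    move=> /AB /= [] fq; rewrite fq in E.
      have : 1 = 2 * t - 1 by apply: ki; rewrite ?k1 // in_itv /=; lra.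
      lra.
    have : 0 = 2 * t - 1 by apply: ki; rewrite ?k0 // in_itv /=; lra.
    lra.
  move=> s t; rewrite !in_itv /= => s01 t01.
  case: (lerP s (1 / 2)) => s2; case: (lerP t (1 / 2)) => t2.
  + rewrite !glue_left // => /fi E.
    have : 2 * s = 2 * t by apply: E; rewrite in_itv /=; lra.
    lra.
  + rewrite glue_left // glue_right // ?ltW // => /H[]; lra.
  + rewrite glue_right ?ltW // glue_left // => /esym/H[]; lra.
  + rewrite !glue_right ?ltW // => /ki E.
    have : 2 * s - 1 = 2 * t - 1 by apply: E; rewrite in_itv /=; lra.
    lra.
- by rewrite g0 g1.
- by rewrite glue_image // -fA -kB.
Qed.

Lemma arc_open p q A : arc p q A -> open_curve p q (A `\` [set p; q]).
Proof.
move=> [f [cf fi f0 f1 fA]]; exists f; split => //; first exact: continuous_subspaceT.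
apply/seteqP; split => z.
  rewrite {1}fA => -[[t]]; rewrite /= in_itv /= => t01 <- ne; exists t => //.
  rewrite /= in_itv /= !lt_neqAle; have /andP[-> ->] := t01; rewrite !andbT.
  apply/andP; split; apply/eqP => E; apply: ne; first by left; rewrite -E f0.
  by right; rewrite E f1.
move=> [t]; rewrite /= in_itv /= => t01 <-; split.
  by rewrite fA; exists t; rewrite //= in_itv /=; lra.
have t01' : t \in `[0, 1] by rewrite in_itv /=; lra.
case=> E.
  have : t = 0 by apply: fi => //; rewrite ?in_itv /= ?lexx ?ler01 // E.
  lra.
have : t = 1 by apply: fi => //; rewrite ?in_itv /= ?lexx ?ler01 // E.
lra.
Qed.

Lemma segment_sym p q : segment p q = segment q p.
Proof.
suff H x y z : segment x y z -> segment y x z by apply/seteqP; split => z; apply: H.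
move=> /segmentP[t t01 ->]; apply/segmentP; exists (1 - t); first lra.
by congr (_, _); lra.
Qed.

End Arcs.

Section PiecewiseLinear.
Variable R : realType.
Implicit Types (p q z : R * R) (s : seq (R * R)).

Definition xlt : rel (R * R) := fun p q => p.1 < q.1.
Definition slope p q : R := (q.2 - p.2) / (q.1 - p.1).

(** Each segment enters through [x] clamped to its range, which gives the interpolation as a sum of
    continuous terms without case distinctions. *)
Fixpoint pl p s (x : R) : R :=
  if s is q :: s' then
    p.2 + slope p q * (Num.max p.1 (Num.min q.1 x) - p.1) + (pl q s' x - q.2)
  else p.2.

Lemma pl_continuous p s : continuous (pl p s).
Proof.
elim: s p => [|q s IH] p /=; first by move=> x; exact: cvg_cst.
have cm : continuous (fun x : R => Num.max p.1 (Num.min q.1 x)).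
  have ci : continuous (fun x : R => Num.min q.1 x).
    by move=> x; apply: (@continuous_min _ _ (fun=> q.1) id); [exact: cvg_cst | exact: cvg_id].
  move=> x; apply: (@continuous_max _ _ (fun=> p.1) (fun x => Num.min q.1 x)).
    exact: cvg_cst.
  exact: ci.
move=> x; apply: cvgD; last by apply: cvgB; [exact: IH | exact: cvg_cst].
apply: cvgD; first exact: cvg_cst.
apply: cvgMl_tmp; apply: cvgB; last exact: cvg_cst.
exact: cm.
Qed.

Lemma pl_left p s x : path xlt p s -> x <= p.1 -> pl p s x = p.2.
Proof.
elim: s p => //= q s IH p /andP[pq ps] xp; rewrite /xlt in pq.
rewrite IH //; last lra.
rewrite min_r; last lra.
by rewrite max_l // subrr mulr0 addr0 subrr addr0.
Qed.

Lemma pl_right p q s x : xlt p q -> q.1 <= x -> pl p (q :: s) x = pl q s x.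
Proof.
rewrite /xlt /= => pq qx; rewrite min_l // max_r; last lra.
rewrite /slope divfK; last by apply/eqP; lra.
lra.
Qed.

Lemma pl_first p q s x : path xlt p (q :: s) -> p.1 <= x <= q.1 ->
  pl p (q :: s) x = p.2 + slope p q * (x - p.1).
Proof.
move=> /= /andP[pq ps] /andP[px xq]; rewrite /xlt in pq.
rewrite pl_left // subrr addr0 min_r // max_r //.
Qed.

Lemma segment_graph p q z : xlt p q ->
  segment p q z <-> p.1 <= z.1 <= q.1 /\ z.2 = p.2 + slope p q * (z.1 - p.1).
Proof.
rewrite /xlt => pq; have pq0 : q.1 - p.1 != 0 by apply/eqP; lra.
rewrite segmentP; split => [[t t01 ->]|[z1 z2]] /=.
  split; first by nra.
  by rewrite /slope; field.
exists ((z.1 - p.1) / (q.1 - p.1)).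
  by rewrite divr_ge0 ?ler_pdivrMr ?mul1r; lra.
rewrite [LHS]surjective_pairing z2 divfK // /slope; congr (_, _); first by lra.
by field.
Qed.

Lemma path_last p s : path xlt p s -> p.1 <= (last p s).1.
Proof.
by elim: s p => //= q s IH p /andP[pq /IH]; rewrite /xlt in pq; lra.
Qed.

Lemma polyline_graph p q s z : path xlt p (q :: s) ->
  polyline p (q :: s) z <->
  p.1 <= z.1 <= (last q s).1 /\ z.2 = pl p (q :: s) z.1.
Proof.
elim: s p q => [|r s IH] p q.
  move=> pth; have pq : xlt p q by move: pth => /= /andP[].
  rewrite [polyline _ _]/= setU0 segment_graph //.
  by split=> -[z1 z2]; split => //; [rewrite pl_first | rewrite pl_first in z2].
move=> pth; have [pq pth'] : xlt p q /\ path xlt q (r :: s) by apply/andP.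
have lst : q.1 <= (last q (r :: s)).1 := path_last pth'.
rewrite /xlt in pq.
have -> : polyline p [:: q, r & s] = segment p q `|` polyline q (r :: s) by [].
split.
  case=> [/segment_graph[//|z1 z2]|/IH[//|/andP[z0 z1] z2]].
    split; first by rewrite -/(last q (r :: s)); lra.
    by rewrite pl_first.
  split; first by apply/andP; split; [lra|].
  by rewrite pl_right.
move=> [/andP[z0 z1] z2]; case: (lerP z.1 q.1) => zq.
  left; apply/segment_graph => //; split; first lra.
  by rewrite z2 pl_first //; lra.
right; apply/IH => //; split; first by apply/andP; split; [lra|].
by rewrite z2 pl_right // ltW.
Qed.

Lemma polyline_arc p q s : path xlt p (q :: s) -> arc p (last q s) (polyline p (q :: s)).
Proof.
elim: s p q => [|r s IH] p q pth.
  rewrite [polyline _ _]/= setU0; apply: arc_segment => E.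
  by move: pth; rewrite /= andbT /xlt E ltxx.
have [pq pth'] : xlt p q /\ path xlt q (r :: s) by apply/andP.
rewrite /xlt in pq.
apply: arc_cat (IH _ _ pth') _.
  by apply: arc_segment => E; rewrite E ltxx in pq.
move=> z [/segment_graph[//|z1 z2] /polyline_graph[//|w1 w2]] /=.
have zq : z.1 = q.1 by lra.
rewrite [z]surjective_pairing [q]surjective_pairing zq; congr (_, _).
by rewrite w2 zq pl_left.
Qed.

Lemma pl_nth (P : nat -> R * R) i K j x : (forall t, (t < i + K)%N -> (P t).1 < (P t.+1).1) ->
  (i <= j < i + K)%N -> (P j).1 <= x <= (P j.+1).1 ->
  path xlt (P i) (map P (iota i.+1 K)) /\
  pl (P i) (map P (iota i.+1 K)) x = (P j).2 + slope (P j) (P j.+1) * (x - (P j).1).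
Proof.
elim: K i => [|K IH] i inc /andP[ij jK] xj; first by move: jK; rewrite addn0 ltnNge ij.
have pth K' t : (forall t', (t' < t + K')%N -> (P t').1 < (P t'.+1).1) -> path xlt (P t) (map P (iota t.+1 K')).
  elim: K' t => //= K' IHK t H; rewrite /xlt H ?IHK //; last by rewrite addnS ltnS leq_addr.
  by move=> t' lt; apply: H; rewrite -addSnnS.
split; first exact: pth.
have p0 : path xlt (P i) (map P (iota i.+1 K.+1)) by apply: pth.
case: (ltngtP i j) ij => // [lt _|E _]; last first.
  by rewrite -E in xj *; rewrite /= -[_ + _ + _]/(pl (P i) (P i.+1 :: map P (iota i.+2 K)) x) pl_first.
have inc' : forall t, (t < i.+1 + K)%N -> (P t).1 < (P t.+1).1 by move=> t; rewrite addSnnS; apply: inc.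
have [|_ <-] := IH i.+1 inc' _ xj; first by rewrite lt addSnnS.
rewrite [map P _]/= pl_right //; first by rewrite /xlt inc // addnS ltnS leq_addr.
have mono t : (i.+1 + t <= j)%N -> (P i.+1).1 <= (P (i.+1 + t)%N).1.
  elim: t => [|t IHt] le; first by rewrite addn0.
  rewrite addnS; apply: le_trans (ltW (inc' _ _)); last by rewrite addnS in le; lia.
  by apply: IHt; lia.
have := mono (j - i.+1)%N; rewrite subnKC // => /(_ (leqnn _)); lra.
Qed.

Lemma grid_interval (P : nat -> R * R) K x : (P 0%N).1 <= x <= (P K).1 -> (0 < K)%N ->
  exists2 j, (j < K)%N & (P j).1 <= x <= (P j.+1).1.
Proof.
elim: K => // K IH /andP[x0 xK] _; case: (lerP x (P K).1) => xK'; last first.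
  by exists K => //; lra.
case: K IH xK xK' => [|K] IH xK xK'.
  by exists 0%N => //; lra.
by have [||j jK ?] := IH; rewrite ?x0 //; exists j => //; apply: ltnW.
Qed.

End PiecewiseLinear.

End Curves.

(** * The region below a graph, and alternation at a crossing of lines *)

Module UnderGraphs.
Import MeshWalks Curves.
From mathcomp Require Import all_boot all_order all_algebra.
From mathcomp Require Import all_classical all_reals all_analysis.
From mathcomp Require Import zify ring lra.

Set Implicit Arguments.
Unset Strict Implicit.
Unset Printing Implicit Defensive.
Import Order.TTheory GRing.Theory Num.Theory.
Import numFieldNormedType.Exports.
Local Open Scope classical_set_scope.
Local Open Scope ring_scope.

Lemma lerN_norm (R : realType) (x : R) : - `|x| <= x.
Proof. by rewrite lerNl -normrN ler_norm. Qed.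

Section UnderGraph.
Variables (R : realType) (a b c : R) (u : R -> R).
Hypotheses (ab : a < b) (cu : continuous u) (ua : u a = c) (ub : u b = c).
Hypothesis (uc : forall x, a < x < b -> c < u x).
Implicit Types (z : R * R).

Definition graph_border : set (R * R) :=
  [set z | a <= z.1 <= b /\ (z.2 = u z.1 \/ z.2 = c)].
Definition under_graph : set (R * R) :=
  [set z | a <= z.1 <= b /\ c <= z.2 <= u z.1].

Lemma fst_cont : continuous (fun z : R * R => z.1).
Proof. by move=> z; apply: cvg_fst. Qed.

Lemma snd_cont : continuous (fun z : R * R => z.2).
Proof. by move=> z; apply: cvg_snd. Qed.

Lemma height_ge x : a <= x <= b -> c <= u x.
Proof.
move=> /andP[ax xb]; case: (eqVneq x a) => [->|xa]; first by rewrite ua.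
case: (eqVneq x b) => [->|xb']; first by rewrite ub.
by apply/ltW/uc; rewrite !lt_neqAle ax xb xb' eq_sym xa.
Qed.

Let cmp (f : R * R -> R) : continuous f ->
  open [set z | 0 < f z] /\ closed [set z | 0 <= f z].
Proof.
move=> cf; split.
  apply: (@open_comp _ _ f [set x | 0 < x]); last exact: open_gt.
  by move=> z _; exact: cf.
apply: (@preimage_closed _ _ f [set x | 0 <= x]); last exact: closed_ge.
by move=> z _; exact: cf.
Qed.

Let ucont : continuous (fun z : R * R => u z.1).
Proof. by move=> z; apply: (@continuous_comp _ _ _ (fun z : R * R => z.1) u); [exact: fst_cont | exact: cu]. Qed.

Let f1 z := z.1 - a.
Let f2 z := b - z.1.
Let f3 z := z.2 - c.
Let f4 z := u z.1 - z.2.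

Let cf1 : continuous f1.
Proof. by move=> z; apply: cvgB; [exact: fst_cont | exact: cvg_cst]. Qed.
Let cf2 : continuous f2.
Proof. by move=> z; apply: cvgB; [exact: cvg_cst | exact: fst_cont]. Qed.
Let cf3 : continuous f3.
Proof. by move=> z; apply: cvgB; [exact: snd_cont | exact: cvg_cst]. Qed.
Let cf4 : continuous f4.
Proof. by move=> z; apply: cvgB; [exact: ucont | exact: snd_cont]. Qed.

Let inner : set (R * R) := [set z | 0 < f1 z] `&` [set z | 0 < f2 z] `&` [set z | 0 < f3 z] `&` [set z | 0 < f4 z].

Let innerE z : ~ graph_border z -> under_graph z -> inner z.
Proof.
move=> nb [/andP[za zb] /andP[zc zu]].
have n2 : z.2 <> c by move=> E; apply: nb; split; [apply/andP|right].
have n1 : z.2 <> u z.1 by move=> E; apply: nb; split; [apply/andP|left].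
have n3 : z.1 <> a by move=> E; rewrite E ua in zu; apply: n2; lra.
have n4 : z.1 <> b by move=> E; rewrite E ub in zu; apply: n2; lra.
have n5 : u z.1 <> z.2 by move/esym.
rewrite /inner /f1 /f2 /f3 /f4; split; [split; [split|]|] => /=; lra.
Qed.

Let inner_under z : inner z -> under_graph z.
Proof.
rewrite /inner /f1 /f2 /f3 /f4 => -[[[/= h1 h2] h3] h4]; split; lra.
Qed.

Let component_under z : ~ graph_border z -> under_graph z ->
  connected_component (~` graph_border) z `<=` under_graph.
Proof.
move=> nb uz; set C := connected_component _ _.
have CN : C `<=` ~` graph_border by apply: connected_component_sub.
have Cz : C z by apply: connected_component_refl.
have CE : C `&` under_graph = C.
  apply: (@component_connected _ (~` graph_border) z); first by exists z.
  - exists inner.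
      by repeat apply: openI; [apply: (cmp cf1).1|apply: (cmp cf2).1|apply: (cmp cf3).1|apply: (cmp cf4).1].
    apply/seteqP; split => w [Cw uw]; split => //; last exact: inner_under.
    by apply: innerE => //; apply: CN.
  - exists under_graph => //.
    have -> : under_graph = [set z | 0 <= f1 z] `&` [set z | 0 <= f2 z] `&` [set z | 0 <= f3 z] `&` [set z | 0 <= f4 z].
      apply/seteqP; split => w; rewrite /under_graph /f1 /f2 /f3 /f4 /=.
        by move=> [/andP[? ?] /andP[? ?]]; split; [split; [split|]|] => /=; lra.
      by move=> [[[/= ? ?] ?] ?]; split; lra.
    by repeat apply: closedI; [apply: (cmp cf1).2|apply: (cmp cf2).2|apply: (cmp cf3).2|apply: (cmp cf4).2].
by rewrite -CE => w [].
Qed.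

Let ray_unbounded z (V : set R) : is_interval V -> V z.2 ->
  (forall y, V y -> ~ graph_border (z.1, y)) ->
  (forall M : R, exists2 y, V y & M < `|y|) ->
  ~ bounded_set (connected_component (~` graph_border) z).
Proof.
move=> iV Vz VN Vunb bd.
have cV : connected ((fun y => (z.1, y)) @` V).
  apply: connected_continuous_connected; first exact/connected_intervalP.
  apply: continuous_subspaceT; apply: continuous_pairf => y; [exact: cvg_cst | exact: cvg_id].
have sub : (fun y => (z.1, y)) @` V `<=` connected_component (~` graph_border) z.
  apply: connected_component_max => //; first by exists z.2 => //; rewrite -surjective_pairing.
  by move=> _ [y Vy <-]; apply: VN.
have [M [_ HM]] := bd.
have [y Vy] := Vunb (M + 1); apply/negP; rewrite -leNgt.
have := HM (M + 1); rewrite ltrDl ltr01 => /(_ isT (z.1, y)).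
rewrite /= prod_norm_le => H.
have /andP[_ ->//] := H (sub _ (ex_intro2 _ _ y Vy erefl)).
Qed.

(** Off the border, [under_graph] is both relatively open and closed, so a component that starts in
    this bounded set stays there. From a point outside it, the vertical ray upwards or the one
    downwards misses the border and makes the component unbounded. *)
Lemma enclosed_under_graph : enclosed graph_border = under_graph.
Proof.
apply/seteqP; split => z.
  case=> [[z1 z2]|[nb bd]].
    split => //; have := height_ge z1; case: z2 => ->; first by move=> ->; rewrite lexx.
    by move=> ->; rewrite lexx.
  apply: contrapT => nu.
  have up : (forall y, z.2 <= y -> ~ graph_border (z.1, y)) -> False.
    move=> H; apply: (@ray_unbounded z `[z.2, +oo[%classic) bd.
    - exact: interval_is_interval.
    - by rewrite /= in_itv /= lexx.
    - by move=> y; rewrite /= in_itv /= andbT; apply: H.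
    - move=> M; exists (`|z.2| + `|M| + 1).
        by rewrite /= in_itv /= andbT; have := ler_norm z.2; have := normr_ge0 M; lra.
      by rewrite ger0_norm; have := ler_norm M; have := normr_ge0 z.2; have := normr_ge0 M; lra.
  have down : (forall y, y <= z.2 -> ~ graph_border (z.1, y)) -> False.
    move=> H; apply: (@ray_unbounded z `]-oo, z.2]%classic) bd.
    - exact: interval_is_interval.
    - by rewrite /= in_itv /= lexx.
    - by move=> y; rewrite /= in_itv /=; apply: H.
    - move=> M; exists (- (`|z.2| + `|M| + 1)).
        by rewrite /= in_itv /=; have := lerN_norm z.2; have := normr_ge0 M; lra.
      by rewrite normrN ger0_norm; have := ler_norm M; have := normr_ge0 z.2; have := normr_ge0 M; lra.
  case: (boolP (a <= z.1 <= b)) => zab; last first.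
    by apply: up => y _ [/= zab' _]; rewrite zab' in zab.
  have cz := height_ge zab.
  case: (ltrP z.2 c) => z2c.
    by apply: down => y yz [_ /= [] E]; lra.
  case: (ltrP (u z.1) z.2) => z2u.
    by apply: up => y yz [_ /= [] E]; lra.
  by apply: nu; split => //; rewrite z2c.
move=> uz; case: (pselect (graph_border z)) => [|nb]; [by left | right; split => //].
have [m _ mmax] := EVT_max (ltW ab) (continuous_subspaceT cu (A := `[a, b]%classic)).
exists (`|a| + `|b| + `|c| + `|u m|); split; first by rewrite num_real.
move=> M ltM w /(component_under nb uz)[/andP[wa wb] /andP[wc wu]].
have um : u w.1 <= u m by apply: mmax; rewrite in_itv /= wa wb.
have := normr_ge0 a; have := normr_ge0 b; have := normr_ge0 c; have := normr_ge0 (u m).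
have := ler_norm b; have := lerN_norm a; have := lerN_norm c; have := ler_norm (u m).
move=> *; rewrite /= prod_norm_le !ler_norml; apply/andP; split; apply/andP; split; lra.
Qed.

(** Every point is joined to the base by a vertical segment. *)
Lemma connected_under_graph : connected under_graph.
Proof.
pose base := (fun t => (t, c) : R * R) @` `[a, b].
pose vert x := (fun y => (x, y) : R * R) @` `[c, u x].
have -> : under_graph = \bigcup_(x in [set x | a <= x <= b]) (base `|` vert x).
  apply/seteqP; split => z.
    move=> [zab zc]; exists z.1 => //; right; exists z.2; first by rewrite /= in_itv.
    by rewrite -surjective_pairing.
  move=> [x xab [[t]|[y]]]; rewrite /= in_itv /= => H <-; split => //=.
  by rewrite lexx height_ge.
apply: bigcup_connected.
  exists (a, c) => x _; left; exists a => //; by rewrite /= in_itv /= lexx ltW.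
move=> x /= xab; apply: connectedU.
- exists (x, c); split; first by exists x => //; rewrite /= in_itv.
  by exists c => //; rewrite /= in_itv /= lexx height_ge.
- apply: connected_continuous_connected; first exact: segment_connected.
  by apply: continuous_subspaceT; apply: continuous_pairf => y; [exact: cvg_id | exact: cvg_cst].
- apply: connected_continuous_connected; first exact: segment_connected.
  by apply: continuous_subspaceT; apply: continuous_pairf => y; [exact: cvg_cst | exact: cvg_id].
Qed.

End UnderGraph.

Section Alternate.
Variable R : realType.
Implicit Types (A B : set (R * R)) (p z : R * R).

Definition locally_horizontal A p : Prop :=
  exists2 r : R, 0 < r & forall z, `|z - p| < r -> (A z <-> z.2 = p.2).
(** The parameter is the inverse slope: vertical lines are included, and horizontal ones, which
    would not cross a horizontal curve, are excluded. *)
Definition locally_line (k : R) A p : Prop :=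
  exists2 r : R, 0 < r & forall z, `|z - p| < r -> (A z <-> z.1 - p.1 = k * (z.2 - p.2)).

(** The homeomorphism required by [alternate] is a scaled shear that carries one axis to the
    horizontal line and the other to the line of inverse slope [k]. *)
Lemma crossing_lines k A B p : locally_horizontal A p -> locally_line k B p ->
  [/\ alternate A B p, alternate B A p & isolated (A `&` B) p].
Proof.
move=> [rA rA0 HA] [rB rB0 HB].
(* The shear and its inverse stretch the maximum norm by at most [D]. So the image of the square
   stays within [s * D = r / 2] of [p] and contains the ball of radius [s / D]. *)
pose r := Num.min rA rB; pose D := 1 + `|k|; pose s := r / (2 * D).
have r0 : 0 < r by rewrite lt_min rA0.
have D0 : 0 < D by rewrite /D; have := normr_ge0 k; lra.
have s0 : 0 < s by rewrite divr_gt0 // mulr_gt0.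
have sD : s * D = r / 2 by rewrite /s; field; rewrite gt_eqF.
have nearp z : `|z - p| < r -> (A z <-> z.2 = p.2) /\ (B z <-> z.1 - p.1 = k * (z.2 - p.2)).
  by rewrite lt_min => /andP[z1 z2]; split; [exact: HA | exact: HB].
have pAB : A p /\ B p.
  have [HA' HB'] := nearp p ltac:(by rewrite subrr normr0).
  by split; [apply/HA' | apply/HB'; rewrite !subrr mulr0].
pose h (z : R * R) : R * R := (p.1 + s * (z.1 + k * z.2), p.2 + s * z.2).
have cfst := @fst_cont R; have csnd := @snd_cont R.
have ch : continuous h.
  apply: continuous_pairf => z; apply: cvgD; try exact: cvg_cst; apply: cvgMl_tmp; last exact: csnd.
  by apply: cvgD; [exact: cfst | apply: cvgMl_tmp; exact: csnd].
have hi : injective h.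
  move=> [x1 x2] [y1 y2] [/addrI e1 /addrI e2].
  have sn0 : s != 0 by rewrite gt_eqF.
  move/(mulfI sn0): e2 => e2; move/(mulfI sn0): e1; rewrite e2 => /addIr ->.
  by [].
have h0 : h 0 = p by rewrite /h /= !mulr0 !addr0 mulr0 !addr0 -surjective_pairing.
pose Q := [set z : R * R | `|z| <= 1].
have hr z : Q z -> `|h z - p| < r.
  rewrite /Q /= prod_norm_le => /andP[z1 z2].
  have k0 := normr_ge0 k.
  have kz : `|k * z.2| <= `|k| by rewrite normrM -[leRHS]mulr1 ler_wpM2l.
  have b1 : `|z.1 + k * z.2| <= D by apply: le_trans (ler_normD _ _) _; rewrite /D; lra.
  have e1 : `|s * (z.1 + k * z.2)| <= s * D by rewrite normrM (gtr0_norm s0) ler_pM2l.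
  have e2 : `|s * z.2| <= s * D.
    rewrite normrM (gtr0_norm s0) ler_pM2l // /D; lra.
  rewrite prod_norm_lt /h /=.
  have -> : p.1 + s * (z.1 + k * z.2) - p.1 = s * (z.1 + k * z.2) by ring.
  have -> : p.2 + s * z.2 - p.2 = s * z.2 by ring.
  by apply/andP; split; lra.
have nb : nbhs p (h @` Q).
  apply/nbhs_ballP; exists (s / D); first by rewrite /= divr_gt0.
  move=> w; rewrite -ball_normE /= distrC prod_norm_lt /= => /andP[w1 w2].
  have sn0 : s != 0 by rewrite gt_eqF.
  exists (((w.1 - p.1) - k * (w.2 - p.2)) / s, (w.2 - p.2) / s).
    have k0 := normr_ge0 k.
    have sD' : s / D * D = s by rewrite divfK // gt_eqF.
    have D1 : 1 <= D by rewrite /D; lra.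
    have le1 : s / D <= s by rewrite ler_pdivrMr // ler_peMr // ltW.
    rewrite /Q /= prod_norm_le /= !normrM !normfV (gtr0_norm s0) !ler_pdivrMr // mul1r.
    apply/andP; split; last lra.
    apply: le_trans (ler_normB _ _) _; rewrite normrM.
    have : `|k| * `|w.2 - p.2| <= `|k| * (s / D) by rewrite ler_wpM2l // ltW.
    have : s / D * D = s / D + `|k| * (s / D) by rewrite /D; ring.
    lra.
  by rewrite /h /= [RHS]surjective_pairing; congr (_, _); field.
have sn0 : s != 0 by rewrite gt_eqF.
have EA : A `&` h @` Q = h @` [set z | Q z /\ z.2 = 0].
  apply/seteqP; split => w.
    move=> [Aw [z Qz zw]]; exists z => //; split => //.
    have [HA' _] := nearp _ (hr _ Qz); rewrite -zw in Aw; move/HA': Aw; rewrite /h /= => E.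
    have /eqP : s * z.2 = 0 by lra.
    by rewrite mulf_eq0 (negbTE sn0) => /eqP.
  move=> [z [Qz z2] <-]; split; last by exists z.
  by have [HA' _] := nearp _ (hr _ Qz); apply/HA'; rewrite /h /= z2 mulr0 addr0.
have EB : B `&` h @` Q = h @` [set z | Q z /\ z.1 = 0].
  apply/seteqP; split => w.
    move=> [Aw [z Qz zw]]; exists z => //; split => //.
    have [_ HB'] := nearp _ (hr _ Qz); rewrite -zw in Aw; move/HB': Aw; rewrite /h /= => E.
    have /eqP : s * z.1 = 0 by move: E; lra.
    by rewrite mulf_eq0 (negbTE sn0) => /eqP.
  move=> [z [Qz z2] <-]; split; last by exists z.
  by have [_ HB'] := nearp _ (hr _ Qz); apply/HB'; rewrite /h /= z2; ring.
pose sw (z : R * R) : R * R := (z.2, z.1).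
have Qsw z : Q (sw z) <-> Q z by rewrite /Q /sw /= !prod_norm_le /= andbC.
have hQ : (h \o sw) @` Q = h @` Q.
  apply/seteqP; split => w [z Qz <-]; last by exists (sw z); [apply/Qsw | case: (z)].
  by exists (sw z) => //; apply/Qsw.
have imsw (P P' : set (R * R)) : (forall z, P (sw z) <-> P' z) -> h @` P = (h \o sw) @` P'.
  move=> PP; apply/seteqP; split => w [z Pz <-]; last by exists (sw z); [apply/PP |].
  by exists (sw z); [apply/PP; case: (z) Pz | case: (z)].
split.
- exists h; split => //; split; first exact: continuous_subspaceT.
  by move=> x y _ _; exact: hi.
- exists (h \o sw); split.
  + split; last by move=> [x1 x2] [y1 y2] _ _ /= /hi [-> ->].
    apply: continuous_subspaceT => z; apply: continuous_comp; last exact: ch.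
    by apply: continuous_pairf; [exact: csnd | exact: cfst].
  + exact: h0.
  + by rewrite hQ.
  + by rewrite hQ EB; apply: imsw => z; split=> -[q e]; split => //; [exact: ((Qsw z).1 q) | exact: ((Qsw z).2 q)].
  + by rewrite hQ EA; apply: imsw => z; split=> -[q e]; split => //; [exact: ((Qsw z).1 q) | exact: ((Qsw z).2 q)].
- split; first by rewrite inE.
  exists [set z | `|z - p| < r].
    apply/nbhs_ballP; exists r => //= z; by rewrite -ball_normE /= distrC.
  apply/seteqP; split => z /=; last by move=> ->; rewrite subrr normr0.
  move=> [/nearp[HA' HB'] [/HA' e2 /HB' e1]].
  rewrite e2 subrr mulr0 in e1; rewrite [z]surjective_pairing [p]surjective_pairing e2.
  by congr (_, _); lra.
Qed.

End Alternate.

End UnderGraphs.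

(** * Depths and heights in a layout *)

Module LayoutArith.
Import MuRecursive LayoutDefs LayoutCode LayoutFromGrid.
From mathcomp Require Import all_boot all_order all_algebra.
From mathcomp Require Import zify.

Set Implicit Arguments.
Unset Strict Implicit.
Unset Printing Implicit Defensive.

Lemma leq_bsum n (g h : nat -> nat) : (forall i, i < n -> g i <= h i) -> bsum n g <= bsum n h.
Proof. by move=> H; apply: leq_sum => i _; apply: H. Qed.

Lemma bsumD n (g h : nat -> nat) : bsum n g + bsum n h = bsum n (fun i => g i + h i).
Proof. by rewrite /bsum big_split. Qed.

(** Absorbs an additional 1 into a sum of indicators, so that inequalities between depths and
    heights can be checked term by term. *)
Lemma bsum_delta n r : r < n -> bsum n (fun u => u == r) = 1.
Proof.
move=> rn; rewrite /bsum (bigD1 (Ordinal rn)) //= eqxx big1 ?addn0 // => i ne.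
by apply/eqP; rewrite eqb0; apply: contra ne => /eqP e; apply/eqP/val_inj.
Qed.

Lemma leq_term_bsum n (g : nat -> nat) i : i < n -> g i <= bsum n g.
Proof. by move=> lin; rewrite /bsum (bigD1 (Ordinal lin)) //= leq_addr. Qed.

Section LayoutFacts.
Variables (n m : nat) (a mem : nat -> nat -> bool).
Variables (f l : nat -> nat) (p : nat -> nat -> nat).
Hypothesis lay : layout n m a mem f l p.
Hypothesis a_sym : forall u v, u < n -> v < n -> a u v = a v u.

Notation cov := (cov f l).
Notation anc := (anc f l).
Notation par := (par n f l).
Notation chord := (chord n a f l).
Notation top := (top n f l).
Notation depth := (depth n f l).
Notation croot := (croot n mem f l).
Notation height := (height n mem f l).

Lemma f_le_l u : u < n -> f u <= l u.
Proof. by case/and5P: lay => /ballP H _ _ _ _; apply: H. Qed.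

Lemma f_inj u v : u < n -> v < n -> f u = f v -> u = v.
Proof.
case/and5P: lay => _ /ballP H _ _ _ un vn e.
by move/ballP: (H _ un) => /(_ _ vn); rewrite e eqxx => /eqP.
Qed.

Lemma anc_l u v : u < n -> v < n -> anc u v -> l v <= l u.
Proof.
case/and5P: lay => _ _ /ballP H _ _ un vn e.
by move/ballP: (H _ un) => /(_ _ vn); rewrite e.
Qed.

Lemma anc_refl v : v < n -> anc v v.
Proof. by move=> vn; rewrite /LayoutDefs.anc /LayoutDefs.cov leqnn f_le_l. Qed.

Lemma anc_cov u v i : u < n -> v < n -> anc u v -> cov v i -> cov u i.
Proof.
move=> un vn uv vi; have := anc_l un vn uv; move: uv vi; rewrite /LayoutDefs.anc /LayoutDefs.cov; lia.
Qed.

Lemma anc_trans u v w : u < n -> v < n -> anc u v -> anc v w -> anc u w.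
Proof. by move=> un vn uv; apply: anc_cov. Qed.

Lemma anc_anti u v : u < n -> v < n -> anc u v -> anc v u -> u = v.
Proof. by move=> un vn uv vu; apply: f_inj => //; move: uv vu; rewrite /LayoutDefs.anc /LayoutDefs.cov; lia. Qed.

Lemma cov_comparable u v i : cov u i -> cov v i -> anc u v || anc v u.
Proof. by rewrite /LayoutDefs.anc /LayoutDefs.cov; lia. Qed.

Lemma parP u v : par u v -> [/\ anc u v, u <> v & forall w, w < n -> anc w v -> w <> v -> anc w u].
Proof.
case/and3P=> uv /eqP ne /ballP H; split => // w wn wv nw.
by have := H _ wn; rewrite wv /=; case: eqP.
Qed.

Lemma topP c v : top c v -> cov v c /\ forall w, w < n -> cov w c -> anc w v.
Proof. by case/andP=> ? /ballP H; split => // w /H /implyP. Qed.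

Lemma chordC u v : u < n -> v < n -> chord u v = chord v u.
Proof. by move=> un vn; rewrite /LayoutDefs.chord a_sym // orbC. Qed.

Lemma chordP u v : u < n -> v < n -> chord u v ->
  [/\ a u v, top (p u v) u & forall w, w < n -> p u v <> f w].
Proof.
case/and5P: lay => _ _ _ _ /and4P[_ /ballP H _ _] un vn ch.
move/ballP: (H _ un) => /(_ _ vn); rewrite ch => /andP[t /ballP nf]; split => //.
  by case/andP: ch.
by move=> w wn; apply/eqP; apply: nf.
Qed.

Lemma chord_inj u v u' v' : u < n -> v < n -> u' < n -> v' < n ->
  chord u v -> chord u' v' -> p u v = p u' v' -> u = u' /\ v = v'.
Proof.
case/and5P: lay => _ _ _ _ /and4P[_ _ /ballP H _] un vn u'n v'n c c' e.
move/ballP: (H _ un) => /(_ _ vn) /ballP/(_ _ u'n) /ballP/(_ _ v'n).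
by rewrite c c' e eqxx /= => /andP[/eqP-> /eqP->].
Qed.

Lemma chord_noncross u v u' v' : u < n -> v < n -> u' < n -> v' < n ->
  chord u v -> chord u' v' -> ~ [/\ p u v < p u' v', p u' v' < p v u & p v u < p v' u'].
Proof.
case/and5P: lay => _ _ _ _ /and4P[_ _ _ /ballP H] un vn u'n v'n c c' [h1 h2 h3].
move/ballP: (H _ un) => /(_ _ vn) /ballP/(_ _ u'n) /ballP/(_ _ v'n).
by rewrite c c' h1 h2 h3.
Qed.

Lemma edge_cases u v : u < n -> v < n -> a u v -> [\/ par u v, par v u | chord u v].
Proof.
move=> un vn auv; case: (boolP (par u v)) => h1; first exact: Or31.
case: (boolP (par v u)) => h2; first exact: Or32.
by apply: Or33; rewrite /LayoutDefs.chord auv negb_or h1 h2.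
Qed.

Section Root.
Variable k : nat.
Hypothesis km : k < m.
Notation r := (croot k).

Lemma crootP : [/\ r < n, mem r k, forall v, v < n -> mem v k -> anc r v &
  forall u v, u < n -> v < n -> mem v k -> anc r u -> anc u v -> mem u k].
Proof.
case/and5P: lay => _ _ _ _ /and4P[/ballP H _ _ _].
have /bexP[q qn /andP[qk /ballP qH]] := H _ km.
have ex : bex n (fun r => mem r k && ball n (fun v => mem v k ==> anc r v)).
  apply/bexP; exists q => //; rewrite qk; apply/ballP => v vn.
  by apply/implyP => vk; have := qH _ vn; rewrite vk => /andP[].
have [rn /andP[rk /ballP rH]] := bminP ex; rewrite -/r in rn rk rH.
have qr : q = r.
  apply: anc_anti => //; last by have := rH _ qn; rewrite qk.
  by have := qH _ rn; rewrite rk => /andP[].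
split => //; first by move=> v vn vk; have := rH _ vn; rewrite vk.
move=> u v un vn vk ru uv; have := qH _ vn; rewrite vk => /andP[_ /ballP/(_ _ un)].
by rewrite qr ru uv.
Qed.

(** An ancestor of [v] is either an ancestor of the root [r], or lies between [r] and [v] and is
    then a member covering column [i]. The root is of both kinds, which yields the successor. *)
Lemma cap_ge v i : v < n -> mem v k -> cov v i -> (depth v).+1 <= depth r + height k i.
Proof.
move=> vn vk vi; have [rn rk rall rbet] := crootP.
rewrite /LayoutDefs.depth /LayoutDefs.height -addn1 -(bsum_delta rn) !bsumD; apply: leq_bsum => u un.
have rv := rall _ vn vk.
case: eqP => [->|ur].
  by rewrite rv anc_refl // rk (anc_cov rn vn rv vi).
case uv : (anc u v) => //=; rewrite addn0.
have /orP[->//|ru] := cov_comparable uv rv.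
by rewrite (rbet u v) // (anc_cov un vn uv vi) addn1.
Qed.

(** A member covering column [i] is an ancestor of [v], since otherwise [v] would lie between [r]
    and that member. The vertex [v] itself is counted neither in the depth of [r] nor in the height,
    which makes up for the root being counted twice. *)
Lemma cap_le v i : v < n -> ~~ mem v k -> anc r v -> cov v i -> depth r + height k i <= depth v.
Proof.
move=> vn vk rv vi; have [rn rk rall rbet] := crootP.
rewrite -(leq_add2r 1) -{1}(bsum_delta vn) -(bsum_delta rn) /LayoutDefs.depth /LayoutDefs.height !bsumD; apply: leq_bsum => u un.
have key : mem u k && cov u i -> anc u v.
  case/andP=> uk ui; case/orP: (cov_comparable ui vi) => // vu.
  by move: vk; rewrite (rbet v u).
have ar : anc u r -> anc u v by move=> h; apply: anc_trans h rv.
have both : anc u r -> mem u k -> u = r by move=> h uk; apply: anc_anti => //; apply: rall.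
case: (eqVneq u v) => [->|uv].
  rewrite anc_refl // (negbTE vk) /= addn0.
  by case vr : (anc v r) => //; rewrite (anc_anti vn rn vr rv) eqxx.
rewrite addn0; case ur : (anc u r) => /=.
  rewrite ar //; case uk : (mem u k) => //=; rewrite (both ur uk) eqxx; by case: (cov _ _).
by case h : (mem u k && cov u i) => //; rewrite key.
Qed.

(** Here [top] makes all members over the column ancestors of [v]. In contrast to [cap_le], [v] may
    be a member, which costs one level. *)
Lemma cap_top v i : v < n -> anc r v -> top i v -> depth r + height k i <= (depth v).+1.
Proof.
move=> vn rv /topP[vi tv]; have [rn rk rall rbet] := crootP.
rewrite -addn1 -(bsum_delta rn) /LayoutDefs.depth /LayoutDefs.height !bsumD; apply: leq_bsum => u un.
have both : anc u r -> mem u k -> u = r by move=> h uk; apply: anc_anti => //; apply: rall.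
case ur : (anc u r) => /=.
  rewrite (anc_trans un rn ur rv); case uk : (mem u k) => //=; rewrite (both ur uk) eqxx; by case: (cov _ _).
by case h : (mem u k && cov u i) => //; case/andP: h => _ /(tv _ un) ->.
Qed.

Lemma cap_bound i : depth r + height k i <= n.+1.
Proof.
have [rn rk rall rbet] := crootP.
have -> : n.+1 = bsum n (fun=> 1) + bsum n (fun u => u == r).
  by rewrite (bsum_delta rn) /bsum sum_nat_const card_ord muln1 addn1.
rewrite /LayoutDefs.depth /LayoutDefs.height !bsumD; apply: leq_bsum => u un.
case ur : (anc u r); last by have := leq_b1 (mem u k && cov u i); lia.
case uk : (mem u k) => //=; have -> : u = r by apply: anc_anti => //; apply: rall.
by rewrite eqxx; case: (cov _ _).
Qed.

(** If [w] were not the root [r], then [r] would be an ancestor of the parent [v], which would lie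
    between [r] and a member. *)
Lemma tree_enter v w : v < n -> w < n -> par v w -> mem w k -> ~~ mem v k -> w = r.
Proof.
move=> vn wn /parP[vw nvw H] wk vk; have [rn rk rall rbet] := crootP.
have rw := rall _ wn wk; case: (eqVneq w r) => // /eqP wr.
have rv : anc r v by apply: H => // e; apply: wr.
by rewrite (rbet v w) in vk.
Qed.

Lemma size_bounds : 0 < size_ n mem k <= n.
Proof.
have [rn rk _ _] := crootP; apply/andP; split.
  by have := leq_term_bsum (fun u => mem u k : nat) rn; rewrite rk.
apply: leq_trans (_ : bsum n (fun=> 1) <= n).
  by apply: leq_bsum => i _; case: (mem i k).
by rewrite /bsum sum_nat_const card_ord muln1.
Qed.

End Root.

Lemma depth_par v w : v < n -> w < n -> par v w -> depth w = (depth v).+1.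
Proof.
move=> vn wn /parP[vw nvw H]; rewrite /LayoutDefs.depth -addn1 -(bsum_delta wn) bsumD.
congr bigop; apply: boolp.funext => -[u un] /=; congr BigBody.
case: (eqVneq u w) => [->|/eqP uw].
  rewrite anc_refl //; case wv : (anc w v) => //; by case: nvw; apply: anc_anti.
rewrite addn0; congr nat_of_bool; apply/idP/idP => h; first exact: H.
exact: anc_trans h vw.
Qed.

Lemma depth_anc u v : u < n -> v < n -> anc u v -> u <> v -> depth u < depth v.
Proof.
move=> un vn uv ne; rewrite /LayoutDefs.depth -addn1 -(bsum_delta vn) bsumD; apply: leq_bsum => w wn.
case: (eqVneq w v) => [->|_].
  rewrite anc_refl //; case vu : (anc v u) => //; by case: ne; apply: anc_anti.
by case wu : (anc w u); rewrite // (anc_trans wn un wu uv).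
Qed.

Lemma depth_gt0 v : v < n -> 0 < depth v.
Proof. by move=> vn; have := leq_term_bsum (fun u => anc u v : nat) vn; rewrite anc_refl. Qed.

Lemma depth_le v : depth v <= n.
Proof.
apply: leq_trans (_ : bsum n (fun=> 1) <= n).
  by apply: leq_bsum => i _; case: (anc i v).
by rewrite /bsum sum_nat_const card_ord muln1.
Qed.

Lemma cap_nested k j i : k < m -> j < m -> (forall v, v < n -> mem v j -> mem v k) ->
  cov (croot j) i ->
  anc (croot k) (croot j) /\ depth (croot j) + height j i <= depth (croot k) + height k i.
Proof.
move=> km jm sub ji; have [rn rk rall rbet] := crootP km; have [qn qk qall qbet] := crootP jm.
have rq : anc (croot k) (croot j) by apply: rall => //; apply: sub.
split => //; rewrite -(leq_add2r 1) -{1}(bsum_delta rn) -(bsum_delta qn).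
rewrite /LayoutDefs.depth /LayoutDefs.height !bsumD; apply: leq_bsum => u un.
have subu : mem u j && cov u i -> mem u k && cov u i by case/andP=> uj ->; rewrite sub.
case: (eqVneq u (croot j)) => [->|uq].
  by rewrite anc_refl // qk ji sub //=; case: (eqVneq _ (croot k)) => [->|_]; rewrite ?anc_refl //; case: (anc _ _).
have h1 : anc u (croot j) -> mem u j -> False.
  by move=> h uj; move/eqP: uq; apply; apply: anc_anti => //; apply: qall.
case: (eqVneq u (croot k)) => [E|ur].
  rewrite E anc_refl // rq rk (anc_cov rn qn rq ji) /= -E.
  case uj : (mem u j) => //=; exfalso; apply: h1 => //; by rewrite E.
rewrite !addn0; case uqa : (anc u (croot j)) => /=.
  have -> : mem u j = false by apply/negP => /(h1 uqa).
  rewrite /= addn0; have /orP[->//|ru] := cov_comparable uqa rq.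
  by rewrite (rbet u (croot j)) // ?sub // (anc_cov un qn uqa ji) addn1.
by case h : (mem u j && cov u i); [rewrite subu //; lia | lia].
Qed.

Lemma cov_bound u i : u < n -> cov u i -> i < (bsum n l).+1.
Proof.
by move=> un /andP[_ h]; rewrite ltnS; apply: leq_trans h _; apply: leq_term_bsum.
Qed.

End LayoutFacts.

End LayoutArith.

(** * The boundary of a region as a polygon *)

Module ClusterPolygons.
Import MuRecursive LayoutDefs LayoutCode MeshWalks Curves UnderGraphs LayoutArith.
From mathcomp Require Import all_boot all_order all_algebra.
From mathcomp Require Import all_classical all_reals all_analysis.
From mathcomp Require Import zify ring lra.

Set Implicit Arguments.
Unset Strict Implicit.
Unset Printing Implicit Defensive.
Import Order.TTheory GRing.Theory Num.Theory.
Import numFieldNormedType.Exports.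
Local Open Scope classical_set_scope.
Local Open Scope ring_scope.

Lemma rat_natpt (R : realType) x y : rat_point R (natpt x y) = (x%:R, y%:R).
Proof. by rewrite /rat_point /natpt /= !ratr_nat. Qed.

Lemma polyline_rcons (R : realType) (p q : R * R) s :
  polyline p (rcons s q) = polyline p s `|` segment (last p s) q.
Proof.
elim: s p => [|r s IH] p /=; first by rewrite setU0 set0U.
by rewrite IH setUA.
Qed.

Lemma lerp_ge (R : realType) (B x y t : R) : 0 <= t <= 1 -> B <= x -> B <= y ->
  B <= x + t * (y - x).
Proof.
move=> /andP[t0 t1] Bx By.
have h1 : 0 <= (1 - t) * (x - B) by apply: mulr_ge0; lra.
have h2 : 0 <= t * (y - B) by apply: mulr_ge0; lra.
have -> : x + t * (y - x) = B + (1 - t) * (x - B) + t * (y - B) by ring.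
lra.
Qed.

Lemma lerp_le (R : realType) (B x y t : R) : 0 <= t <= 1 -> x <= B -> y <= B ->
  x + t * (y - x) <= B.
Proof.
move=> t01 xB yB; have := @lerp_ge R (- B) (- x) (- y) t t01.
rewrite !lerN2 => /(_ xB yB); lra.
Qed.

Lemma lerp_gt (R : realType) (B x y t : R) : 0 <= t <= 1 -> B < x -> B < y ->
  B < x + t * (y - x).
Proof.
move=> t01 Bx By; apply: (@lt_le_trans _ _ (Num.min x y)); first by rewrite lt_min Bx.
by apply: lerp_ge => //; rewrite ge_min lexx ?orbT.
Qed.

Section Scale.
Variables (R : realType) (n : nat) (l : nat -> nat).
Definition Sr : R := (unit_ n)%:R.
Definition Xr (c : nat) : R := (colx n c)%:R.
Definition Hr (j : nat) : R := (lvlh n l * j)%:R.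

Lemma Sr_ge : n%:R + 1 <= Sr.
Proof. by rewrite /Sr /unit_ -natr1. Qed.

Lemma Sr_gt0 : 0 < Sr.
Proof. by rewrite /Sr ltr0n. Qed.

Lemma XrS c : Xr c.+1 = Xr c + 10 * Sr.
Proof. by rewrite /Xr /Sr /colx /colw -natrM -natrD; congr _%:R; ring. Qed.

Lemma Xr_lt c c' : (c < c')%N -> Xr c + 10 * Sr <= Xr c'.
Proof. by move=> lt; rewrite /Xr /Sr /colx /colw -natrM -natrD ler_nat; nia. Qed.

Lemma Xr_le c c' : (c <= c')%N -> Xr c <= Xr c'.
Proof. by move=> lt; rewrite /Xr ler_nat /colx leq_mul2l ltnS lt orbT. Qed.

Lemma Xr_inj c c' : Xr c = Xr c' -> c = c'.
Proof.
by move=> E; case: (ltngtP c c') => // /Xr_lt h; exfalso; have := Sr_gt0; lra.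
Qed.

Lemma Xr_leP c c' : Xr c <= Xr c' -> (c <= c')%N.
Proof. by move=> le; rewrite leqNgt; apply/negP => /Xr_lt; have := Sr_gt0; lra. Qed.

Lemma HrS j : Hr j.+1 = Hr j + Hr 1.
Proof. by rewrite /Hr -natrD; congr _%:R; ring. Qed.

Lemma Hr_le j j' : (j <= j')%N -> Hr j <= Hr j'.
Proof. by move=> le; rewrite ler_nat leq_mul2l le orbT. Qed.

Lemma Hr1_ge c : (c < (bsum n l).+1)%N -> Xr c <= Hr 1.
Proof.
by move=> lt; rewrite /Xr /Hr /colx /lvlh muln1 ler_nat leq_mul2l lt orbT.
Qed.

Lemma Hr1_geS : 10 * Sr <= Hr 1.
Proof. by have := Hr1_ge (ltn0Sn _); rewrite /Xr /colx muln1 /Sr /colw natrM. Qed.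

Lemma Xr_gt0 c : 10 * Sr <= Xr c.
Proof. by rewrite /Xr /Sr /colx /colw -natrM ler_nat; nia. Qed.

Lemma Hr_lt j j' : (j < j')%N -> Hr j + Hr 1 <= Hr j'.
Proof. by move=> lt; rewrite -HrS; apply: Hr_le. Qed.

End Scale.

Section ClusterPolygon.
Variables (R : realType) (n m : nat) (a mem : nat -> nat -> bool).
Variables (f l : nat -> nat) (p : nat -> nat -> nat).
Hypothesis lay : layout n m a mem f l p.

Local Notation S := (Sr R n).
Local Notation X := (Xr R n).
Local Notation H := (Hr R n l).
Local Notation depth := (depth n f l).
Local Notation croot := (croot n mem f l).
Local Notation height := (height n mem f l).
Local Notation cov := (cov f l).

Definition fk k := f (croot k).
Definition lk k := l (croot k).
Definition szr k : R := (size_ n mem k)%:R.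
Definition capr k i : R := H (depth (croot k) + height k i) - (2 * S - szr k).
Definition baser k : R := H (depth (croot k)) - szr k.
Definition wk k : R := 2 * S + 2 * szr k.
Definition xa k : R := X (fk k) - wk k.
Definition xb k : R := X (lk k) + wk k.
Definition corner k j : R * R := ((cx n mem f l k j)%:R, (cy n mem f l k j)%:R).
Definition nseg k := ((lk k - fk k).*2 + 3)%N.
(** The roof of the region: the boundary will be the graph of [uk k] between [xa k] and [xb k]
    together with the base. *)
Definition uk k : R -> R := pl (corner k 0) (map (corner k) (iota 1 (nseg k))).

Lemma szr_itv k : (k < m)%N -> 1 <= szr k <= S - 1.
Proof.
move=> km; have /andP[s1 s2] := size_bounds lay km.
have := @Sr_ge R n; rewrite /szr; have : (1 : R) <= (size_ n mem k)%:R by rewrite ler1n.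
have : (size_ n mem k)%:R <= n%:R :> R by rewrite ler_nat.
by move=> *; lra.
Qed.

Lemma wk_itv k : (k < m)%N -> 2 * S + 2 <= wk k <= 4 * S - 2.
Proof. by move=> /szr_itv /andP[s1 s2]; rewrite /wk; lra. Qed.

Lemma wk1E k : (k < m)%N -> (2 * unit_ n + (2 * size_ n mem k).-1)%:R = wk k - 1 :> R.
Proof.
move=> km; have /andP[s1 s2] := size_bounds lay km.
by rewrite natrD natrM -subn1 natrB ?natrM; [rewrite /wk /szr /Sr; lra | lia].
Qed.

Lemma fk_le k : (k < m)%N -> (fk k <= lk k)%N.
Proof. by move=> km; have [rn _ _ _] := crootP lay km; exact: (f_le_l lay rn). Qed.

Lemma capr_ge k v i : (k < m)%N -> (v < n)%N -> mem v k -> cov v i ->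
  H (depth v).+1 - (2 * S - szr k) <= capr k i.
Proof.
move=> km vn vk vi; rewrite /capr lerD2r; apply: Hr_le.
exact: (cap_ge lay km vn vk vi).
Qed.

Lemma capr_le k v i : (k < m)%N -> (v < n)%N -> ~~ mem v k -> anc f l (croot k) v -> cov v i ->
  capr k i <= H (depth v) - (2 * S - szr k).
Proof.
move=> km vn vk rv vi; rewrite /capr lerD2r; apply: Hr_le.
exact: (cap_le lay km vn vk rv vi).
Qed.

(** The root is a member over all its columns, so a cap is at least one level, less two units, above
    the level of the root. *)
Lemma capr_base k i : (k < m)%N -> (fk k <= i <= lk k)%N ->
  baser k + 6 * S <= capr k i.
Proof.
move=> km ik; have [rn rk _ _] := crootP lay km.
have := capr_ge km rn rk ik; rewrite HrS /baser; have := Hr1_geS R n l; have := szr_itv km.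
by have := Sr_gt0 R n; move=> ? /andP[? ?] *; lra.
Qed.

Lemma cyE k j : (k < m)%N -> (j <= nseg k)%N ->
  (cy n mem f l k j)%:R = if (j == 0%N) || (j == nseg k) then baser k
                         else capr k (ccol n mem f l k j).
Proof.
move=> km jn; have [rn rk _ _] := crootP lay km.
have /andP[s1 s2] := size_bounds lay km.
have d0 := depth_gt0 lay rn.
have lv : (10 * unit_ n <= lvlh n l)%N by rewrite /lvlh /colw leq_pmulr.
have un : unit_ n = n.+1 by [].
rewrite /cy /ncorner; have -> : (j.+1 == (l (croot k) - f (croot k)).*2 + 4)%N = (j == nseg k).
  by rewrite /nseg /lk /fk; lia.
case: ifP => _.
  by rewrite /base /baser natrB //; nia.
rewrite /cap /capr natrB; last by nia.
by rewrite /Hr /Sr /szr [in LHS](natrB _ (_ : size_ n mem k <= 2 * unit_ n)%N) ?natrM //; lia.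
Qed.

Lemma corner0 k : (k < m)%N -> corner k 0 = (xa k, baser k).
Proof.
move=> km; rewrite /corner cyE //=; congr (_, _).
have /andP[s1 s2] := size_bounds lay km.
have -> : cx n mem f l k 0 = (colx n (fk k) - (2 * unit_ n + 2 * size_ n mem k))%N by [].
rewrite natrB; last by rewrite /colx /colw /unit_; nia.
by rewrite natrD (natrM _ 2 (unit_ n)) (natrM _ 2 (size_ n mem k)).
Qed.

Lemma corner_last k : (k < m)%N -> corner k (nseg k) = (xb k, baser k).
Proof.
move=> km; rewrite /corner cyE // eqxx orbT; congr (_, _).
rewrite /cx /ncorner /nseg /lk /fk ifN; last by lia.
by rewrite ifT; [rewrite natrD natrD (natrM _ 2 (unit_ n)) (natrM _ 2 (size_ n mem k)) | lia].
Qed.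

Lemma corner_lo k i : (k < m)%N -> (fk k <= i <= lk k)%N ->
  corner k ((i - fk k).*2 + 1) = (X i - (if i == fk k then wk k - 1 else 4 * S), capr k i).
Proof.
move=> km /andP[i1 i2]; have cc : ccol n mem f l k ((i - fk k).*2 + 1) = i.
  by rewrite /ccol -/(fk k); lia.
rewrite /corner cyE //; last by rewrite /nseg; lia.
rewrite cc ifN; last by rewrite /nseg; lia.
rewrite /cx /ncorner ifN ?cc; last by lia.
rewrite ifN; last by rewrite -/(fk k) -/(lk k); lia.
rewrite ifT; last by lia.
have /andP[s1 s2] := size_bounds lay km.
rewrite -/(fk k) natrB; last by rewrite /colx /colw /unit_; case: ifP => _; nia.
by congr (_ - _, _); case: ifP => _; rewrite ?wk1E ?natrM.
Qed.

Lemma corner1 k : (k < m)%N -> corner k 1 = (X (fk k) - (wk k - 1), capr k (fk k)).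
Proof.
move=> km; have := @corner_lo k (fk k) km; rewrite subnn eqxx leqnn (fk_le km); exact.
Qed.

Lemma corner_hi k i : (k < m)%N -> (fk k <= i <= lk k)%N ->
  corner k ((i - fk k).*2 + 2) = (X i + (if i == lk k then wk k - 1 else 4 * S), capr k i).
Proof.
move=> km /andP[i1 i2]; have cc : ccol n mem f l k ((i - fk k).*2 + 2) = i.
  by rewrite /ccol -/(fk k); lia.
rewrite /corner cyE //; last by rewrite /nseg; lia.
rewrite cc ifN; last by rewrite /nseg; lia.
rewrite /cx /ncorner ifN ?cc; last by lia.
rewrite ifN; last by rewrite -/(fk k) -/(lk k); lia.
rewrite ifN; last by lia.
by rewrite -/(lk k) natrD; congr (_ + _, _); case: ifP => _; rewrite ?wk1E ?natrM.
Qed.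

(* the index of a corner: first, last, or one end of the roof over a column *)
Lemma corner_index k j : (k < m)%N -> (j < nseg k)%N ->
  [\/ j = 0%N, exists2 i, (fk k <= i <= lk k)%N & j = ((i - fk k).*2 + 1)%N
    | exists2 i, (fk k <= i <= lk k)%N & j = ((i - fk k).*2 + 2)%N].
Proof.
move=> km jn; have le := fk_le km; rewrite /nseg in jn.
case: j jn => [|j] jn; first by apply: Or31.
case oj : (odd j); [apply: Or33 | apply: Or32]; exists (fk k + j./2)%N; lia.
Qed.

Lemma corner_incr k j : (k < m)%N -> (j < nseg k)%N -> (corner k j).1 < (corner k j.+1).1.
Proof.
move=> km jn; have S0 := Sr_gt0 R n; have /andP[s1 s2] := wk_itv km.
case: (corner_index km jn) => [->|[i ik ->]|[i ik ->]].
- by rewrite corner0 // corner1 //= /xa; lra.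
- have -> : ((i - fk k).*2 + 1).+1 = ((i - fk k).*2 + 2)%N by lia.
  by rewrite corner_lo // corner_hi //=; case: ifP => _; case: ifP => _; lra.
- case: (eqVneq i (lk k)) => [il|il].
    have -> : ((i - fk k).*2 + 2).+1 = nseg k by rewrite /nseg; lia.
    by rewrite corner_hi // corner_last //= il eqxx /xb; lra.
  have -> : ((i - fk k).*2 + 2).+1 = ((i.+1 - fk k).*2 + 1)%N by lia.
  rewrite corner_hi // corner_lo //=; last by lia.
  rewrite (negbTE il) ifN; last by lia.
  by have := XrS R n i; lra.
Qed.

Lemma uk_seg k j x : (k < m)%N -> (j < nseg k)%N -> (corner k j).1 <= x <= (corner k j.+1).1 ->
  uk k x = (corner k j).2 + slope (corner k j) (corner k j.+1) * (x - (corner k j).1).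
Proof.
move=> km jn xj.
have inc t : (t < 0 + nseg k)%N -> (corner k t).1 < (corner k t.+1).1 by apply: corner_incr.
exact: (pl_nth inc (jn : (0 <= j < 0 + nseg k)%N) xj).2.
Qed.

Lemma uk_path k : (k < m)%N -> path (@xlt R) (corner k 0) (map (corner k) (iota 1 (nseg k))).
Proof.
move=> km; have j0 : (0 < nseg k)%N by rewrite /nseg addn3.
have x0 : (corner k 0).1 <= (corner k 0).1 <= (corner k 1).1 by rewrite lexx ltW // corner_incr.
have inc t : (t < 0 + nseg k)%N -> (corner k t).1 < (corner k t.+1).1 by apply: corner_incr.
exact: (pl_nth inc (j0 : (0 <= 0 < 0 + nseg k)%N) x0).1.
Qed.

Lemma uk_flat k i x : (k < m)%N -> (fk k <= i <= lk k)%N ->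
  X i - (if i == fk k then wk k - 1 else 4 * S) <= x <= X i + (if i == lk k then wk k - 1 else 4 * S) ->
  uk k x = capr k i.
Proof.
move=> km ik xi; have E : ((i - fk k).*2 + 1).+1 = ((i - fk k).*2 + 2)%N by lia.
rewrite (@uk_seg k ((i - fk k).*2 + 1)) //; last by rewrite E corner_lo // corner_hi.
  by rewrite E /slope corner_lo // corner_hi //= subrr mul0r mul0r addr0.
by rewrite /nseg; lia.
Qed.

(** This includes the two outer columns, where the flat piece ends [wk k - 1 > 2 * S] outwards from
    the centre. *)
Lemma uk_near k i x : (k < m)%N -> (fk k <= i <= lk k)%N -> `|x - X i| <= 2 * S ->
  uk k x = capr k i.
Proof.
move=> km ik; rewrite ler_norml => /andP[x1 x2]; apply: uk_flat => //.
have S0 := Sr_gt0 R n; have /andP[s1 s2] := wk_itv km.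
by case: ifP => _; case: ifP => _; apply/andP; split; lra.
Qed.

Lemma uk_trans k i t : (k < m)%N -> (fk k <= i)%N -> (i < lk k)%N -> 0 <= t <= 1 ->
  uk k (X i + 4 * S + 2 * S * t) = capr k i + t * (capr k i.+1 - capr k i).
Proof.
move=> km i1 i2 t01; have S0 := Sr_gt0 R n; have XS := XrS R n i.
have ik : (fk k <= i <= lk k)%N by rewrite i1 ltnW.
have ik' : (fk k <= i.+1 <= lk k)%N by rewrite i2 leqW.
have E : ((i - fk k).*2 + 2).+1 = ((i.+1 - fk k).*2 + 1)%N by lia.
have ni : (i == lk k) = false by lia.
have ni' : (i.+1 == fk k) = false by lia.
rewrite (@uk_seg k ((i - fk k).*2 + 2)) //; first last.
- by rewrite E corner_hi // corner_lo //= ni ni' XS; nra.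
- by rewrite /nseg; lia.
rewrite E corner_hi // corner_lo // /slope /= ni ni' XS.
have S2 : X i + 10 * S - 4 * S - (X i + 4 * S) = 2 * S by ring.
rewrite S2; field; by rewrite gt_eqF.
Qed.

Lemma uk_left k t : (k < m)%N -> 0 <= t <= 1 ->
  uk k (xa k + t) = baser k + t * (capr k (fk k) - baser k).
Proof.
move=> km t01; have /andP[s1 s2] := szr_itv km.
rewrite (@uk_seg k 0) //; first last.
- by rewrite corner0 // corner1 //= /xa; lra.
- by rewrite /nseg; lia.
rewrite corner0 // corner1 // /slope /=.
have -> : X (fk k) - (wk k - 1) - xa k = 1 by rewrite /xa; ring.
by field.
Qed.

Lemma uk_right k t : (k < m)%N -> 0 <= t <= 1 ->
  uk k (xb k - t) = baser k + t * (capr k (lk k) - baser k).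
Proof.
move=> km t01; have /andP[s1 s2] := szr_itv km.
have fl : (fk k <= lk k <= lk k)%N by rewrite leqnn fk_le.
have E : ((lk k - fk k).*2 + 2).+1 = nseg k by rewrite /nseg; lia.
rewrite (@uk_seg k ((lk k - fk k).*2 + 2)) //; first last.
- by rewrite E corner_last // corner_hi // eqxx /= /xb; lra.
- by rewrite /nseg; lia.
rewrite E corner_last // corner_hi // eqxx /slope /=.
have -> : xb k - (X (lk k) + (wk k - 1)) = 1 by rewrite /xb; ring.
by rewrite /xb; field.
Qed.

Variant uk_spec k x : Prop :=
| UkLeft t of 0 <= t <= 1 & x = xa k + t
    & uk k x = baser k + t * (capr k (fk k) - baser k)
| UkRight t of 0 <= t <= 1 & x = xb k - t
    & uk k x = baser k + t * (capr k (lk k) - baser k)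
| UkFlat i of (fk k <= i <= lk k)%N
    & X i - (if i == fk k then wk k - 1 else 4 * S) <= x <= X i + (if i == lk k then wk k - 1 else 4 * S)
    & uk k x = capr k i
| UkTrans i t of (fk k <= i)%N & (i < lk k)%N & 0 <= t <= 1
    & x = X i + 4 * S + 2 * S * t & uk k x = capr k i + t * (capr k i.+1 - capr k i).

Lemma ukP k x : (k < m)%N -> xa k <= x <= xb k -> uk_spec k x.
Proof.
move=> km xab; have S0 := Sr_gt0 R n; have /andP[s1 s2] := szr_itv km.
have [||j jn] := @grid_interval R (corner k) (nseg k) x.
- by rewrite corner0 // corner_last.
- by rewrite /nseg addn3.
case: (corner_index km jn) => [->|[i ik ->]|[i ik ->]].
- rewrite corner0 // corner1 //= => xj.
  have xE : x = xa k + (x - xa k) by ring.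
  have t01 : 0 <= x - xa k <= 1 by move: xj; rewrite /xa; lra.
  apply: (UkLeft t01 xE); rewrite {1}xE; exact: uk_left.
- have -> : ((i - fk k).*2 + 1).+1 = ((i - fk k).*2 + 2)%N by lia.
  rewrite corner_lo // corner_hi //= => xj.
  by apply: (UkFlat ik xj); apply: uk_flat.
- case: (eqVneq i (lk k)) => [il|il].
    have -> : ((i - fk k).*2 + 2).+1 = nseg k by rewrite /nseg; lia.
    rewrite corner_hi // corner_last //= il eqxx => xj.
    have xE : x = xb k - (xb k - x) by ring.
    have t01 : 0 <= xb k - x <= 1 by move: xj; rewrite /xb; lra.
    apply: (UkRight t01 xE); rewrite {1}xE; exact: uk_right.
  have i2 : (i < lk k)%N by lia.
  have i1 : (fk k <= i)%N by lia.
  have -> : ((i - fk k).*2 + 2).+1 = ((i.+1 - fk k).*2 + 1)%N by lia.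
  rewrite corner_hi // corner_lo //=; last by lia.
  rewrite (negbTE il) ifN; last by lia.
  have XS := XrS R n i; rewrite XS => xj.
  have xE : x = X i + 4 * S + 2 * S * ((x - X i - 4 * S) / (2 * S)).
    by field; rewrite gt_eqF.
  have t01 : 0 <= (x - X i - 4 * S) / (2 * S) <= 1.
    by rewrite divr_ge0 ?ler_pdivrMr ?mul1r //; lra.
  apply: (UkTrans i1 i2 t01 xE); rewrite {1}xE; exact: uk_trans.
Qed.

Lemma uk_cont k : continuous (uk k).
Proof. exact: pl_continuous. Qed.

Lemma uk_a k : (k < m)%N -> uk k (xa k) = baser k.
Proof.
move=> km; have := @uk_left k 0 km; rewrite lexx ler01 addr0 mul0r addr0; exact.
Qed.

Lemma uk_b k : (k < m)%N -> uk k (xb k) = baser k.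
Proof.
move=> km; have := @uk_right k 0 km; rewrite lexx ler01 subr0 mul0r addr0; exact.
Qed.

Lemma xa_lt_xb k : (k < m)%N -> xa k < xb k.
Proof.
move=> km; have S0 := Sr_gt0 R n; have /andP[s1 s2] := wk_itv km.
by have := Xr_le R n (fk_le km); rewrite /xa /xb; lra.
Qed.

Lemma uk_gt k x : (k < m)%N -> xa k < x < xb k -> baser k < uk k x.
Proof.
move=> km xab; have S0 := Sr_gt0 R n; have /andP[s1 s2] := szr_itv km.
have fl := fk_le km.
have cb i : (fk k <= i <= lk k)%N -> baser k < capr k i by move=> /(capr_base km); lra.
have xab' : xa k <= x <= xb k by lra.
case: (ukP km xab') => [t t01 xE ->|t t01 xE ->|i ik xi ->|i t i1 i2 t01 xE ->].
- have t0 : 0 < t by have := xE; lra.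
  by have := cb (fk k); rewrite leqnn fl => /(_ isT) h; nra.
- have t0 : 0 < t by have := xE; lra.
  by have := cb (lk k); rewrite leqnn fl => /(_ isT) h; nra.
- exact: cb.
- have h1 : baser k < capr k i by apply: cb; rewrite i1 ltnW.
  have h2 : baser k < capr k i.+1 by apply: cb; rewrite i2 leqW.
  exact: lerp_gt.
Qed.

Lemma polygon_border k : (k < m)%N ->
  polygon (map (rat_point R) (mkseq (fun j => natpt (cx n mem f l k j) (cy n mem f l k j)) (ncorner n mem f l k))) =
  graph_border (xa k) (xb k) (baser k) (uk k) /\
  simple_closed_curve (graph_border (xa k) (xb k) (baser k) (uk k)).
Proof.
move=> km; have ab := xa_lt_xb km.
have -> : map (rat_point R) (mkseq (fun j => natpt (cx n mem f l k j) (cy n mem f l k j)) (ncorner n mem f l k))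
  = corner k 0 :: map (corner k) (iota 1 (nseg k)).
  rewrite /mkseq -map_comp (eq_map (g := corner k)); last by move=> j /=; rewrite rat_natpt.
  by rewrite /ncorner -/(fk k) -/(lk k) addnS -/(nseg k).
rewrite [polygon _]/= polyline_rcons.
have lastE : last (corner k 0) (map (corner k) (iota 1 (nseg k))) = corner k (nseg k).
  have N0 : (0 < nseg k)%N by rewrite /nseg addn3.
  by rewrite last_map -nth_last size_iota nth_iota ?ltn_predL // add1n prednK.
rewrite lastE; have pth := uk_path km; rewrite /uk.
have [q [s sE]] : exists q s, map (corner k) (iota 1 (nseg k)) = q :: s.
  by rewrite /nseg addn3 /=; eexists; eexists.
rewrite sE in pth lastE *.
have gr z := polyline_graph z pth.
have lq : last q s = corner k (nseg k) by [].
have base_seg z : segment (corner k (nseg k)) (corner k 0) z <-> xa k <= z.1 <= xb k /\ z.2 = baser k.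
  rewrite segment_sym corner0 // corner_last // segment_graph //=.
  by rewrite /slope /= subrr mul0r mul0r addr0.
have E : polyline (corner k 0) (q :: s) `|` segment (corner k (nseg k)) (corner k 0) =
  graph_border (xa k) (xb k) (baser k) (pl (corner k 0) (q :: s)).
  apply/seteqP; split => z.
    case=> [/gr|/base_seg]; rewrite ?lq ?corner0 ?corner_last //= => -[z1 z2]; split => //; by [left|right].
  move=> [z1 [z2|z2]]; [left; apply/gr | right; apply/base_seg] => //.
  by split => //; rewrite lq corner0 // corner_last.
split => //; rewrite -E.
have ukE : pl (corner k 0) (q :: s) = uk k by rewrite /uk sE.
apply: (@arc_closed R (corner k 0) (corner k (nseg k))).
- by rewrite -lq; apply: polyline_arc.
- by apply: arc_segment; rewrite corner0 // corner_last // => -[h]; lra.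
- move=> z [/gr[_ z2] /base_seg[z1 z2']]; rewrite ukE in z2.
  case: (ltrP (xa k) z.1) => za; last first.
    left; rewrite corner0 // [z]surjective_pairing z2'; congr (_, _); lra.
  case: (ltrP z.1 (xb k)) => zb; last first.
    right; rewrite corner_last // [z]surjective_pairing z2'; congr (_, _); lra.
  by have := @uk_gt k z.1 km; rewrite za zb => /(_ isT); lra.
Qed.

End ClusterPolygon.

End ClusterPolygons.

(** * Nested and disjoint regions *)

Module Regions.
Import MuRecursive LayoutDefs LayoutCode MeshWalks Curves UnderGraphs LayoutArith ClusterPolygons.
From mathcomp Require Import all_boot all_order all_algebra.
From mathcomp Require Import all_classical all_reals all_analysis.
From mathcomp Require Import zify ring lra.

Ltac nlia :=
  match goal with K : realType |- _ =>
    repeat match goal with H : context [K] |- _ => clear H end end; lia.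

Set Implicit Arguments.
Unset Strict Implicit.
Unset Printing Implicit Defensive.
Import Order.TTheory GRing.Theory Num.Theory.
Import numFieldNormedType.Exports.
Local Open Scope classical_set_scope.
Local Open Scope ring_scope.

Section Geometry.
Variables (R : realType) (n m : nat) (a mem : nat -> nat -> bool).
Variables (f l : nat -> nat) (p : nat -> nat -> nat).
Hypothesis lay : layout n m a mem f l p.
Hypothesis a_sym : forall u v, (u < n)%N -> (v < n)%N -> a u v = a v u.
Hypothesis a_irr : forall u, (u < n)%N -> ~~ a u u.

Local Notation S := (Sr R n).
Local Notation X := (Xr R n).
Local Notation H := (Hr R n l).
Local Notation depth := (depth n f l).
Local Notation croot := (croot n mem f l).
Local Notation height := (height n mem f l).
Local Notation cov := (cov f l).
Local Notation anc := (anc f l).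
Local Notation par := (par n f l).
Local Notation chord := (chord n a f l).
Local Notation fk := (fk n mem f l).
Local Notation lk := (lk n mem f l).
Local Notation xa := (xa R n mem f l).
Local Notation xb := (xb R n mem f l).
Local Notation uk := (@uk R n mem f l).
Local Notation baser := (baser R n mem f l).
Local Notation capr := (capr R n mem f l).
Local Notation szr := (szr R n mem).
Local Notation wk := (wk R n mem).

Definition bord k : set (R * R) := graph_border (xa k) (xb k) (baser k) (uk k).
Definition reg k : set (R * R) := under_graph (xa k) (xb k) (baser k) (uk k).

Lemma reg_enclosed k : (k < m)%N -> enclosed (bord k) = reg k.
Proof.
move=> km; apply: enclosed_under_graph.
- exact: (xa_lt_xb R lay km).
- exact: uk_cont.
- exact: (uk_a R lay km).
- exact: (uk_b R lay km).
- by move=> x; apply: (uk_gt lay km).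
Qed.

Lemma reg_connected k : (k < m)%N -> connected (reg k).
Proof.
move=> km; apply: connected_under_graph.
- exact: (xa_lt_xb R lay km).
- exact: (uk_a R lay km).
- exact: (uk_b R lay km).
- by move=> x; apply: (uk_gt lay km).
Qed.

Lemma bord_reg k : (k < m)%N -> bord k `<=` reg k.
Proof. by move=> km; rewrite -reg_enclosed // => z; left. Qed.

Lemma reg_inside k z : (k < m)%N -> xa k < z.1 < xb k -> baser k < z.2 < uk k z.1 -> reg k z /\ ~ bord k z.
Proof.
move=> km z1 z2; split; first by split; lra.
by case=> _ []; lra.
Qed.

Lemma uk_le_range k i1 i2 B x : (k < m)%N -> (fk k <= i1)%N -> (i2 <= lk k)%N -> (i1 <= i2)%N ->
  (forall i, (i1 <= i <= i2)%N -> capr k i <= B) -> baser k <= B ->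
  xa k <= x <= xb k -> X i1 - 4 * S <= x <= X i2 + 4 * S -> uk k x <= B.
Proof.
move=> km f1 l2 i12 HB bB xab /andP[x1 x2]; have S0 := Sr_gt0 R n; have /andP[w1 w2] := wk_itv R lay km.
have /andP[xa1 xa2] := xab.
case: (ukP lay km xab) => [t t01 xE ->|t t01 xE ->|i ik xi ->|i t h1 h2 t01 xE ->].
- have E : i1 = fk k.
    apply/eqP; rewrite eqn_leq f1 andbT leqNgt; apply/negP => /(Xr_lt R n).
    by move: xE; rewrite /ClusterPolygons.xa; lra.
  by apply: lerp_le => //; apply: HB; rewrite E leqnn -E.
- have E : i2 = lk k.
    apply/eqP; rewrite eqn_leq l2 leqNgt; apply/negP => /(Xr_lt R n).
    by move: xE; rewrite /ClusterPolygons.xb; lra.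
  by apply: lerp_le => //; apply: HB; rewrite E leqnn -E i12.
- have /andP[c1 c2] : X i - 4 * S <= x <= X i + 4 * S.
    by move: xi; case: ifP => _; case: ifP => _ /andP[? ?]; apply/andP; split; lra.
  apply: HB; apply/andP; split; rewrite leqNgt; apply/negP => /(Xr_lt R n); lra.
- have XS := XrS R n i; have /andP[t0 t1] := t01.
  have St : 0 <= 2 * S * t by rewrite !mulr_ge0 //; lra.
  have St' : 2 * S * t <= 2 * S by rewrite ler_piMr //; lra.
  have lo : (i1 <= i.+1)%N by rewrite leqNgt; apply/negP => /(Xr_lt R n); lra.
  have hi : (i <= i2)%N by rewrite leqNgt; apply/negP => /(Xr_lt R n); lra.
  case: (leqP i1 i) => hh1; last first.
    have E : i.+1 = i1 by nlia.
    have t1E : t = 1.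
      have : 2 * S * t = 2 * S by rewrite -E in x1; lra.
      by move=> /eqP; rewrite -subr_eq0 -{2}[2 * S]mulr1 -mulrBr mulf_eq0 => /orP[] /eqP; lra.
    by rewrite t1E mul1r subrKC E; apply: HB; rewrite leqnn.
  case: (leqP i.+1 i2) => hh2; last first.
    have E : i = i2 by nlia.
    have t0E : t = 0.
      have : 2 * S * t = 0 by rewrite E in xE; lra.
      by move=> /eqP; rewrite mulf_eq0 => /orP[] /eqP; lra.
    by rewrite t0E mul0r addr0 E; apply: HB; rewrite leqnn i12.
  by apply: lerp_le => //; apply: HB; nlia.
Qed.

Lemma uk_ge_range k i1 i2 B x : (k < m)%N -> (fk k <= i1)%N -> (i2 <= lk k)%N ->
  (forall i, (i1 <= i <= i2)%N -> B <= capr k i) -> X i1 <= x <= X i2 -> B <= uk k x.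
Proof.
move=> km f1 l2 HB /andP[x1 x2]; have S0 := Sr_gt0 R n; have /andP[w1 w2] := wk_itv R lay km.
have fx := Xr_le R n f1; have lx := Xr_le R n l2.
have xab : xa k <= x <= xb k by rewrite /ClusterPolygons.xa /ClusterPolygons.xb; apply/andP; split; lra.
case: (ukP lay km xab) => [t t01 xE ->|t t01 xE ->|i ik xi ->|i t h1 h2 t01 xE ->].
- by exfalso; move: xE; rewrite /ClusterPolygons.xa; lra.
- by exfalso; move: xE; rewrite /ClusterPolygons.xb; lra.
- have /andP[c1 c2] : X i - 4 * S <= x <= X i + 4 * S.
    by move: xi; case: ifP => _; case: ifP => _ /andP[? ?]; apply/andP; split; lra.
  apply: HB; apply/andP; split; rewrite leqNgt; apply/negP => /(Xr_lt R n); lra.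
- have XS := XrS R n i; have /andP[t0 t1] := t01.
  have St : 0 <= 2 * S * t by rewrite !mulr_ge0 //; lra.
  have St' : 2 * S * t <= 2 * S by rewrite ler_piMr //; lra.
  have lo : (i1 <= i)%N by rewrite leqNgt; apply/negP => h; have := Xr_le R n h; lra.
  have hi : (i < i2)%N by rewrite ltnNge; apply/negP => h; have := Xr_le R n h; lra.
  by apply: lerp_ge => //; apply: HB; nlia.
Qed.

(** The offsets give [k] a lower base and higher caps. Since [wk] differs by at least 2 and sides
    have width 1, the sloping sides of [j] lie below a flat piece of the roof of [k]; on the
    passages, both roofs are interpolated with the same parameter. *)
Lemma reg_nested k j : (k < m)%N -> (j < m)%N ->
  (forall v, (v < n)%N -> mem v j -> mem v k) -> (size_ n mem j < size_ n mem k)%N ->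
  forall z, reg j z -> reg k z /\ ~ bord k z.
Proof.
move=> km jm sub szlt z [zx /andP[zb zu]]; have S0 := Sr_gt0 R n.
have /andP[w1 w2] := wk_itv R lay km; have /andP[w1' w2'] := wk_itv R lay jm.
have [rn rk rall rbet] := crootP lay km; have [qn qk qall qbet] := crootP lay jm.
have sz : szr j + 1 <= szr k by rewrite /ClusterPolygons.szr natr1 ler_nat.
have wlt : wk j + 2 <= wk k by rewrite /ClusterPolygons.wk; lra.
have ij : (fk j <= fk j <= lk j)%N by rewrite leqnn (fk_le lay jm).
have rq : anc (croot k) (croot j) by case: (cap_nested lay km jm sub ij).
have ff : (fk k <= fk j)%N by move: rq; rewrite /LayoutDefs.anc /LayoutDefs.cov /ClusterPolygons.fk => /andP[].
have ll : (lk j <= lk k)%N by apply: (anc_l lay).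
have capN i : (fk j <= i <= lk j)%N -> capr j i < capr k i.
  move=> ik; have [_ le] := cap_nested lay km jm sub ik.
  by have := Hr_le R n l le; rewrite /ClusterPolygons.capr; lra.
have bN : baser k < baser j.
  rewrite /ClusterPolygons.baser; suff : H (depth (croot k)) <= H (depth (croot j)) by lra.
  apply: Hr_le; case: (eqVneq (croot k) (croot j)) => [->//|/eqP ne].
  exact/ltnW/(depth_anc lay).
have Xf := Xr_le R n ff; have Xl := Xr_le R n ll.
have zk : xa k < z.1 < xb k.
  by move: zx; rewrite /ClusterPolygons.xa /ClusterPolygons.xb => /andP[? ?]; apply/andP; split; lra.
apply: reg_inside => //; apply/andP; split; first lra.
have win i x : (fk j <= i <= lk j)%N -> (i = fk j -> X i - wk j <= x) -> (i <> fk j -> X i - 4 * S <= x) ->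
   (i = lk j -> x <= X i + wk j) -> (i <> lk j -> x <= X i + 4 * S) -> uk k x = capr k i.
  move=> ik a1 a2 a3 a4; apply: (uk_flat lay km); first by nlia.
  apply/andP; split.
    case: (eqVneq i (fk k)) => [E|_]; first by have := a1; rewrite (_ : i = fk j) => [/(_ erefl)|]; [lra|nlia].
    by case: (eqVneq i (fk j)) => [/a1|/eqP/a2]; lra.
  case: (eqVneq i (lk k)) => [E|_]; first by have := a3; rewrite (_ : i = lk j) => [/(_ erefl)|]; [lra|nlia].
  by case: (eqVneq i (lk j)) => [/a3|/eqP/a4]; lra.
have capB i : (fk j <= i <= lk j)%N -> baser j <= capr j i.
  by move=> /(capr_base R lay jm); lra.
apply: (le_lt_trans zu).
case: (ukP lay jm zx) => [t t01 xE ->|t t01 xE ->|i ik xi ->|i t h1 h2 t01 xE ->].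
- rewrite (win (fk j)) //; first by apply: le_lt_trans (capN _ ij); apply: lerp_le => //; apply: capB.
  + by move=> _; rewrite xE /ClusterPolygons.xa; lra.
  + by move=> _; rewrite xE /ClusterPolygons.xa; lra.
  + by move=> _; rewrite xE /ClusterPolygons.xa; lra.
- have il : (fk j <= lk j <= lk j)%N by rewrite leqnn (fk_le lay jm).
  rewrite (win (lk j)) //; first by apply: le_lt_trans (capN _ il); apply: lerp_le => //; apply: capB.
  + by move=> _; rewrite xE /ClusterPolygons.xb; lra.
  + by move=> _; rewrite xE /ClusterPolygons.xb; lra.
  + by move=> _; rewrite xE /ClusterPolygons.xb; lra.
- rewrite (win i) //; first exact: capN.
  + by move=> E; move: xi; rewrite E eqxx => /andP[? _]; lra.
  + by move=> /eqP/negbTE E; move: xi; rewrite E => /andP[? _]; lra.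
  + by move=> E; move: xi; rewrite E eqxx => /andP[_ ?]; lra.
  + by move=> /eqP/negbTE E; move: xi; rewrite E => /andP[_ ?]; lra.
- have i1 : (fk j <= i <= lk j)%N by rewrite h1 ltnW.
  have i2 : (fk j <= i.+1 <= lk j)%N by rewrite h2 leqW.
  have f1 : (fk k <= i)%N by nlia.
  have l1 : (i < lk k)%N by nlia.
  have c1 := capN _ i1; have c2 := capN _ i2.
  rewrite xE (uk_trans lay km f1 l1 t01) -subr_gt0.
  have -> : capr k i + t * (capr k i.+1 - capr k i) - (capr j i + t * (capr j i.+1 - capr j i)) =
    (capr k i - capr j i) + t * ((capr k i.+1 - capr j i.+1) - (capr k i - capr j i)) by ring.
  by apply: lerp_gt => //; lra.
Qed.

Lemma interval_disjoint u v : (u < n)%N -> (v < n)%N -> ~~ anc u v -> ~~ anc v u -> (l u < f v)%N \/ (l v < f u)%N.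
Proof.
by move=> un vn; have := f_le_l lay un; have := f_le_l lay vn; rewrite /LayoutDefs.anc /LayoutDefs.cov; nlia.
Qed.

(** If neither root is an ancestor of the other, their columns are disjoint and [wk < 4 * S] keeps
    the regions apart. Otherwise let the root of [j] be below that of [k] in the tree: it is not a
    member of [k], so over its columns the roof of [k] is at least [2 * S - szr k] under the level
    of this root, while the base of [j] is only [szr j] under it, and both sizes are less than
    [S]. *)
Lemma reg_disjoint k j z : (k < m)%N -> (j < m)%N ->
  (forall v, (v < n)%N -> mem v j -> ~~ mem v k) -> reg k z -> reg j z -> False.
Proof.
have S0 := Sr_gt0 R n.
wlog rq : k j / ~~ anc (croot j) (croot k) => [W|].
  move=> km jm dis rk rj; case: (boolP (anc (croot j) (croot k))) => h; last exact: (W k j).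
  case: (boolP (anc (croot k) (croot j))) => h'.
    have [rn rk' _ _] := crootP lay km; have [qn qk _ _] := crootP lay jm.
    by have := dis _ qn qk; rewrite (anc_anti lay qn rn h h') rk'.
  apply: (W j k) => // v vn vk; apply/negP => vj; by have := dis v vn vj; rewrite vk.
move=> km jm dis [kx /andP[kb ku]] [jx /andP[jb ju]].
have /andP[w1 w2] := wk_itv R lay km; have /andP[w1' w2'] := wk_itv R lay jm.
have [rn rk _ _] := crootP lay km; have [qn qk _ _] := crootP lay jm.
case: (boolP (anc (croot k) (croot j))) => h; last first.
  case: (interval_disjoint rn qn h rq) => /(Xr_lt R n); move: kx jx;
    rewrite /ClusterPolygons.xa /ClusterPolygons.xb /ClusterPolygons.fk /ClusterPolygons.lk => /andP[? ?] /andP[? ?]; lra.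
have nq := dis _ qn qk.
suff : uk k z.1 <= H (depth (croot j)) - (2 * S - szr k).
  have := szr_itv R lay km; have := szr_itv R lay jm; move: jb; rewrite /ClusterPolygons.baser => ? /andP[? ?] /andP[? ?]; lra.
have fl := fk_le lay jm.
have cap_j i : (fk j <= i <= lk j)%N -> capr k i <= H (depth (croot j)) - (2 * S - szr k).
  by move=> ik; apply: (capr_le R lay km qn nq h).
apply: (@uk_le_range k (fk j) (lk j)) => //.
- by move: h; rewrite /LayoutDefs.anc /LayoutDefs.cov => /andP[].
- exact: (anc_l lay rn qn h).
- have fj : (fk j <= fk j <= lk j)%N by rewrite leqnn fl.
  have hj : (fk k <= fk j <= lk k)%N by exact: h.
  by have := cap_j _ fj; have := capr_base R lay km hj; lra.
- by move: jx; rewrite /ClusterPolygons.xa /ClusterPolygons.xb => /andP[? ?]; apply/andP; split; lra.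
Qed.

(** Base and roof are treated together, since a tree edge enters a cluster through its base and
    edges leave through its roof. The vertical radius [S] separates the two, which are [6 * S]
    apart. *)
Lemma bord_flat k i x y : (k < m)%N -> (fk k <= i <= lk k)%N -> `|x - X i| < 2 * S ->
  y = capr k i \/ y = baser k -> bord k (x, y) /\ locally_horizontal (bord k) (x, y).
Proof.
move=> km ik xi yE; have S0 := Sr_gt0 R n; have /andP[w1 w2] := wk_itv R lay km.
have /andP[i1 i2] := ik; have Xf := Xr_le R n i1; have Xl := Xr_le R n i2.
have cb := capr_base R lay km ik.
have loc z : `|z - (x, y)| < Num.min (2 * S - `|x - X i|) S -> bord k z <-> z.2 = y.
  rewrite prod_norm_lt /= !lt_min => /andP[/andP[z1 _] /andP[_ z2]].
  have d : `|z.1 - X i| <= 2 * S.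
    rewrite -[z.1 - _](subrKA x); apply: le_trans (ler_normD _ _) _; lra.
  have uE := uk_near lay km ik d.
  move: d; rewrite ler_norml => /andP[d1 d2]; move: z2; rewrite ltr_norml => /andP[e1 e2].
  split.
    by move=> [_]; rewrite uE; case: yE => yE [] E //; lra.
  move=> E; split; first by rewrite /ClusterPolygons.xa /ClusterPolygons.xb; apply/andP; split; lra.
  by rewrite uE E; case: yE => ->; [left|right].
have r0 : 0 < Num.min (2 * S - `|x - X i|) S by rewrite lt_min; apply/andP; split; lra.
split; last by exists (Num.min (2 * S - `|x - X i|) S).
by apply/loc => //; rewrite subrr normr0.
Qed.

End Geometry.

End Regions.

(** * Half-edges and the upper parts of chords *)

Module Fans.
Import MuRecursive LayoutDefs LayoutCode MeshWalks Curves UnderGraphs LayoutArith ClusterPolygons Regions.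
From mathcomp Require Import all_boot all_order all_algebra.
From mathcomp Require Import all_classical all_reals all_analysis.
From mathcomp Require Import zify ring lra.

Set Implicit Arguments.
Unset Strict Implicit.
Unset Printing Implicit Defensive.
Import Order.TTheory GRing.Theory Num.Theory.
Import numFieldNormedType.Exports.
Local Open Scope classical_set_scope.
Local Open Scope ring_scope.

Lemma vertical_segment (R : realType) (x y y' : R) z : y <= y' ->
  segment (x, y) (x, y') z <-> z.1 = x /\ y <= z.2 <= y'.
Proof.
move=> yy; rewrite segmentP /=; split.
  case=> t /andP[t0 t1] -> /=; split; first by ring.
  have h1 : 0 <= t * (y' - y) by apply: mulr_ge0; lra.
  have h2 : 0 <= (1 - t) * (y' - y) by apply: mulr_ge0; lra.
  have h3 : t * (y' - y) + (1 - t) * (y' - y) = y' - y by ring.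
  by apply/andP; split; lra.
case: z => z1 z2 /= [-> /andP[h1 h2]]; case: (eqVneq y y') => [E|ne].
  by exists 0; [rewrite lexx ler01 | congr (_, _); lra].
have d0 : 0 < y' - y by rewrite subr_gt0 lt_neqAle ne.
exists ((z2 - y) / (y' - y)).
  by rewrite divr_ge0 ?ler_pdivrMr ?mul1r //; lra.
by congr (_, _); [ring | rewrite divfK ?gt_eqF //; ring].
Qed.

Lemma horizontal_segment (R : realType) (x x' y : R) z :
  segment (x, y) (x', y) z <-> z.2 = y /\ (x <= z.1 <= x' \/ x' <= z.1 <= x).
Proof.
have aux (u u' : R) w : u <= u' -> segment (u, y) (u', y) w <-> w.2 = y /\ u <= w.1 <= u'.
  move=> uu; have := @vertical_segment R y u u' (w.2, w.1) uu => -[A B]; split.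
    move=> /segmentP[t t01 /= wE]; apply: A; apply/segmentP; exists t => //=.
    by rewrite wE.
  move=> /B /segmentP[t t01 /= [e1 e2]]; apply/segmentP; exists t => //=.
  by rewrite -e1 -e2 -surjective_pairing.
case: (lerP x x') => xx.
  by rewrite (aux x x' z xx); split=> -[zy h]; split => //; [left | case: h => // h; lra].
have xx' := ltW xx; rewrite segment_sym (aux x' x z xx').
by split=> -[zy h]; split => //; [right | case: h => // h; lra].
Qed.

Lemma segment_closed (R : realType) (p q : R * R) : closed (segment p q).
Proof.
apply: compact_closed; first exact: norm_hausdorff.
case: (pselect (p = q)) => [->|/arc_segment[g [cg _ _ _ ->]]].
  suff -> : segment q q = [set q] by exact: compact_set1.
  apply/seteqP; split => z; last by move=> ->; apply/segmentP; exists 0; rewrite ?lexx ?ler01 // !subrr mulr0 !addr0 -surjective_pairing.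
  by move=> /segmentP[t _ ->]; rewrite !subrr mulr0 !addr0 -surjective_pairing.
by apply: continuous_compact; [exact: continuous_subspaceT | exact: segment_compact].
Qed.

Section Edges.
Variables (R : realType) (n m : nat) (a mem : nat -> nat -> bool).
Variables (f l : nat -> nat) (p : nat -> nat -> nat).
Hypothesis lay : layout n m a mem f l p.
Hypothesis a_sym : forall u v, (u < n)%N -> (v < n)%N -> a u v = a v u.
Hypothesis a_irr : forall u, (u < n)%N -> ~~ a u u.

Local Notation S := (Sr R n).
Local Notation X := (Xr R n).
Local Notation H := (Hr R n l).
Local Notation depth := (depth n f l).
Local Notation croot := (croot n mem f l).
Local Notation cov := (cov f l).
Local Notation anc := (anc f l).
Local Notation par := (par n f l).
Local Notation chord := (chord n a f l).
Local Notation fk := (fk n mem f l).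
Local Notation lk := (lk n mem f l).
Local Notation xa := (xa R n mem f l).
Local Notation xb := (xb R n mem f l).
Local Notation uk := (@uk R n mem f l).
Local Notation baser := (baser R n mem f l).
Local Notation capr := (capr R n mem f l).
Local Notation szr := (szr R n mem).
Local Notation wk := (wk R n mem).
Local Notation bord := (@bord R n mem f l).
Local Notation reg := (@reg R n mem f l).

Definition vpt v : R * R := (X (f v), H (depth v)).
(** A whole tree edge, or the first segment of a chord at one of its ends. It stays between two
    consecutive levels. *)
Definition fan v c : set (R * R) := segment (vpt v) (X c, H (depth v).+1).
Definition kap v c : R := (X c - X (f v)) / H 1.
Definition target v c w : Prop := (par v w /\ c = f w) \/ (chord v w /\ c = p v w).
Definition Tr u v : R := (topy n l p u v)%:R.

Lemma H1_gt0 : 0 < H 1.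
Proof. by have := Hr1_geS R n l; have := Sr_gt0 R n; lra. Qed.

Lemma target_cov v c w : (v < n)%N -> (w < n)%N -> target v c w -> cov v c /\ (f v < c)%N.
Proof.
move=> vn wn [[/(parP)[vw ne _] ->]|[/(chordP lay vn wn)[_ /topP[vc _] nf] ->]].
  split => //; have : f v <> f w by move/(f_inj lay vn wn).
  by move: vw; rewrite /LayoutDefs.anc /LayoutDefs.cov; lia.
by split => //; move: vc (nf _ vn); rewrite /LayoutDefs.cov; lia.
Qed.

Lemma kapP v c : (v < n)%N -> cov v c -> 0 <= kap v c <= 1 /\ X c = X (f v) + kap v c * H 1.
Proof.
move=> vn vc; have H0 := H1_gt0; split; last by rewrite /kap divfK ?gt_eqF //; ring.
have h1 := Hr1_ge R (cov_bound vn vc); have h2 := Xr_gt0 R n (f v).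
have h3 : X (f v) <= X c by apply: Xr_le; case/andP: vc.
by have := Sr_gt0 R n; rewrite /kap divr_ge0 ?ler_pdivrMr ?mul1r; lra.
Qed.

Lemma fan_line v c z : (v < n)%N -> cov v c ->
  fan v c z <-> H (depth v) <= z.2 <= H (depth v).+1 /\ z.1 = X (f v) + kap v c * (z.2 - H (depth v)).
Proof.
move=> vn vc; have H0 := H1_gt0; have [_ XE] := kapP vn vc.
rewrite /fan segmentP /= HrS XE; split.
  case=> t /andP[t0 t1] -> /=; split; last by ring.
  have h1 : 0 <= t * H 1 by apply: mulr_ge0; lra.
  have h2 : 0 <= (1 - t) * H 1 by apply: mulr_ge0; lra.
  by have h3 : t * H 1 + (1 - t) * H 1 = H 1 by [ring]; apply/andP; split; lra.
move=> [/andP[z1 z2] zE]; exists ((z.2 - H (depth v)) / H 1).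
  by rewrite divr_ge0 ?ler_pdivrMr ?mul1r; lra.
rewrite [LHS]surjective_pairing zE; congr (_, _); field; by rewrite gt_eqF.
Qed.

(** The third clause is where the height of a level pays off: a point [d] below the upper level is
    within [d] of column [c], so the fan meets caps and bases over the flat piece of that column. *)
Lemma fan_facts v c z : (v < n)%N -> cov v c -> fan v c z ->
  [/\ X (f v) <= z.1 <= X c, H (depth v) <= z.2 <= H (depth v).+1,
      X c - z.1 <= H (depth v).+1 - z.2,
      z.2 = H (depth v) -> z = vpt v & z.2 = H (depth v).+1 -> z.1 = X c].
Proof.
move=> vn vc /(fan_line _ vn vc)[/andP[z1 z2] zE]; have [/andP[k0 k1] XE] := kapP vn vc.
rewrite HrS in z2 *.
have h1 : 0 <= kap v c * (z.2 - H (depth v)) by apply: mulr_ge0; lra.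
have h2 : 0 <= kap v c * (H 1 - (z.2 - H (depth v))) by apply: mulr_ge0; lra.
have h3 : 0 <= (1 - kap v c) * (H 1 - (z.2 - H (depth v))) by apply: mulr_ge0; lra.
have e2 : kap v c * (H 1 - (z.2 - H (depth v))) = kap v c * H 1 - kap v c * (z.2 - H (depth v)) by ring.
have e3 : (1 - kap v c) * (H 1 - (z.2 - H (depth v))) = H 1 - (z.2 - H (depth v)) - kap v c * (H 1 - (z.2 - H (depth v))) by ring.
split; [by apply/andP; split; lra | by apply/andP; split; lra | lra | |].
  by move=> E; rewrite [z]surjective_pairing zE E subrr mulr0 addr0.
by move=> E; rewrite zE XE E; congr (_ + _); ring.
Qed.

Lemma target_inj v c w v' w' : (v < n)%N -> (w < n)%N -> (v' < n)%N -> (w' < n)%N ->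
  target v c w -> target v' c w' -> v = v' /\ w = w'.
Proof.
move=> vn wn v'n w'n [[P cE]|[C cE]] [[P' cE']|[C' cE']].
- have ww : w = w' by apply: (f_inj lay) => //; rewrite -cE.
  rewrite -ww in P' *; split => //.
  case/parP: P => [a1 a2 a3]; case/parP: P' => [b1 b2 b3].
  by apply: (anc_anti lay) => //; [apply: b3 | apply: a3].
- by have [_ _ /(_ _ wn)] := chordP lay v'n w'n C'; rewrite -cE' cE.
- by have [_ _ /(_ _ w'n)] := chordP lay vn wn C; rewrite -cE cE'.
- by apply: (chord_inj lay) => //; rewrite -cE.
Qed.

(** Fans of different depths can share only the starting point of the deeper one. At equal depth,
    different vertices have disjoint columns, and two fans of one vertex are different lines through
    it. *)
Lemma fan_fan v c w v' c' w' z : (v < n)%N -> (w < n)%N -> (v' < n)%N -> (w' < n)%N ->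
  target v c w -> target v' c' w' -> c <> c' -> fan v c z -> fan v' c' z ->
  exists2 x, (x < n)%N & z = vpt x.
Proof.
have H0 := H1_gt0; have S0 := Sr_gt0 R n.
wlog le : v c w v' c' w' / (depth v <= depth v')%N => [W|].
  move=> vn wn v'n w'n t t' cc F F'; case/orP: (leq_total (depth v) (depth v')) => le.
    exact: (W v c w v' c' w').
  by apply: (W v' c' w' v c w) => // /esym.
move=> vn wn v'n w'n t t' cc F F'.
have [vc lc] := target_cov vn wn t; have [vc' lc'] := target_cov v'n w'n t'.
have [/andP[x1 x2] /andP[y1 y2] _ bot top] := fan_facts vn vc F.
have [/andP[x1' x2'] /andP[y1' y2'] _ bot' top'] := fan_facts v'n vc' F'.
move: le; rewrite leq_eqVlt => /orP[/eqP dE|lt]; last first.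
  by exists v' => //; apply: bot'; have := Hr_le R n l lt; lra.
case: (eqVneq v v') => [vE|/eqP ne].
  exists v => //; apply: bot.
  have [_ z1] := (fan_line z vn vc).1 F; have [_ z1'] := (fan_line z v'n vc').1 F'.
  rewrite -vE in z1'.
  have : (kap v c - kap v c') * (z.2 - H (depth v)) = 0 by rewrite mulrBl; lra.
  move=> /eqP; rewrite mulf_eq0 !subr_eq0 => /orP[/eqP E|/eqP //].
  exfalso; apply: cc; apply: (@Xr_inj R n).
  by have [_ ->] := kapP vn vc; have [_ ->] := kapP v'n vc'; rewrite -vE E.
have n1 : ~~ anc v v' by apply/negP => h; have := depth_anc lay vn v'n h ne; rewrite dE ltnn.
have n2 : ~~ anc v' v by apply/negP => h; have := depth_anc lay v'n vn h (nesym ne); rewrite dE ltnn.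
move: vc vc'; rewrite /LayoutDefs.cov => /andP[_ cl] /andP[_ cl'].
case: (interval_disjoint lay vn v'n n1 n2) => h.
  by have h' := Xr_lt R n (leq_ltn_trans cl h); exfalso; lra.
by have h' := Xr_lt R n (leq_ltn_trans cl' h); exfalso; lra.
Qed.

Lemma fan_vertex v c x : (v < n)%N -> (x < n)%N -> cov v c -> fan v c (vpt x) -> x = v \/ c = f x.
Proof.
move=> vn xn vc F; have H0 := H1_gt0.
have [_ /andP[/= y1 y2] _ bot top] := fan_facts vn vc F.
case: (ltngtP (depth x) (depth v).+1) => h.
- have E : depth x = depth v.
    apply/eqP; rewrite eqn_leq; apply/andP; split; first by rewrite -ltnS.
    by rewrite leqNgt; apply/negP => /(Hr_lt R n l); lra.
  left; apply: (f_inj lay) => //; apply: (@Xr_inj R n).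
  by have := bot; rewrite /= E => /(_ erefl) [].
- by have h' := Hr_lt R n l h; exfalso; lra.
- by right; apply: (@Xr_inj R n); rewrite -top //= h.
Qed.

(** A fan that reaches the column of the chord starts at a vertex covering it, by [top] an ancestor
    of [v]. It therefore ends no higher than the stalk begins, and can touch it only with its upper
    end. *)
Lemma stalk_fan v w v' c' w' z : (v < n)%N -> (w < n)%N -> (v' < n)%N -> (w' < n)%N ->
  chord v w -> target v' c' w' -> fan v' c' z -> z.1 = X (p v w) -> H (depth v).+1 <= z.2 ->
  c' = p v w.
Proof.
move=> vn wn v'n w'n ch t' F z1 z2.
have [vc' lc'] := target_cov v'n w'n t'.
have [/andP[x1 x2] /andP[y1 y2] _ bot top] := fan_facts v'n vc' F.
have [_ /topP[vc tp] _] := chordP lay vn wn ch.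
have cv : cov v' (p v w).
  rewrite z1 in x1 x2; have h1 := Xr_leP x1; have h2 := Xr_leP x2.
  by move: vc'; rewrite /LayoutDefs.cov h1 => /andP[_ h3]; rewrite (leq_trans h2 h3).
have dd : (depth v' <= depth v)%N.
  have av := tp _ v'n cv; case: (eqVneq v' v) => [->//|/eqP ne].
  exact/ltnW/(depth_anc lay).
have := @Hr_le R n l (depth v').+1 (depth v).+1 dd => hh.
by apply: (@Xr_inj R n); rewrite -z1 top //; lra.
Qed.

Lemma TrE u v : Tr u v = H (n + 3) + ((p u v - p v u) + (p v u - p u v))%:R.
Proof. by rewrite /Tr /topy natrD. Qed.

Lemma Tr_ge u v : H (n + 3) <= Tr u v.
Proof. by rewrite TrE lerDl ler0n. Qed.

Lemma TrC u v : Tr v u = Tr u v.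
Proof. by rewrite /Tr /topy [X in (_ + X)%:R]addnC. Qed.

Lemma depth_Tr v u w : (v < n)%N -> H (depth v).+1 + 2 * H 1 <= Tr u w.
Proof.
move=> vn; have := depth_le n f l v => le; apply: le_trans (Tr_ge u w).
have : H (depth v).+3 <= H (n + 3) by apply: Hr_le; rewrite addn3 !ltnS.
by rewrite (HrS R n l (depth v).+2) (HrS R n l (depth v).+1); lra.
Qed.

Definition tops u v : set (R * R) := [set z |
  [\/ z.1 = X (p u v) /\ H (depth u).+1 <= z.2 <= Tr u v,
      z.1 = X (p v u) /\ H (depth v).+1 <= z.2 <= Tr u v
    | z.2 = Tr u v /\ (X (p u v) <= z.1 <= X (p v u) \/ X (p v u) <= z.1 <= X (p u v))]].

Lemma chord_ends u v : (u < n)%N -> (v < n)%N -> chord u v -> u <> v /\ p u v <> p v u.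
Proof.
move=> un vn ch; have uv : u <> v.
  by move=> E; have [au _ _] := chordP lay un vn ch; move: (a_irr un); rewrite {2}E au.
split => // pE; have ch' : chord v u by rewrite (chordC f l a_sym).
by case: (chord_inj lay un vn vn un ch ch' pE).
Qed.

Lemma noncross_nat u v u' v' : (u < n)%N -> (v < n)%N -> (u' < n)%N -> (v' < n)%N ->
  chord u v -> chord u' v' ->
  (p u v < p u' v' < p v u \/ p v u < p u' v' < p u v)%N ->
  (p u v <= p v' u' <= p v u \/ p v u <= p v' u' <= p u v)%N.
Proof.
move=> un vn u'n v'n ch ch' hyp.
have chC : chord v u by rewrite (chordC f l a_sym).
have chC' : chord v' u' by rewrite (chordC f l a_sym).
have N1 := chord_noncross lay un vn u'n v'n ch ch'.
have N2 := chord_noncross lay vn un u'n v'n chC ch'.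
have N3 := chord_noncross lay v'n u'n un vn chC' ch.
have N4 := chord_noncross lay v'n u'n vn un chC' chC.
case: hyp => /andP[h1 h2]; [left | right]; apply/andP; split; rewrite leqNgt; apply/negP => h.
- by apply: N3.
- by apply: N1.
- by apply: N4.
- by apply: N2.
Qed.

End Edges.

End Fans.

(** * Crossings of half-edges with cluster boundaries *)

Module FanCrossings.
Import MuRecursive LayoutDefs LayoutCode MeshWalks Curves UnderGraphs LayoutArith ClusterPolygons Regions Fans.
From mathcomp Require Import all_boot all_order all_algebra.
From mathcomp Require Import all_classical all_reals all_analysis.
From mathcomp Require Import zify ring lra.

Set Implicit Arguments.
Unset Strict Implicit.
Unset Printing Implicit Defensive.
Import Order.TTheory GRing.Theory Num.Theory.
Import numFieldNormedType.Exports.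
Local Open Scope classical_set_scope.
Local Open Scope ring_scope.

Section Crossings.
Variables (R : realType) (n m : nat) (a mem : nat -> nat -> bool).
Variables (f l : nat -> nat) (p : nat -> nat -> nat).
Hypothesis lay : layout n m a mem f l p.
Hypothesis a_sym : forall u v, (u < n)%N -> (v < n)%N -> a u v = a v u.
Hypothesis a_irr : forall u, (u < n)%N -> ~~ a u u.

Local Notation S := (Sr R n).
Local Notation X := (Xr R n).
Local Notation H := (Hr R n l).
Local Notation depth := (depth n f l).
Local Notation croot := (croot n mem f l).
Local Notation cov := (cov f l).
Local Notation anc := (anc f l).
Local Notation par := (par n f l).
Local Notation chord := (chord n a f l).
Local Notation fk := (fk n mem f l).
Local Notation lk := (lk n mem f l).
Local Notation xa := (xa R n mem f l).
Local Notation xb := (xb R n mem f l).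
Local Notation uk := (@uk R n mem f l).
Local Notation baser := (baser R n mem f l).
Local Notation capr := (capr R n mem f l).
Local Notation szr := (szr R n mem).
Local Notation wk := (wk R n mem).
Local Notation bord := (@bord R n mem f l).
Local Notation reg := (@reg R n mem f l).

Local Notation vpt := (vpt R n f l).
Local Notation fan := (@fan R n f l).
Local Notation kap := (kap R n f l).
Local Notation target := (target n a f l p).
Local Notation Tr := (Tr R n l p).
Local Notation tops := (@tops R n f l p).

Lemma fan_eq v c z z' : (v < n)%N -> cov v c -> fan v c z -> fan v c z' -> z.2 = z'.2 -> z = z'.
Proof.
move=> vn vc /(fan_line _ vn vc)[_ e] /(fan_line _ vn vc)[_ e'] E.
by rewrite [z]surjective_pairing [z']surjective_pairing e e' E.
Qed.

Lemma fan_at v c y : (v < n)%N -> cov v c -> H (depth v) <= y <= H (depth v).+1 ->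
  exists2 z, fan v c z & z.2 = y.
Proof.
by move=> vn vc h; exists (X (f v) + kap v c * (y - H (depth v)), y) => //; apply/(fan_line _ vn vc).
Qed.

Lemma root_depth_le k v : (k < m)%N -> (v < n)%N -> anc (croot k) v -> H (depth (croot k)) <= H (depth v).
Proof.
move=> km vn rv; have [rn _ _ _] := crootP lay km; apply: Hr_le.
by case: (eqVneq (croot k) v) => [->//|/eqP ne]; apply/ltnW/(depth_anc lay).
Qed.

(** No member over column [c] is deeper than [v]: for a tree edge because the nonmember [w] is
    there, for a chord because [v] is the top of its column. *)
Lemma cap_exit k v c w : (k < m)%N -> (v < n)%N -> (w < n)%N -> target v c w -> mem v k ->
  par v w && mem w k = false -> capr k c = H (depth v).+1 - (2 * S - szr k).
Proof.
move=> km vn wn t vk tin; have [rn rk rall rbet] := crootP lay km.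
have [vc lc] := target_cov lay vn wn t; have rv := rall _ vn vk.
apply/eqP; rewrite eq_le; apply/andP; split; last exact: (capr_ge R lay km vn vk vc).
case: t => [[P cE]|[C cE]].
  rewrite P /= in tin; rewrite -(depth_par lay vn wn P).
  have [vw _ _] := parP P.
  apply: (capr_le R lay km wn (negbT tin) (anc_trans lay rn vn rv vw)).
  by rewrite cE; apply: (anc_refl lay).
rewrite /ClusterPolygons.capr lerD2r; apply: Hr_le; rewrite cE.
by have [_ tp _] := chordP lay vn wn C; apply: (cap_top lay km vn rv tp).
Qed.

(** [par v w && mem w k] tells whether the upper end of the fan is in the region, as the upper part
    of a chord is outside all regions. If the two ends are on different sides there is one crossing,
    on a flat piece of the roof or on the base, strictly between the levels. *)
Lemma fan_border v c w k : (v < n)%N -> (w < n)%N -> (k < m)%N -> target v c w ->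
  (mem v k = par v w && mem w k -> forall z, fan v c z -> ~ bord k z) /\
  (mem v k <> par v w && mem w k -> exists z0, [/\ fan v c z0, bord k z0,
     (forall z, fan v c z -> bord k z -> z = z0), locally_horizontal (bord k) z0
     & H (depth v) < z0.2 < H (depth v).+1]).
Proof.
move=> vn wn km t; have [rn rk rall rbet] := crootP lay km.
have S0 := Sr_gt0 R n; have HS := Hr1_geS R n l.
have /andP[w1 w2] := wk_itv R lay km; have /andP[s1 s2] := szr_itv R lay km.
have [vc lc] := target_cov lay vn wn t.
have HE := HrS R n l (depth v).
(* If [v] is not below the root of the cluster, the fan can only enter through the base, and does so
   exactly when it is a tree edge to the root. *)
case: (boolP (anc (croot k) v)) => rv; last first.
  have nvk : mem v k = false by apply/negP => /(rall _ vn); rewrite (negbTE rv).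
  rewrite nvk; case tin : (par v w && mem w k); split => // _.
    case/andP: tin => P wk'; have wr := tree_enter lay km vn wn P wk' (negbT nvk).
    have cE : c = fk k.
      case: t => [[_ ->]|[/andP[_ /norP[/negP//]]]]; by rewrite wr.
    have dE : H (depth v).+1 = H (depth (croot k)) by rewrite -(depth_par lay vn wn P) wr.
    have yb : H (depth v) <= baser k <= H (depth v).+1.
      by rewrite dE /ClusterPolygons.baser; rewrite dE in HE; apply/andP; split; lra.
    have [z0 F0 z0y] := fan_at vn vc yb.
    have [/andP[x1 x2] _ sl _ _] := fan_facts vn vc F0.
    have fl : (fk k <= fk k <= lk k)%N by rewrite leqnn (fk_le lay km).
    have near0 : `|z0.1 - X (fk k)| < 2 * S.
      rewrite -cE ler0_norm; last by lra.
      by move: sl; rewrite z0y dE /ClusterPolygons.baser; lra.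
    have [B0 L0] := bord_flat lay km fl near0 (or_intror z0y); rewrite -surjective_pairing in B0 L0.
    exists z0; split => //; last by rewrite z0y dE /ClusterPolygons.baser; rewrite dE in HE; apply/andP; split; lra.
    move=> z F [zx zB]; apply: (fan_eq vn vc F F0); rewrite z0y; case: zB => // zu.
    have [/andP[x1' x2'] /andP[y1' y2'] sl' _ _] := fan_facts vn vc F.
    have ug : baser k <= uk k z.1.
      apply: (height_ge (uk_a R lay km) (uk_b R lay km) _ zx).
      by move=> x; apply: (uk_gt lay km).
    exfalso; case: (lerP (X c - z.1) (2 * S)) => hz.
      have nz : `|z.1 - X (fk k)| <= 2 * S by rewrite -cE ler0_norm; lra.
      have := uk_near lay km fl nz; have := capr_base R lay km fl.
      by move: y2'; rewrite dE /ClusterPolygons.baser; lra.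
    by move: ug sl'; rewrite dE /ClusterPolygons.baser; lra.
  have cN : ~~ cov (croot k) c.
    apply/negP => rc; move/negP: rv; apply.
    case: t => [[P cE]|[C cE]].
      have [vw _ mx] := parP P; apply: mx => //; first by rewrite /LayoutDefs.anc -cE.
      by move=> E; move: tin; rewrite P -E rk.
    by have [_ /topP[_ tp] _] := chordP lay vn wn C; apply: tp; rewrite -?cE.
  move=> z F [/andP[za zb] zB].
  have [/andP[x1 x2] /andP[y1 y2] sl _ _] := fan_facts vn vc F.
  have ug : baser k <= uk k z.1.
    apply: (height_ge (uk_a R lay km) (uk_b R lay km) _ _); last by apply/andP.
    by move=> x; apply: (uk_gt lay km).
  have zb' : baser k <= z.2 by case: zB => ->.
  rewrite /ClusterPolygons.xa in za; rewrite /ClusterPolygons.xb in zb.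
  case: (boolP (anc v (croot k))) => vr.
    have ne : v <> croot k by move=> E; move: rv; rewrite E (anc_refl lay).
    have dd := Hr_le R n l (depth_anc lay vn rn vr ne).
    move: cN; rewrite /LayoutDefs.cov negb_and -!ltnNge => /orP[] h.
      by have := Xr_lt R n h; rewrite -/(fk k); lra.
    have h' := Xr_lt R n h; rewrite -/(lk k) in h'.
    by move: zb'; rewrite /ClusterPolygons.baser; lra.
  have cl : (c <= l v)%N by case/andP: vc.
  case: (interval_disjoint lay vn rn vr rv) => h.
    by have := Xr_lt R n (leq_ltn_trans cl h); rewrite -/(fk k); lra.
  by have := Xr_lt R n h; rewrite -/(lk k); lra.
have rd := root_depth_le km vn rv.
have fv : (fk k <= f v)%N by move: rv; rewrite /LayoutDefs.anc /LayoutDefs.cov => /andP[].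
have cl : (c <= lk k)%N by apply: leq_trans (anc_l lay rn vn rv); case/andP: vc.
have ck : (fk k <= c <= lk k)%N by rewrite cl (leq_trans fv (ltnW lc)).
have covi i : (f v <= i <= c)%N -> cov v i.
  by case/andP=> h1 h2; rewrite /LayoutDefs.cov h1 (leq_trans h2) //; case/andP: vc.
have Xfv := Xr_le R n fv; have Xcl := Xr_le R n cl.
have rng z : fan v c z -> xa k <= z.1 <= xb k /\ baser k < z.2.
  move=> F; have [/andP[x1 x2] /andP[y1 y2] _ _ _] := fan_facts vn vc F.
  by rewrite /ClusterPolygons.xa /ClusterPolygons.xb /ClusterPolygons.baser; split; [apply/andP; split|]; lra.
(* A nonmember below the root: over its columns the whole roof is under the level of [v]. *)
case vk : (mem v k); last first.
  have tin : par v w && mem w k = false.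
    apply/negP => /andP[P wk']; have wr := tree_enter lay km vn wn P wk' (negbT vk).
    have [vw ne _] := parP P; apply: ne; apply: (anc_anti lay) => //; by rewrite wr.
  rewrite tin; split => // _ z F [zx zB].
  have [_ zb] := rng _ F; have [/andP[x1 x2] /andP[y1 y2] _ _ _] := fan_facts vn vc F.
  have cp i : (f v <= i <= c)%N -> capr k i <= H (depth v) - (2 * S - szr k).
    by move=> /covi; apply: (capr_le R lay km vn (negbT vk) rv).
  have : uk k z.1 <= H (depth v) - (2 * S - szr k).
    apply: (uk_le_range lay km fv cl (ltnW lc) cp) => //; last by apply/andP; split; lra.
    have := cp (f v); rewrite leqnn (ltnW lc) => /(_ isT).
    have fvk : (fk k <= f v <= lk k)%N by rewrite fv (leq_trans (ltnW lc) cl).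
    by have := capr_base R lay km fvk; lra.
  by case: zB => zE; lra.
(* Now [v] is a member: the roof over the fan is less than [2 * S] below the upper level. If [w] is
   a member too, the roof is a level higher near column [c] and the fan passes beneath it. *)
have ulo z : fan v c z -> H (depth v).+1 - (2 * S - szr k) <= uk k z.1.
  move=> F; have [x12 _ _ _ _] := fan_facts vn vc F.
  apply: (uk_ge_range lay km fv cl _ x12) => i /covi; exact: (capr_ge R lay km vn vk).
case tin : (par v w && mem w k); split => // _.
  case/andP: tin => P wk' z F [zx zB]; have [_ zb] := rng _ F; have lo := ulo _ F.
  have [/andP[x1 x2] /andP[y1 y2] sl _ _] := fan_facts vn vc F.
  have cE : c = f w by case: t => [[_ ->]//|[/andP[_ /norP[/negP//]]]].
  have wc : cov w c by rewrite cE; apply: (anc_refl lay).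
  have hc := capr_ge R lay km wn wk' wc; rewrite (depth_par lay vn wn P) (HrS R n l (depth v).+1) in hc.
  case: zB => zE; last by lra.
  case: (lerP (X c - z.1) (2 * S)) => hz; last by lra.
  have nz : `|z.1 - X c| <= 2 * S by rewrite ler0_norm; lra.
  by have := uk_near lay km ck nz; lra.
have capE := cap_exit km vn wn t vk tin.
have yb : H (depth v) <= capr k c <= H (depth v).+1 by rewrite capE; apply/andP; split; lra.
have [z0 F0 z0y] := fan_at vn vc yb.
have [/andP[x1 x2] _ sl _ _] := fan_facts vn vc F0.
have near0 : `|z0.1 - X c| < 2 * S.
  rewrite ler0_norm; last by lra.
  by move: sl; rewrite z0y capE; lra.
have [B0 L0] := bord_flat lay km ck near0 (or_introl z0y); rewrite -surjective_pairing in B0 L0.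
exists z0; split => //; last by rewrite z0y capE; apply/andP; split; lra.
move=> z F [zx zB]; have [_ zb] := rng _ F; have lo := ulo _ F.
have [/andP[x1' x2'] /andP[y1' y2'] sl' _ _] := fan_facts vn vc F.
apply: (fan_eq vn vc F F0); rewrite z0y; case: zB => zE; last by lra.
case: (lerP (X c - z.1) (2 * S)) => hz; last by lra.
have nz : `|z.1 - X c| <= 2 * S by rewrite ler0_norm; lra.
by rewrite zE; apply: (uk_near lay km ck nz).
Qed.

(** By [top], the roof over the column of a chord stays below the level at which the vertical part
    begins. *)
Lemma stalk_reg u v k z : (u < n)%N -> (v < n)%N -> (k < m)%N -> chord u v ->
  z.1 = X (p u v) -> H (depth u).+1 <= z.2 -> ~ reg k z.
Proof.
move=> un vn km ch z1 z2 [/andP[za zb] /andP[_ zu]].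
have S0 := Sr_gt0 R n; have [rn rk rall rbet] := crootP lay km.
have /andP[w1 w2] := wk_itv R lay km; have /andP[s1 s2] := szr_itv R lay km.
have [_ tp _] := chordP lay un vn ch; have [uc tp'] := topP tp.
rewrite z1 /ClusterPolygons.xa in za; rewrite z1 /ClusterPolygons.xb in zb.
have ck : (fk k <= p u v <= lk k)%N.
  by apply/andP; split; rewrite leqNgt; apply/negP => /(Xr_lt R n); lra.
have ru := tp' _ rn ck.
have nz : `|z.1 - X (p u v)| <= 2 * S by rewrite z1 subrr normr0; lra.
have : capr k (p u v) <= H (depth u).+1 - (2 * S - szr k).
  by rewrite /ClusterPolygons.capr lerD2r; apply: Hr_le; apply: (cap_top lay km un ru tp).
by rewrite (uk_near lay km ck nz) in zu; lra.
Qed.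

Lemma tops_reg u v k z : (u < n)%N -> (v < n)%N -> (k < m)%N -> chord u v -> tops u v z -> ~ reg k z.
Proof.
move=> un vn km ch [[z1 /andP[z2 _]]|[z1 /andP[z2 _]]|[z2 _]].
- exact: (stalk_reg un vn km ch z1 z2).
- have ch' : chord v u by rewrite (chordC f l a_sym).
  exact: (stalk_reg vn un km ch' z1 z2).
move=> [zx /andP[_ zu]]; have S0 := Sr_gt0 R n; have H0 := H1_gt0 R n l.
have /andP[w1 w2] := wk_itv R lay km; have /andP[s1 s2] := szr_itv R lay km.
have cp i : (fk k <= i <= lk k)%N -> capr k i <= H n.+1.
  move=> _; have := Hr_le R n l (cap_bound lay km i); rewrite /ClusterPolygons.capr; lra.
have fl := fk_le lay km.
have : uk k z.1 <= H n.+1.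
  apply: (uk_le_range lay km (leqnn _) (leqnn _) fl cp) => //.
    have ff : (fk k <= fk k <= lk k)%N by rewrite leqnn fl.
    by have := cp _ ff; have := capr_base R lay km ff; lra.
  by move: zx; rewrite /ClusterPolygons.xa /ClusterPolygons.xb => /andP[? ?]; apply/andP; split; lra.
have := Tr_ge R n l p u v; rewrite addn3 (HrS R n l n.+2) (HrS R n l n.+1); lra.
Qed.

Lemma vertex_reg k v : (k < m)%N -> (v < n)%N -> (reg k (vpt v) <-> mem v k) /\ ~ bord k (vpt v).
Proof.
move=> km vn; have S0 := Sr_gt0 R n; have HS := Hr1_geS R n l; have [rn rk rall rbet] := crootP lay km.
have /andP[w1 w2] := wk_itv R lay km; have /andP[s1 s2] := szr_itv R lay km.
have vv : cov v (f v) by apply: (anc_refl lay).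
have HE := HrS R n l (depth v).
have nz : `|(vpt v).1 - X (f v)| <= 2 * S by rewrite subrr normr0; lra.
case vk : (mem v k).
  have rv := rall _ vn vk; have rd := root_depth_le km vn rv.
  have uE := uk_near lay km rv nz.
  have hc := capr_ge R lay km vn vk vv.
  have /andP[Xf Xl] : X (fk k) <= X (f v) <= X (lk k).
    by case/andP: (rv) => h1 h2; rewrite !Xr_le.
  suff [] : reg k (vpt v) /\ ~ bord k (vpt v) by split.
  apply: (reg_inside (m := m)) => //.
    by rewrite /= /ClusterPolygons.xa /ClusterPolygons.xb; apply/andP; split; lra.
  by rewrite uE /= /ClusterPolygons.baser; apply/andP; split; lra.
suff nr : ~ reg k (vpt v) by split; [split | move=> /(bord_reg lay km)].
move=> [/andP[/= za zb] /andP[_ zu]].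
rewrite /ClusterPolygons.xa in za; rewrite /ClusterPolygons.xb in zb.
have rv : anc (croot k) v.
  by rewrite /LayoutDefs.anc /LayoutDefs.cov; apply/andP; split; rewrite leqNgt; apply/negP => /(Xr_lt R n);
    rewrite -/(fk k) -/(lk k); lra.
have := capr_le R lay km vn (negbT vk) rv vv; rewrite (uk_near lay km rv nz) /= in zu; lra.
Qed.

End Crossings.

End FanCrossings.

(** * Edges as polylines and their intersections *)

Module EdgePolylines.
Import MuRecursive LayoutDefs LayoutCode MeshWalks Curves UnderGraphs LayoutArith ClusterPolygons Regions Fans FanCrossings.
From mathcomp Require Import all_boot all_order all_algebra.
From mathcomp Require Import all_classical all_reals all_analysis.
From mathcomp Require Import zify ring lra.

Set Implicit Arguments.
Unset Strict Implicit.
Unset Printing Implicit Defensive.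
Import Order.TTheory GRing.Theory Num.Theory.
Import numFieldNormedType.Exports.
Local Open Scope classical_set_scope.
Local Open Scope ring_scope.

Section EdgeCurves.
Variables (R : realType) (n m : nat) (a mem : nat -> nat -> bool).
Variables (f l : nat -> nat) (p : nat -> nat -> nat).
Hypothesis lay : layout n m a mem f l p.
Hypothesis a_sym : forall u v, (u < n)%N -> (v < n)%N -> a u v = a v u.
Hypothesis a_irr : forall u, (u < n)%N -> ~~ a u u.

Local Notation S := (Sr R n).
Local Notation X := (Xr R n).
Local Notation H := (Hr R n l).
Local Notation depth := (depth n f l).
Local Notation croot := (croot n mem f l).
Local Notation cov := (cov f l).
Local Notation anc := (anc f l).
Local Notation par := (par n f l).
Local Notation chord := (chord n a f l).
Local Notation fk := (fk n mem f l).
Local Notation lk := (lk n mem f l).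
Local Notation xa := (xa R n mem f l).
Local Notation xb := (xb R n mem f l).
Local Notation uk := (@uk R n mem f l).
Local Notation baser := (baser R n mem f l).
Local Notation capr := (capr R n mem f l).
Local Notation szr := (szr R n mem).
Local Notation wk := (wk R n mem).
Local Notation bord := (@bord R n mem f l).
Local Notation reg := (@reg R n mem f l).

Local Notation vpt := (vpt R n f l).
Local Notation fan := (@fan R n f l).
Local Notation kap := (kap R n f l).
Local Notation target := (target n a f l p).
Local Notation Tr := (Tr R n l p).
Local Notation tops := (@tops R n f l p).

Definition ebends u v : seq (R * R) := if chord u v then
  [:: (X (p u v), H (depth u).+1); (X (p u v), Tr u v); (X (p v u), Tr u v); (X (p v u), H (depth v).+1)]
  else [::].
Definition eset u v : set (R * R) := polyline (vpt u) (rcons (ebends u v) (vpt v)).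

Lemma near_avoid (O : set (R * R)) z0 : closed O -> ~ O z0 ->
  exists2 r : R, 0 < r & forall z, `|z - z0| < r -> ~ O z.
Proof.
move=> cO nO; have : nbhs z0 (~` O) by apply: open_nbhs_nbhs; split => //; exact: closed_openC.
move=> /nbhs_ballP[r /= r0 rO]; exists r => // z zr; apply: rO.
by rewrite -ball_normE /= distrC.
Qed.

Lemma stalk_segment u x y : (u < n)%N -> chord x y ->
  segment (X (p x y), H (depth u).+1) (X (p x y), Tr x y) =
  [set z | z.1 = X (p x y) /\ H (depth u).+1 <= z.2 <= Tr x y].
Proof.
move=> un ch; have H0 := H1_gt0 R n l; have := depth_Tr R f l p x y un => h.
by apply/seteqP; split => z /vertical_segment; apply; lra.
Qed.

Lemma tops_segments u v : (u < n)%N -> (v < n)%N -> chord u v ->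
  tops u v = segment (X (p u v), H (depth u).+1) (X (p u v), Tr u v) `|`
    (segment (X (p u v), Tr u v) (X (p v u), Tr u v) `|`
     segment (X (p v u), Tr u v) (X (p v u), H (depth v).+1)).
Proof.
move=> un vn ch; have ch' : chord v u by rewrite (chordC f l a_sym).
rewrite (stalk_segment un ch) [segment (X (p v u), Tr u v) (X (p v u), _)]segment_sym.
rewrite -(TrC R n l p u v) (stalk_segment vn ch') (TrC R n l p u v).
apply/seteqP; split => z.
  case=> [h|h|[h1 h2]]; [by left | by right; right | right; left].
  by apply/horizontal_segment.
case=> [h|[/horizontal_segment[h1 h2]|h]]; [exact: Or31 | exact: Or33 | exact: Or32].
Qed.

Lemma eset_chord u v : (u < n)%N -> (v < n)%N -> chord u v ->
  eset u v = fan u (p u v) `|` (tops u v `|` fan v (p v u)).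
Proof.
move=> un vn ch; rewrite /eset /ebends ch /= setU0 (tops_segments un vn ch).
by rewrite /Fans.fan [segment (vpt v) _]segment_sym -!setUA.
Qed.

Lemma eset_par u v : (u < n)%N -> (v < n)%N -> par u v ->
  eset u v = fan u (f v) /\ eset v u = fan u (f v).
Proof.
move=> un vn P; have nch : chord u v = false by rewrite /LayoutDefs.chord P andbF.
have nch' : chord v u = false by rewrite /LayoutDefs.chord P orbT andbF.
rewrite /eset /ebends nch nch' /= !setU0 /Fans.fan -(depth_par lay un vn P).
by rewrite segment_sym.
Qed.

(** [x] is an end of the edge and [c] the column of its fan towards the other end [w]. A chord has
    two halves, a tree edge only the one at its parent end. *)
Definition half u v x c w : Prop := target x c w /\ ((x = u /\ w = v) \/ (x = v /\ w = u)).

Lemma eset_half u v z : (u < n)%N -> (v < n)%N -> a u v -> eset u v z ->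
  (exists x c w, half u v x c w /\ fan x c z) \/ (chord u v /\ tops u v z).
Proof.
move=> un vn auv; case: (edge_cases f l un vn auv) => [P|P|C].
- rewrite (eset_par un vn P).1 => F; left; exists u, (f v), v; split => //; split; [by left | by left].
- rewrite (eset_par vn un P).2 => F; left; exists v, (f u), u; split => //; split; [by left | by right].
- have C' : chord v u by rewrite (chordC f l a_sym).
  rewrite eset_chord // => -[F|[T|F]]; [left|by right|left].
    by exists u, (p u v), v; split => //; split; [right | left].
  by exists v, (p v u), u; split => //; split; [right | right].
Qed.

Lemma half_fan_eset u v x c w : (u < n)%N -> (v < n)%N -> half u v x c w -> fan x c `<=` eset u v.
Proof.
move=> un vn [t uv]; case: t => [[P ->]|[C ->]].
  by case: uv P => -[-> ->] P; [rewrite (eset_par un vn P).1 | rewrite (eset_par vn un P).2].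
case: uv C => -[-> ->] C z F; first by rewrite eset_chord //; left.
by rewrite eset_chord ?(chordC f l a_sym un vn) //; right; right.
Qed.

Lemma half_ord u v x c w : (u < n)%N -> (v < n)%N -> half u v x c w -> (x < n)%N /\ (w < n)%N.
Proof. by move=> un vn [_ [[-> ->]|[-> ->]]]. Qed.

Lemma fan_tops u v x c w z : (u < n)%N -> (v < n)%N -> (x < n)%N -> (w < n)%N ->
  target x c w -> chord u v -> fan x c z -> tops u v z ->
  (c = p u v /\ H (depth u).+1 <= z.2) \/ (c = p v u /\ H (depth v).+1 <= z.2).
Proof.
move=> un vn xn wn t ch F; have ch' : chord v u by rewrite (chordC f l a_sym).
have H0 := H1_gt0 R n l.
case=> [[z1 /andP[z2 _]]|[z1 /andP[z2 _]]|[z2 _]].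
- by left; split => //; apply: (stalk_fan lay un vn xn wn ch t F z1 z2).
- by right; split => //; apply: (stalk_fan lay vn un xn wn ch' t F z1 z2).
exfalso; have [xc _] := target_cov lay xn wn t.
have [_ /andP[y1 y2] _ _ _] := fan_facts xn xc F.
by have := depth_Tr R f l p u v xn; lra.
Qed.

Lemma eset_vertex u v y : (u < n)%N -> (v < n)%N -> (y < n)%N -> a u v -> eset u v (vpt y) -> y = u \/ y = v.
Proof.
move=> un vn yn auv /(eset_half un vn auv)[[x [c [w [h F]]]]|[ch]].
  have [xn wn] := half_ord un vn h; case: h => t uv.
  have [xc _] := target_cov lay xn wn t.
  case: (fan_vertex lay xn yn xc F) => [->|cE]; first by case: uv => -[-> _]; [left|right].
  case: t => [[_ cE']|[C cE']]; last by have [_ _ /(_ _ yn)] := chordP lay xn wn C; rewrite -cE' cE.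
  have -> : y = w by apply: (f_inj lay) => //; rewrite -cE.
  by case: uv => -[_ ->]; [right|left].
have ch' : chord v u by rewrite (chordC f l a_sym).
have H0 := H1_gt0 R n l.
case=> [[/= /(@Xr_inj R n) E _]|[/= /(@Xr_inj R n) E _]|[/= E _]].
- by have [_ _ /(_ _ yn)] := chordP lay un vn ch; rewrite E.
- by have [_ _ /(_ _ yn)] := chordP lay vn un ch'; rewrite E.
- have h := depth_Tr R f l p u v yn; have h2 := HrS R n l (depth y).
  have E' : Hr R n l (depth y) = Tr u v := E.
  by exfalso; rewrite -E' h2 in h; lra.
Qed.

Lemma tops_disjoint u v u' v' z : (u < n)%N -> (v < n)%N -> (u' < n)%N -> (v' < n)%N ->
  chord u v -> chord u' v' -> tops u v z -> tops u' v' z ->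
  (u = u' /\ v = v') \/ (u = v' /\ v = u').
Proof.
(* A stalk below the horizontal part of another chord belongs, by noncrossing, to a chord nested in
   it and strictly shorter; so it ends below that horizontal part. *)
have bridge x y x' y' : (x < n)%N -> (y < n)%N -> (x' < n)%N -> (y' < n)%N -> chord x y -> chord x' y' ->
    z.1 = X (p x' y') -> z.2 <= Tr x' y' -> z.2 = Tr x y ->
    X (p x y) <= z.1 <= X (p y x) \/ X (p y x) <= z.1 <= X (p x y) ->
    (x = x' /\ y = y') \/ (x = y' /\ y = x').
  move=> xn yn x'n y'n ch ch' z1 z2 zT zb.
  have chC : chord y x by rewrite (chordC f l a_sym).
  case: (eqVneq (p x y) (p x' y')) => [E|n1]; first by left; apply: (chord_inj lay).
  case: (eqVneq (p y x) (p x' y')) => [E|n2].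
    by right; have [-> ->] := chord_inj lay yn xn x'n y'n chC ch' E.
  have bt : (p x y < p x' y' < p y x \/ p y x < p x' y' < p x y)%N.
    rewrite z1 in zb; case: zb => /andP[/(@Xr_leP R n) h1 /(@Xr_leP R n) h2]; [left|right];
      by rewrite !ltn_neqAle h1 h2 ?n1 ?n2 ?[_ == p x y]eq_sym ?[_ == p y x]eq_sym ?n1 ?n2.
  have bt' := noncross_nat lay a_sym xn yn x'n y'n ch ch' bt.
  have [_ ne'] := chord_ends lay a_sym a_irr x'n y'n ch'.
  exfalso; move: z2; rewrite zT !TrE lerD2l ler_nat leqNgt => /negP; apply.
  by move: bt bt' ne'; clear; lia.
move=> un vn u'n v'n ch ch'.
have chC : chord v u by rewrite (chordC f l a_sym).
have chC' : chord v' u' by rewrite (chordC f l a_sym).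
have sw (P Q : Prop) : P \/ Q -> Q \/ P by tauto.
case=> [[z1 /andP[y1 y2]]|[z1 /andP[y1 y2]]|[y b]] [[z1' /andP[y1' y2']]|[z1' /andP[y1' y2']]|[y' b']].
- by left; apply: (chord_inj lay) => //; apply: (@Xr_inj R n); rewrite -z1.
- by right; apply: (chord_inj lay) => //; apply: (@Xr_inj R n); rewrite -z1.
- have [[-> ->]|[-> ->]] := bridge u' v' u v u'n v'n un vn ch' ch z1 y2 y' b'; [by left | by right].
- have [-> ->] : v = u' /\ u = v' by apply: (chord_inj lay) => //; apply: (@Xr_inj R n); rewrite -z1.
  by right.
- have [-> ->] : v = v' /\ u = u' by apply: (chord_inj lay) => //; apply: (@Xr_inj R n); rewrite -z1.
  by left.
- rewrite -(TrC R n l p u v) in y2.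
  have [[-> ->]|[-> ->]] := bridge u' v' v u u'n v'n vn un ch' chC z1 y2 y' b'; [by right | by left].
- exact: (bridge u v u' v' un vn u'n v'n ch ch' z1' y2' y b).
- rewrite -(TrC R n l p u' v') in y2'.
  have [[-> ->]|[-> ->]] := bridge u v v' u' un vn v'n u'n ch chC' z1' y2' y b; [by right | by left].
(* Horizontal parts at the same height have the same length; if they overlap without sharing an end,
   the chords cross. *)
- have TE : Tr u v = Tr u' v' by rewrite -y.
  have dE : ((p u v - p v u) + (p v u - p u v) = (p u' v' - p v' u') + (p v' u' - p u' v'))%N.
    by apply/eqP; rewrite -(eqr_nat R); apply/eqP; move: TE; rewrite !TrE; lra.
  have ov : (minn (p u v) (p v u) <= maxn (p u' v') (p v' u') /\ minn (p u' v') (p v' u') <= maxn (p u v) (p v u))%N.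
    have [lo hi] : X (minn (p u v) (p v u)) <= z.1 /\ z.1 <= X (maxn (p u v) (p v u)).
      by case: b => /andP[h1 h2]; have /(@Xr_leP R n) h := le_trans h1 h2;
        [rewrite (minn_idPl h) (maxn_idPr h) | rewrite (minn_idPr h) (maxn_idPl h)].
    have [lo' hi'] : X (minn (p u' v') (p v' u')) <= z.1 /\ z.1 <= X (maxn (p u' v') (p v' u')).
      by case: b' => /andP[h1 h2]; have /(@Xr_leP R n) h := le_trans h1 h2;
        [rewrite (minn_idPl h) (maxn_idPr h) | rewrite (minn_idPr h) (maxn_idPl h)].
    by split; apply: (@Xr_leP R n); lra.
  case: (eqVneq (p u v) (p u' v')) => [E|n1]; first by left; apply: (chord_inj lay).
  case: (eqVneq (p v u) (p u' v')) => [E|n2].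
    by right; have [-> ->] := chord_inj lay vn un u'n v'n chC ch' E.
  have K1 := noncross_nat lay a_sym un vn u'n v'n ch ch'.
  have K2 := noncross_nat lay a_sym u'n v'n un vn ch' ch.
  have K3 := noncross_nat lay a_sym u'n v'n vn un ch' chC.
  have [_ ne] := chord_ends lay a_sym a_irr un vn ch.
  case: (eqVneq (p u v) (p v' u')) => [E|n3].
    by right; have [-> ->] := chord_inj lay un vn v'n u'n ch chC' E.
  case: (eqVneq (p v u) (p v' u')) => [E|n4].
    by left; have [-> ->] := chord_inj lay vn un v'n u'n chC chC' E.
  by exfalso; move: K1 K2 K3 dE ov n1 n2 n3 n4 ne; clear; lia.
Qed.

Lemma eset_meet u v u' v' z : (u < n)%N -> (v < n)%N -> (u' < n)%N -> (v' < n)%N ->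
  a u v -> a u' v' -> ~ ((u = u' /\ v = v') \/ (u = v' /\ v = u')) ->
  eset u v z -> eset u' v' z -> exists2 y, (y < n)%N & z = vpt y.
Proof.
move=> un vn u'n v'n auv auv' ne.
have same x c w x' w' : half u v x c w -> half u' v' x' c w' -> False.
  move=> h h'; have [xn wn] := half_ord un vn h; have [x'n w'n] := half_ord u'n v'n h'.
  case: h h' => t uv [t' uv']; have [ex ew] := target_inj lay xn wn x'n w'n t t'.
  by apply: ne; subst x' w'; case: uv => -[e1 e2]; case: uv' => -[e3 e4]; subst; [left|right|right|left].
have ft x y x' y' : (x < n)%N -> (y < n)%N -> (x' < n)%N -> (y' < n)%N ->
    (forall s c t s' t', half x y s c t -> half x' y' s' c t' -> False) ->
    forall s c t, half x y s c t -> fan s c z -> chord x' y' -> tops x' y' z -> False.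
  move=> xn yn x'n y'n sm s c t h F ch T; have [sn tn] := half_ord xn yn h.
  have ch' : chord y' x' by rewrite (chordC f l a_sym).
  case: (fan_tops x'n y'n sn tn h.1 ch F T) => -[cE _].
    by apply: (sm _ _ _ x' y' h); split; [right | left].
  by apply: (sm _ _ _ y' x' h); split; [right | right].
move=> /(eset_half un vn auv)[[x [c [w [h F]]]]|[ch T]] /(eset_half u'n v'n auv')[[x' [c' [w' [h' F']]]]|[ch' T']].
- have [xn wn] := half_ord un vn h; have [x'n w'n] := half_ord u'n v'n h'.
  apply: (fan_fan lay xn wn x'n w'n h.1 h'.1 _ F F').
  by move=> E; rewrite -E in h'; apply: same h h'.
- by case: (ft _ _ _ _ un vn u'n v'n same _ _ _ h F ch' T').
- have same' s c t s' t' : half u' v' s c t -> half u v s' c t' -> False by move=> h1 h2; apply: same h2 h1.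
  by case: (ft _ _ _ _ u'n v'n un vn same' _ _ _ h' F' ch T).
- by case: ne; apply: tops_disjoint T T'.
Qed.

Lemma half_interior u v x c w z0 : (u < n)%N -> (v < n)%N -> a u v -> half u v x c w -> fan x c z0 ->
  H (depth x) < z0.2 < H (depth x).+1 ->
  locally_line (kap x c) (eset u v `\` [set vpt u; vpt v]) z0.
Proof.
move=> un vn auv h F0 /andP[lo hi]; have [xn wn] := half_ord un vn h.
have [xc _] := target_cov lay xn wn h.1.
have nv y : (y < n)%N -> z0 <> vpt y.
  move=> yn E; have F := F0; rewrite E in F.
  have [_ _ _ bot top] := fan_facts xn xc F.
  case: (fan_vertex lay xn yn xc F) => [yx|cE].
    by move: lo; rewrite E yx /= ltxx.
  case: h.1 => [[P cE']|[C cE']]; last by have [_ _ /(_ _ yn)] := chordP lay xn wn C; rewrite -cE' cE.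
  have yw : y = w by apply: (f_inj lay) => //; rewrite -cE.
  by move: hi; rewrite E yw /= (depth_par lay xn wn P) ltxx.
(* The other pieces of the edge form a closed set that misses [z0]. Near [z0] the edge is thus the
   line of its fan. *)
pose O := if chord u v then tops u v `|` fan w (p w x) else set0.
have cO : closed O.
  rewrite /O; case: ifP => ch; last exact: closed0.
  apply: closedU; last exact: segment_closed.
  by rewrite (tops_segments un vn ch); repeat (apply: closedU); exact: segment_closed.
have EO z : eset u v z -> fan x c z \/ O z.
  move=> Ez; case ch : (chord u v); last first.
    case: (eset_half un vn auv Ez) => [[x' [c' [w' [h' F']]]]|[]]; last by rewrite ch.
    have nch' : chord v u = false by rewrite (chordC f l a_sym).
    case: h h' => [[[P ->]|[C _]] uv] [[[P' cE']|[C' _]] uv']; first last.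
    - by exfalso; case: uv C => -[-> ->]; rewrite ?ch ?nch'.
    - by exfalso; case: uv C => -[-> ->]; rewrite ?ch ?nch'.
    - by exfalso; case: uv' C' => -[-> ->]; rewrite ?ch ?nch'.
    left; suff [-> ->] : x = x' /\ w = w' by rewrite -cE'.
    have [ad nd _] := parP P; have [ad' _ _] := parP P'.
    case: uv uv' => -[xu wu] [] [xu' wu']; subst => //; by case: nd; apply: (anc_anti lay).
  have ch' : chord v u by rewrite (chordC f l a_sym).
  have [tc cE] : chord x w /\ c = p x w.
    case: h => -[[P _]|//] uv; exfalso; case: uv P => -[-> ->] P; move: ch ch'; rewrite /LayoutDefs.chord P ?orbT ?andbF //.
  move: Ez; rewrite eset_chord // /O ch; case: h.2 => -[xu wv]; rewrite cE xu wv.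
    by case=> [|[|]]; [left | right; left | right; right].
  by case=> [|[|]]; [right; right | right; left | left].
have nO : ~ O z0.
  rewrite /O; case: ifP => [ch|_ //]; case=> [T|F].
    case: (fan_tops un vn xn wn h.1 ch F0 T) => -[cE hz].
      have hu : half u v u c v by split; [right | left].
      by have [ex _] := target_inj lay xn wn un vn h.1 hu.1; rewrite ex in hi; lra.
    have ch' : chord v u by rewrite (chordC f l a_sym).
    have hu : target v c u by right.
    by have [ex _] := target_inj lay xn wn vn un h.1 hu; rewrite ex in hi; lra.
  have chx : chord x w /\ chord w x.
    by case: h.2 => -[-> ->]; rewrite ?(chordC f l a_sym vn un) ch.
  have tw : target w (p w x) x by right; split => //; exact: chx.2.
  have tx : target x (p x w) w by right; split => //; exact: chx.1.
  have cx : c = p x w.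
    case: h.1 => [[P _]|[_ ->]//]; by move: chx.1; rewrite /LayoutDefs.chord P andbF.
  have [xw pw] := chord_ends lay a_sym a_irr xn wn chx.1.
  have [y yn zy] := fan_fan lay xn wn wn xn tx tw pw (eq_rect _ (fun c => fan x c z0) F0 _ cx) F.
  exact: nv zy.
pose O' := O `|` ([set vpt u] `|` [set vpt v]).
have cO' : closed O' by apply: closedU => //; apply: closedU; apply: compact_closed; try exact: norm_hausdorff; exact: compact_set1.
have nO' : ~ O' z0 by case=> [//|[E|E]]; [apply: (nv u) | apply: (nv v)].
have [r r0 rO] := near_avoid cO' nO'.
exists (Num.min r (Num.min (z0.2 - H (depth x)) (H (depth x).+1 - z0.2))).
  by rewrite !lt_min r0 !subr_gt0 lo hi.
move=> z; rewrite !lt_min => /and3P[zr za zb]; have nOz := rO z zr.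
have [_ e0] := (fan_line z0 xn xc).1 F0.
have : `|z.2 - z0.2| <= `|z - z0| by rewrite [leRHS]prod_normE le_max lexx orbT.
rewrite ler_norml => /andP[d1 d2].
split.
  move=> [/EO[F _|Oz]]; last by case: nOz; left.
  by have [_ ->] := (fan_line z xn xc).1 F; rewrite e0; ring.
move=> E; split; last by case=> Ez; apply: nOz; right; [left|right].
apply: (half_fan_eset un vn h); apply/(fan_line z xn xc); split; first by apply/andP; split; lra.
have -> : z.1 = z0.1 + kap x c * (z.2 - z0.2) by lra.
by rewrite e0; ring.
Qed.

Lemma eset_arc u v : (u < n)%N -> (v < n)%N -> a u v -> Curves.arc (vpt u) (vpt v) (eset u v).
Proof.
move=> un vn auv; have H0 := H1_gt0 R n l; have S0 := Sr_gt0 R n.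
have uv : u <> v by move=> E; move: (a_irr un); rewrite {2}E auv.
case ch : (chord u v); last first.
  rewrite /eset /ebends ch /= setU0; apply: arc_segment => -[/(@Xr_inj R n)/(f_inj lay un vn)] //.
have ch' : chord v u by rewrite (chordC f l a_sym).
have [_ pne] := chord_ends lay a_sym a_irr un vn ch.
have [cu _] : cov u (p u v) /\ True by have [_ /topP[? _] _] := chordP lay un vn ch.
have [cv _] : cov v (p v u) /\ True by have [_ /topP[? _] _] := chordP lay vn un ch'.
have tu : target u (p u v) v by right.
have tv : target v (p v u) u by right.
have dTu := depth_Tr R f l p u v un; have dTv := depth_Tr R f l p u v vn.
have nX : X (p u v) <> X (p v u) by move=> /(@Xr_inj R n).
have HSu := HrS R n l (depth u); have HSv := HrS R n l (depth v).
rewrite /eset /ebends ch /= setU0.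
have s2 := stalk_segment un ch.
have s4 : segment (X (p v u), Tr u v) (X (p v u), H (depth v).+1) = [set z | z.1 = X (p v u) /\ H (depth v).+1 <= z.2 <= Tr u v].
  by rewrite segment_sym -(TrC R n l p u v) (stalk_segment vn ch').
have s5 : segment (X (p v u), H (depth v).+1) (vpt v) = fan v (p v u) by rewrite segment_sym.
have fT x c z : (x < n)%N -> cov x c -> fan x c z -> z.2 = Tr u v -> False.
  by move=> xn xc F zT; have [_ /andP[_ h] _ _ _] := fan_facts xn xc F; have := depth_Tr R f l p u v xn; lra.
have pr (z : R * R) x y : z.1 = x -> z.2 = y -> z = (x, y) by case: z => ? ? /= -> ->.
apply: (@arc_cat _ _ (X (p u v), H (depth u).+1)).
- by apply: arc_segment => -[_]; lra.
- apply: (@arc_cat _ _ (X (p u v), Tr u v)).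
  + by apply: arc_segment => -[]; lra.
  + apply: (@arc_cat _ _ (X (p v u), Tr u v)).
    * by apply: arc_segment => -[].
    * apply: (@arc_cat _ _ (X (p v u), H (depth v).+1)).
      - by apply: arc_segment => -[]; lra.
      - by apply: arc_segment => -[_]; lra.
      - rewrite s4 s5 => z [[z1 /andP[z2 z3]] F] /=; apply: pr => //.
        by have [_ /andP[_ h] _ _ _] := fan_facts vn cv F; lra.
    * rewrite s4 s5 => z [/horizontal_segment[z2 _] [[z1 _]|F]] /=; first exact: pr.
      by case: (fT _ _ _ vn cv F z2).
  + rewrite s2 s4 s5 => z [[z1 /andP[z2 z3]] [/horizontal_segment[h _]|[[h _]|F]]] /=.
    * exact: pr.
    * by case: nX; rewrite -z1.
    * by case: pne; rewrite (stalk_fan lay un vn vn un ch tv F z1 z2).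
- rewrite s2 s4 s5 -/(fan u (p u v)) => z [F [[z1 /andP[z2 z3]]|[/horizontal_segment[h _]|[[z1 /andP[z2 z3]]|F']]]] /=.
  + have [_ /andP[_ h] _ _ _] := fan_facts un cu F; apply: pr => //; lra.
  + by case: (fT _ _ _ un cu F h).
  + by case: pne; rewrite (stalk_fan lay vn un un vn ch' tu F z1 z2).
  + have [y yn zy] := fan_fan lay un vn vn un tu tv pne F F'; rewrite zy in F F'.
    have [_ _ nf] := chordP lay un vn ch; have [_ _ nf'] := chordP lay vn un ch'.
    case: (fan_vertex lay un yn cu F) => [yu|/(nf _ yn)//].
    case: (fan_vertex lay vn yn cv F') => [yv|/(nf' _ yn)//].
    by case: uv; rewrite -yu.
Qed.

End EdgeCurves.

End EdgePolylines.

(** * The number of chords, and of clusters containing a vertex *)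

Module CrossingCount.
Import MuRecursive LayoutDefs LayoutCode ClusterTrees LayoutArith Fans.
From mathcomp Require Import all_boot all_order all_algebra.
From mathcomp Require Import zify.

Set Implicit Arguments.
Unset Strict Implicit.
Unset Printing Implicit Defensive.

(* A chord is the longest one leaving its left end to the right, or the longest
   one leaving its right end to the left: otherwise two longer chords cross. *)
Lemma noncrossing_card N (S : {set 'I_N * 'I_N}) :
  {in S, forall e : 'I_N * 'I_N, e.1 < e.2} ->
  {in S &, forall e e' : 'I_N * 'I_N, ~ [/\ e.1 < e'.1, e'.1 < e.2 & e.2 < e'.2]} ->
  #|S| <= 2 * N.
Proof.
move=> lt nc.
pose right (e : 'I_N * 'I_N) := [forall e' in S, (e'.1 == e.1) ==> (e'.2 <= e.2)].
pose g (e : 'I_N * 'I_N) : 'I_N + 'I_N := if right e then inl e.1 else inr e.2.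
have longer e : ~~ right e -> exists2 e', e' \in S & e'.1 = e.1 /\ e.2 < e'.2.
  rewrite negb_forall => /existsP[e']; rewrite negb_imply => /andP[e'S].
  by rewrite negb_imply -ltnNge => /andP[/eqP E lt']; exists e'.
have leftmost e e' : e \in S -> e' \in S -> ~~ right e -> e.2 = e'.2 -> e.1 <= e'.1.
  move=> eS e'S /longer[e0 e0S [E lt0]] E2; rewrite leqNgt; apply/negP => lt1.
  have lte := lt e eS.
  by apply: (nc e' e0 e'S e0S); split; rewrite ?E -?E2.
have inj : {in S &, injective g}.
  move=> e e' eS e'S; rewrite /g; case: (boolP (right e)) => r; case: (boolP (right e')) => r' // [E].
  - suff E2 : e.2 = e'.2 by rewrite [e]surjective_pairing [e']surjective_pairing E E2.
    have h := forallP r e'; have h' := forallP r' e.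
    rewrite e'S E eqxx /= in h; rewrite eS E eqxx /= in h'.
    by apply/val_inj/eqP; rewrite eqn_leq; apply/andP; split.
  - suff E1 : e.1 = e'.1 by rewrite [e]surjective_pairing [e']surjective_pairing E E1.
    apply/val_inj/eqP; rewrite eqn_leq.
    by rewrite (leftmost e e' eS e'S r E) (leftmost e' e e'S eS r' (esym E)).
rewrite -(card_in_imset inj); apply: leq_trans (max_card _) _.
by rewrite card_sum !card_ord mul2n addnn.
Qed.

Section ChordCount.
Variables (n m : nat) (a mem : nat -> nat -> bool).
Variables (f l : nat -> nat) (p : nat -> nat -> nat).
Hypothesis lay : layout n m a mem f l p.
Hypothesis a_sym : forall u v, u < n -> v < n -> a u v = a v u.
Hypothesis a_irr : forall u, u < n -> ~~ a u u.

Local Notation cov := (cov f l).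
Local Notation chord := (chord n a f l).
Local Notation top := (LayoutDefs.top n f l).

(** As [f w <= l w], this is 0 before the interval of [w], 1 inside and 2 after it; it is monotone
    in [c] and shows whether [w] covers [c]. *)
Definition tick c w := (f w <= c) + (l w < c).

(* The columns fall into at most 2n+1 blocks, cut at the values of f and l; the
   set of vertices covering a column depends only on its block. *)
Definition block c := \sum_(w < n) tick c w.

Lemma tick_le c c' w : c <= c' -> tick c w <= tick c' w.
Proof.
by move=> h; apply: leq_add; [case: (leqP (f w) c) => // h1 | case: (ltnP (l w) c) => // h1];
  rewrite (leq_trans h1 h).
Qed.

Lemma block_le c c' : c <= c' -> block c <= block c'.
Proof. by move=> h; apply: leq_sum => w _; exact: tick_le. Qed.

Lemma block_bound c : block c < (2 * n).+1.
Proof.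
rewrite ltnS; apply: (@leq_trans (\sum_(w < n) 2)); last by rewrite sum_nat_const card_ord mulnC.
by apply: leq_sum => w _; exact: (leq_add (leq_b1 _) (leq_b1 _)).
Qed.

Lemma block_cov c c' w : w < n -> c <= c' -> block c = block c' -> cov w c = cov w c'.
Proof.
have D c0 (wn : w < n) : block c0 = tick c0 w + \sum_(i < n | i != Ordinal wn) tick c0 i.
  by rewrite /block (bigD1 (Ordinal wn)).
move=> wn h; rewrite !(D _ wn) => E.
have rest : \sum_(i < n | i != Ordinal wn) tick c i <= \sum_(i < n | i != Ordinal wn) tick c' i.
  by apply: leq_sum => i _; exact: tick_le.
have : tick c w = tick c' w.
  apply/eqP; rewrite eqn_leq tick_le //=.
  by rewrite -(leq_add2r (\sum_(i < n | i != Ordinal wn) tick c i)) E leq_add2l.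
rewrite /tick /LayoutDefs.cov.
by case: (leqP (f w) c); case: (leqP (f w) c'); case: (ltnP (l w) c); case: (ltnP (l w) c') => //=; lia.
Qed.

(** Columns of one block are covered by the same vertices, so their tops are ancestors of each
    other. *)
Lemma block_owner u v c c' : u < n -> v < n -> top c u -> top c' v -> block c = block c' -> u = v.
Proof.
wlog h : u v c c' / c <= c'.
  move=> W un vn tu tv E; case: (leqP c c') => [h|/ltnW h]; first exact: (W u v c c').
  by symmetry; apply: (W v u c' c).
move=> un vn /topP[cu tu] /topP[cv tv] E.
have cE w : w < n -> cov w c = cov w c' by move=> wn; apply: block_cov.
apply: (anc_anti lay) => //; first by apply: tv => //; rewrite -(cE u un).
by apply: tu => //; rewrite (cE v vn).
Qed.

(** Chords are oriented to the right and sent to the blocks of their columns. By [block_owner] the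
    blocks determine both ends and are different, and the pairs inherit noncrossing as [block] is
    monotone; the bound is twice the number [2n + 1] of blocks. *)
Lemma chord_card : #|[set e : 'I_n * 'I_n | (e.1 < e.2) && chord e.1 e.2]| <= 4 * n + 2.
Proof.
set E := [set e | _].
pose o (e : 'I_n * 'I_n) := if p e.1 e.2 < p e.2 e.1 then e else (e.2, e.1).
have oP e : e \in E -> [/\ chord (o e).1 (o e).2, p (o e).1 (o e).2 < p (o e).2 (o e).1 &
    (o e).1 != (o e).2].
  rewrite inE => /andP[lt ch].
  have [_ ne] := chord_ends lay a_sym a_irr (ltn_ord _) (ltn_ord _) ch.
  have neo : e.1 != e.2 by apply: contraTneq lt => ->; rewrite ltnn.
  rewrite /o; case: ltnP => h /=; split => //.
  - by rewrite (chordC f l a_sym).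
  - by rewrite ltn_neqAle h andbT; apply/eqP => E1; apply: ne.
  - by rewrite eq_sym.
have oI : {in E &, injective o}.
  move=> [x y] [x' y']; rewrite !inE /= => /andP[lt _] /andP[lt' _]; rewrite /o /=.
  by case: ifP => _; case: ifP => _ [Ex Ey];
    first [by rewrite Ex Ey | by exfalso; move: lt; rewrite Ex Ey ltnNge (ltnW lt')].
have topo e : e \in E -> top (p (o e).1 (o e).2) (o e).1 /\ top (p (o e).2 (o e).1) (o e).2.
  move=> /oP[ch _ _]; have ch' : chord (o e).2 (o e).1 by rewrite (chordC f l a_sym).
  have [_ t1 _] := chordP lay (ltn_ord _) (ltn_ord _) ch.
  by have [_ t2 _] := chordP lay (ltn_ord _) (ltn_ord _) ch'.
pose b (e : 'I_n * 'I_n) : 'I_(2 * n).+1 * 'I_(2 * n).+1 :=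
  (inord (block (p (o e).1 (o e).2)), inord (block (p (o e).2 (o e).1))).
have bv c : nat_of_ord (inord (block c) : 'I_(2 * n).+1) = block c by rewrite inordK ?block_bound.
have bI : {in E &, injective b}.
  move=> e e' eE e'E Eb; have B1 := congr1 (fun q => nat_of_ord q.1) Eb.
  have B2 := congr1 (fun q => nat_of_ord q.2) Eb; rewrite /b /= !bv in B1 B2.
  have [t1 t2] := topo _ eE; have [t1' t2'] := topo _ e'E.
  have U := block_owner (ltn_ord _) (ltn_ord _) t1 t1' B1.
  have V := block_owner (ltn_ord _) (ltn_ord _) t2 t2' B2.
  apply: oI => //; clear -U V.
  by case: (o e) (o e') U V => [x y] [x' y'] /= U V; congr (_, _); exact: val_inj.
rewrite -(card_in_imset bI) (_ : 4 * n + 2 = 2 * (2 * n).+1); last by lia.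
apply: noncrossing_card.
- move=> _ /imsetP[e eE ->]; have [ch lt ne] := oP _ eE; have [t1 t2] := topo _ eE.
  rewrite /b /= !bv ltn_neqAle block_le ?(ltnW lt) // andbT; apply/eqP => B.
  have U := block_owner (ltn_ord _) (ltn_ord _) t1 t2 B.
  by case/eqP: ne; apply: val_inj.
- move=> _ _ /imsetP[e eE ->] /imsetP[e' e'E ->]; rewrite /b /= !bv => -[l1 l2 l3].
  have inc c c' : block c < block c' -> c < c' by rewrite !ltnNge; apply: contra; exact: block_le.
  have [ch _ _] := oP _ eE; have [ch' _ _] := oP _ e'E.
  have := noncross_nat lay a_sym (ltn_ord _) (ltn_ord _) (ltn_ord _) (ltn_ord _) ch ch'.
  by move: (inc _ _ l1) (inc _ _ l2) (inc _ _ l3); clear; lia.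
Qed.

End ChordCount.

Section ClusterCount.
Variables (n m : nat) (C : cgraph n m).

(** The clusters of a vertex form a chain, so their cardinalities, at most [n], are distinct. *)
Lemma clusters_at_card v : #|[set k | v \in vcluster C k]| <= n.+1.
Proof.
pose g (k : 'I_m) : 'I_n.+1 := inord #|vcluster C k|.
have memE k : (k \in [set k | v \in vcluster C k]) = (v \in vcluster C k) by rewrite [LHS]in_set.
have gv k : nat_of_ord (g k) = #|vcluster C k|.
  by rewrite inordK // ltnS; apply: leq_trans (max_card _) _; rewrite card_ord.
have inj : {in [set k | v \in vcluster C k] &, injective g}.
  move=> k j; rewrite !memE => vk vj /(congr1 (@nat_of_ord _)); rewrite !gv => E.
  apply: (@cgraph_inj _ _ C); change (vcluster C k = vcluster C j).
  case: (vcluster_chain vk vj) => /ancestor_subset sub; apply/eqP.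
    by rewrite eq_sym eqEcard sub E leqnn.
  by rewrite eqEcard sub E leqnn.
by rewrite -(card_in_imset inj); apply: leq_trans (max_card _) _; rewrite card_ord.
Qed.

(** In the chain of clusters at [v], being the root is an injective property: of two others, one
    would contain the other. *)
Lemma flat_clusters_at_card v : flat C -> #|[set k | v \in vcluster C k]| <= 2.
Proof.
move=> fl; pose g (k : 'I_m) := parent C (inr k) == None.
have memE k : (k \in [set k | v \in vcluster C k]) = (v \in vcluster C k) by rewrite [LHS]in_set.
have rootP k j : parent C (inr j) = None -> ancestor (parent C) k (inr j) -> j = k.
  move=> pj /connectP[[|y q] /=]; first by move=> _ [->].
  by case: y => //= k'; rewrite pj.
have inj : {in [set k | v \in vcluster C k] &, injective g}.
  move=> k j; rewrite !memE => vk vj; rewrite /g.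
  case: (eqVneq (parent C (inr k)) None) => pk; case: (eqVneq (parent C (inr j)) None) => pj // _.
    by case: (vcluster_chain vk vj) => an; [symmetry; apply: rootP pj an | apply: rootP pk an].
  case: (vcluster_chain vk vj) => /ancestor_subset sub.
    by symmetry; apply: (fl k j) => //; exact/eqP.
  by apply: (fl j k) => //; exact/eqP.
by rewrite -(card_in_imset inj); apply: leq_trans (max_card _) _; rewrite card_bool.
Qed.

End ClusterCount.

End CrossingCount.

(** * Every layout gives a drawing with the required crossing numbers *)

Module Soundness.
Import MuRecursive LayoutDefs LayoutCode ClusterTrees Curves UnderGraphs LayoutArith ClusterPolygons Regions Fans FanCrossings EdgePolylines CrossingCount.
From mathcomp Require Import all_boot all_order all_algebra.
From mathcomp Require Import all_classical all_reals all_analysis.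
From mathcomp Require Import zify ring lra.

Set Implicit Arguments.
Unset Strict Implicit.
Unset Printing Implicit Defensive.
Import Order.TTheory GRing.Theory Num.Theory.
Import numFieldNormedType.Exports.
Local Open Scope classical_set_scope.
Local Open Scope ring_scope.

Section SmallSets.
Variable R : realType.
Implicit Types (A : set (R * R)) (x y : R * R).
Local Open Scope card_scope.

Lemma card_empty A : (forall z, ~ A z) -> A #= `I_0.
Proof.
move=> A0; rewrite card_eq_sym; apply/card_set_bijP; exists (fun=> 0).
by split=> [i|i j /set_mem|z /A0].
Qed.

Lemma card_none : @set0 (R * R) #= `I_0.
Proof. by apply: card_empty => z h; exact: h. Qed.

Lemma card_singleton x : [set x] #= `I_1.
Proof.
rewrite card_eq_sym; apply/card_set_bijP; exists (fun=> x); split=> [i _ //|i j|z ->].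
  by move=> /set_mem /= i1 /set_mem /= j1 _; move: i j i1 j1 => [|i] [|j].
by exists 0%N.
Qed.

Lemma card_pair x y : x <> y -> [set x; y] #= `I_2.
Proof.
move=> ne; rewrite card_eq_sym; apply/card_set_bijP.
exists (fun i : nat => if i == 0%N then x else y); split.
- by move=> i _ /=; case: eqP => _; [left|right].
- move=> i j /set_mem /= i2 /set_mem /= j2.
  by move: i j i2 j2 => [|[|i]] [|[|j]] //= _ _ E; case: ne.
- by move=> z [->|->]; [exists 0%N | exists 1%N].
Qed.

End SmallSets.

Section Soundness.
Variables (R : realType) (n m : nat) (C : cgraph n m).
Variables (f l : nat -> nat) (p : nat -> nat -> nat).
Local Notation adjm := (adjC C).
Local Notation memm := (memC C).
Hypothesis lay : layout n m adjm memm f l p.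

Local Notation D := (realize R (layout_drawing n m adjm memm f l p)).
Local Notation vpt := (vpt R n f l).
Local Notation eset := (@eset R n adjm f l p).
Local Notation bord := (@bord R n memm f l).
Local Notation reg := (@reg R n memm f l).
Local Notation fan := (@fan R n f l).
Local Notation tops := (@tops R n f l p).
Local Notation kap := (kap R n f l).
Local Notation chord := (LayoutDefs.chord n adjm f l).
Local Notation par := (LayoutDefs.par n f l).
Local Notation target := (target n adjm f l p).
Local Notation half := (EdgePolylines.half n adjm f l p).
Local Notation H j := (Hr R n l j).
Local Notation depth := (depth n f l).

Lemma adjm_sym u v : (u < n)%N -> (v < n)%N -> adjm u v = adjm v u.
Proof.
move=> un vn; have E1 := adjC_ord C (Ordinal un) (Ordinal vn).
have E2 := adjC_ord C (Ordinal vn) (Ordinal un); rewrite /= in E1 E2.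
by rewrite E1 E2 cgraph_sym.
Qed.

Lemma adjm_irr u : (u < n)%N -> ~~ adjm u u.
Proof.
move=> un; have E := adjC_ord C (Ordinal un) (Ordinal un); rewrite /= in E.
by rewrite E cgraph_irr.
Qed.

Lemma dpointE v : dpoint D v = vpt v.
Proof. exact: rat_natpt. Qed.

Lemma dcurveE (u v : 'I_n) : dcurve D (u, v) = eset u v `\` [set vpt u; vpt v].
Proof.
have E : map (rat_point R) (bends (layout_drawing n m adjm memm f l p) u v) = ebends R n adjm f l p u v.
  by rewrite /ebends /=; case: ifP => // _ /=; rewrite !rat_natpt.
by rewrite /EdgePolylines.eset -E -!dpointE.
Qed.

Lemma dborderE k : dborder D k = bord k.
Proof. exact: (polygon_border R lay (ltn_ord k)).1. Qed.

Lemma regionE k : region D k = reg k.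
Proof. by rewrite /region dborderE; exact: (reg_enclosed R lay (ltn_ord k)). Qed.

Lemma edgeP e : e \in edges (adj C) -> (e.1 < e.2)%N /\ adjm e.1 e.2.
Proof. by rewrite inE => /andP[lt ad]; rewrite adjC_ord. Qed.

Lemma edges_disjoint e e' z : e \in edges (adj C) -> e' \in edges (adj C) -> e <> e' ->
  dcurve D e z -> dcurve D e' z -> False.
Proof.
case: e e' => [u v] [u' v'] /edgeP[lt auv] /edgeP[lt' auv'] ne; rewrite !dcurveE => -[E1 N1] [E2 N2].
have [y yn zy] : exists2 y, (y < n)%N & z = vpt y.
  apply: (eset_meet lay adjm_sym adjm_irr (ltn_ord u) (ltn_ord v) (ltn_ord u') (ltn_ord v') auv auv' _ E1 E2).
  case=> -[h1 h2]; first by apply: ne; congr (_, _); exact: val_inj.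
  by move: lt lt'; rewrite /= h1 h2 ltnNge => /negP h /ltnW.
rewrite zy in E1 N1.
case: (eset_vertex lay adjm_sym (ltn_ord u) (ltn_ord v) yn auv E1) => yE; apply: N1; rewrite yE.
  by left.
by right.
Qed.

Lemma memm_subset (j k : 'I_m) : vcluster C j \subset vcluster C k ->
  forall v, (v < n)%N -> memm v j -> memm v k.
Proof.
move=> sub v vn; have E1 := memC_ord C (Ordinal vn) j; have E2 := memC_ord C (Ordinal vn) k.
by rewrite /= in E1 E2; rewrite E1 E2; exact: (fintype.subsetP sub).
Qed.

Lemma size_vcluster (k : 'I_m) : size_ n memm k = #|vcluster C k|.
Proof.
rewrite /size_ /bsum -sum1_card [RHS]big_mkcond /=; apply: eq_bigr => u _.
by rewrite memC_ord; case: (u \in _).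
Qed.

Lemma size_proper (k j : 'I_m) : k <> j -> vcluster C j \subset vcluster C k ->
  (size_ n memm j < size_ n memm k)%N.
Proof.
move=> ne sub; rewrite !size_vcluster; apply: proper_card; rewrite finset.properEneq sub andbT.
by apply/eqP => E; apply: ne; apply: (@cgraph_inj _ _ C); exact: (esym E).
Qed.

Lemma nested_reg (k j : 'I_m) z : ancestor (parent C) k (inr j) -> k <> j ->
  reg j z -> reg k z /\ ~ bord k z.
Proof.
move=> an ne; have sub := ancestor_subset an.
exact: (reg_nested lay (ltn_ord k) (ltn_ord j) (memm_subset sub) (size_proper ne sub)).
Qed.

Lemma incomparable_reg (k j : 'I_m) z : ~~ ancestor (parent C) k (inr j) ->
  ~~ ancestor (parent C) j (inr k) -> reg k z -> reg j z -> False.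
Proof.
move=> n1 n2; apply: (reg_disjoint lay (ltn_ord k) (ltn_ord j)) => v vn.
have E1 := memC_ord C (Ordinal vn) j; have E2 := memC_ord C (Ordinal vn) k.
rewrite /= in E1 E2; rewrite E1 E2 => vj; apply/negP => vk.
by case: (vcluster_chain vk vj) => h; [move: n1 | move: n2]; rewrite h.
Qed.

Lemma borders_disjoint (k j : 'I_m) z : k <> j -> bord k z -> bord j z -> False.
Proof.
move=> ne bk bj; have rk := bord_reg lay (ltn_ord k) bk; have rj := bord_reg lay (ltn_ord j) bj.
case A1 : (ancestor (parent C) k (inr j)); first by have [_] := nested_reg A1 ne rj.
case A2 : (ancestor (parent C) j (inr k)).
  by have [_] := nested_reg A2 (fun E => ne (esym E)) rk.
exact: (incomparable_reg (negbT A1) (negbT A2) rk rj).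
Qed.

Lemma edge_border (u v : 'I_n) (k : 'I_m) z : adjm u v -> dcurve D (u, v) z -> bord k z ->
  exists x c w, [/\ half u v x c w, fan x c z, H (depth x) < z.2 < H (depth x).+1
    & locally_horizontal (bord k) z].
Proof.
move=> auv; rewrite dcurveE => -[E _] b.
case: (eset_half lay adjm_sym (ltn_ord u) (ltn_ord v) auv E) => [[x [c [w [h F]]]]|[ch T]]; last first.
  by case: (tops_reg lay adjm_sym (ltn_ord u) (ltn_ord v) (ltn_ord k) ch T (bord_reg lay (ltn_ord k) b)).
have [xn wn] := half_ord (ltn_ord u) (ltn_ord v) h.
have [B1 B2] := fan_border R lay xn wn (ltn_ord k) h.1.
case: (eqVneq (memm x k) (par x w && memm w k)) => [/B1/(_ z F)//|/eqP/B2[z0 [F0 b0 uq lh hz]]].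
by exists x, c, w; rewrite -(uq z F b) in lh hz.
Qed.

Lemma edge_border_alternate e k z : e \in edges (adj C) -> dcurve D e z -> dborder D k z ->
  [/\ isolated (dcurve D e `&` dborder D k) z, alternate (dcurve D e) (dborder D k) z,
      isolated (dborder D k `&` dcurve D e) z & alternate (dborder D k) (dcurve D e) z].
Proof.
case: e => [u v] /edgeP[lt auv] zc zb; rewrite dborderE in zb *.
have [x [c [w [h F hz lh]]]] := edge_border auv zc zb.
have ll := half_interior lay adjm_sym adjm_irr (ltn_ord u) (ltn_ord v) auv h F hz.
rewrite -dcurveE in ll; have [a1 a2 i1] := crossing_lines lh ll.
by split => //; rewrite setIC.
Qed.

Lemma curves_meet i j z : is_curve C i -> is_curve C j -> i <> j ->
  curves D i z -> curves D j z ->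
  [/\ isolated (curves D i `&` curves D j) z, alternate (curves D i) (curves D j) z
    & exists e k, (i = inl e /\ j = inr k) \/ (i = inr k /\ j = inl e)].
Proof.
case: i => [e|k]; case: j => [e'|k'] ci cj ne zi zj.
- by exfalso; apply: (edges_disjoint ci cj _ zi zj) => E; apply: ne; rewrite E.
- have [h1 h2 _ _] := edge_border_alternate ci zi zj; split; [exact: h1 | exact: h2 |].
  by exists e, k'; left.
- have [_ _ h1 h2] := edge_border_alternate cj zj zi; split; [exact: h1 | exact: h2 |].
  by exists e', k; right.
- have bk : dborder D k z := zi; have bk' : dborder D k' z := zj.
  rewrite dborderE in bk; rewrite dborderE in bk'; exfalso.
  by apply: (borders_disjoint _ bk bk') => E; apply: ne; rewrite E.
Qed.

Lemma layout_is_drawing : is_drawing C D.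
Proof.
split.
- split.
  + move=> u v; rewrite !dpointE /Fans.vpt => -[/(@Xr_inj R n)/(f_inj lay (ltn_ord u) (ltn_ord v)) h _].
    exact: val_inj.
  + move=> [u v] /edgeP[lt auv]; rewrite !dpointE dcurveE; apply: arc_open.
    exact: (eset_arc R lay adjm_sym adjm_irr (ltn_ord u) (ltn_ord v) auv).
  + move=> [u v] w /edgeP[lt auv]; rewrite dpointE dcurveE => -[E N].
    case: (eset_vertex lay adjm_sym (ltn_ord u) (ltn_ord v) (ltn_ord w) auv E) => wE.
      by apply: N; left; rewrite /= wE.
    by apply: N; right; rewrite /= wE.
- by move=> k; rewrite dborderE; exact: (polygon_border R lay (ltn_ord k)).2.
- by move=> k v; rewrite regionE dpointE -memC_ord; exact: (vertex_reg R lay (ltn_ord k) (ltn_ord v)).1.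
- by move=> k v; rewrite dborderE dpointE; exact: (vertex_reg R lay (ltn_ord k) (ltn_ord v)).2.
- move=> k j an; rewrite !regionE; case: (eqVneq k j) => [->//|/eqP ne] z rj.
  exact: (nested_reg an ne rj).1.
- by move=> i j ci cj ne z [zi zj]; have [] := curves_meet ci cj ne zi zj.
- by move=> i j ci cj ne z [zi zj]; have [] := curves_meet ci cj ne zi zj.
- move=> i j k ci cj ck ij ik jk; apply/seteqP; split => z // -[[zi zj] zk].
  have [_ _ [e1 [k1 h1]]] := curves_meet ci cj ij zi zj.
  have [_ _ [e2 [k2 h2]]] := curves_meet ci ck ik zi zk.
  have [_ _ [e3 [k3 h3]]] := curves_meet cj ck jk zj zk.
  by destruct h1 as [[]|[]], h2 as [[]|[]], h3 as [[]|[]]; congruence.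
Qed.

(** Halving leaves 1 exactly for a chord with both ends in the cluster, and 0 in all other cases. *)
Definition crossings (e : 'I_n * 'I_n) (k : 'I_m) : nat :=
  if chord e.1 e.2 then (memm e.1 k + memm e.2 k)%N else memm e.1 k != memm e.2 k.

Lemma fan_bordE x c w (k : 'I_m) : (x < n)%N -> (w < n)%N -> target x c w ->
  exists z0, fan x c `&` bord k = if memm x k != (par x w && memm w k) then [set z0] else set0.
Proof.
move=> xn wn t; have [B1 B2] := fan_border R lay xn wn (ltn_ord k) t.
case: (eqVneq (memm x k) (par x w && memm w k)) => [/B1 h|/eqP/B2[z0 [F b uq _ _]]].
  by exists 0; apply/seteqP; split => z // -[F b]; have := h z F b.
by exists z0; apply/seteqP; split => z; [case=> F' b'; exact: uq | move=> ->].
Qed.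

Local Open Scope card_scope.

Lemma crossings_card (u v : 'I_n) (k : 'I_m) : adjm u v ->
  dcurve D (u, v) `&` bord k #= `I_(crossings (u, v) k).
Proof.
move=> auv; rewrite dcurveE /crossings [(u, v).1]/= [(u, v).2]/=.
have [un vn km] : [/\ (u < n)%N, (v < n)%N & (k < m)%N] by [].
have nb y : (y < n)%N -> ~ bord k (vpt y) by move=> yn; exact: (vertex_reg R lay km yn).2.
have -> : (eset u v `\` [set vpt u; vpt v]) `&` bord k = eset u v `&` bord k.
  apply/seteqP; split => z [E b]; first by case: E.
  by split => //; split => // -[] zE; move: b; rewrite zE; apply: nb.
case: (boolP (chord u v)) => ch; last first.
  case: (edge_cases f l un vn auv) => [P|P|ch']; last by rewrite ch' in ch.
    rewrite (eset_par R lay un vn P).1.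
    have [z0 ->] := fan_bordE k un vn (or_introl (conj P erefl)); rewrite P andTb.
    by case: (memm u k); case: (memm v k); rewrite /=; (exact: card_singleton || exact: card_none).
  rewrite (eset_par R lay vn un P).2.
  have [z0 ->] := fan_bordE k vn un (or_introl (conj P erefl)); rewrite P andTb.
  by case: (memm u k); case: (memm v k); rewrite /=; (exact: card_singleton || exact: card_none).
have ch' : chord v u by rewrite (chordC f l adjm_sym).
have [_ pne] := chord_ends lay adjm_sym adjm_irr un vn ch.
have tu : target u (p u v) v by right.
have tv : target v (p v u) u by right.
have EC : eset u v = fan u (p u v) `|` (tops u v `|` fan v (p v u)).
  by apply: eset_chord => //; first [exact: adjm_sym | exact: lay].
have -> : eset u v `&` bord k = (fan u (p u v) `&` bord k) `|` (fan v (p v u) `&` bord k).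
  rewrite EC; apply/seteqP; split => z.
    case=> -[F|[T|F]] b; [by left | | by right].
    by case: (tops_reg lay adjm_sym un vn km ch T (bord_reg lay km b)).
  by case=> -[F b]; split => //; [left | right; right].
have dis z : (fan u (p u v) `&` bord k) z -> (fan v (p v u) `&` bord k) z -> False.
  move=> [F b] [F' _]; have [y yn zy] := fan_fan lay un vn vn un tu tv pne F F'.
  by move: b; rewrite zy; apply: nb.
have [pu pv] : par u v = false /\ par v u = false.
  by move: ch; rewrite /LayoutDefs.chord negb_or => /and3P[_ /negbTE h1 /negbTE h2].
move: dis; have [z0 ->] := fan_bordE k un vn tu; have [z1 ->] := fan_bordE k vn un tv.
rewrite pu pv !andFb; case: (memm u k); case: (memm v k); rewrite /= ?setU0 ?set0U => dis.
- by apply: card_pair => E; apply: (dis z0) => //=; rewrite E.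
- exact: card_singleton.
- exact: card_singleton.
- exact: card_none.
Qed.

Lemma components_reg (k : 'I_m) : components (reg k) #= `I_1.
Proof.
have [rn rk _ _] := crootP lay (ltn_ord k).
have rin : reg k (vpt (croot n memm f l k)) by apply: (vertex_reg R lay (ltn_ord k) rn).1.2.
have cc z : reg k z -> connected_component (reg k) z = reg k.
  move=> rz; apply/seteqP; split; first exact: connected_component_sub.
  by apply: connected_component_max => //; exact: (reg_connected (R := R) lay (ltn_ord k)).
rewrite card_eq_sym; apply/card_set_bijP; exists (fun=> reg k); split=> [i _|i j|A [z rz <-]].
- by exists (vpt (croot n memm f l k)) => //; exact: cc.
- by move=> /set_mem /= i1 /set_mem /= j1 _; move: i j i1 j1 => [|i] [|j].
- by exists 0%N => //; rewrite cc.
Qed.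

(** A chord contributes at most 1 for each cluster that contains its first end. *)
Lemma crossings_sum M : (forall v, #|[set k | v \in vcluster C k]%SET| <= M)%N ->
  (\sum_(e in edges (adj C)) \sum_(k < m) (crossings e k)./2 <= (4 * n + 2) * M)%N.
Proof.
move=> HM; apply: (@leq_trans (\sum_(e in edges (adj C)) (if chord e.1 e.2 then M else 0))).
  apply: leq_sum => e _; case: ifP => ch; last first.
    by rewrite big1 // => k _; rewrite /crossings ch; case: (_ != _).
  apply: leq_trans (HM e.1); rewrite -sum1_card [leqRHS]big_mkcond /=; apply: leq_sum => k _.
  rewrite finset.in_set -memC_ord /crossings ch.
  by case: (memm e.1 k); case: (memm e.2 k).
apply: (@leq_trans (\sum_(e in [set e : 'I_n * 'I_n | (e.1 < e.2)%N && chord e.1 e.2]%SET) M)).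
  rewrite big_mkcond [leqRHS]big_mkcond /=; apply: leq_sum => e _; rewrite !finset.in_set.
  by case: (e.1 < e.2)%N; case: (adj C _ _); case: (chord e.1 e.2).
by rewrite sum_nat_const leq_mul2r (chord_card lay adjm_sym adjm_irr) orbT.
Qed.

Lemma layout_abc_drawing : exists beta,
  [/\ abc_drawing C 0 beta 0 D, (beta <= 12 * n ^ 2)%N & flat C -> (beta <= 12 * n)%N].
Proof.
(* For positive [n], [4n + 2 <= 6n] and [n + 1 <= 2n] give the factor 12; in the flat case
   [2 * (4n + 2) <= 12n]. *)
have n0 := cgraph_order_gt0 C.
exists (\sum_(e in edges (adj C)) \sum_(k < m) (crossings e k)./2)%N; split.
- split; first exact: layout_is_drawing.
  + apply: card_empty => z [e [e' [eE e'E ne ze ze']]].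
    exact: (edges_disjoint eE e'E ne ze ze').
  + exists crossings => // -[u v] k /edgeP[lt auv]; rewrite dborderE.
    exact: crossings_card.
  (* Regions of incomparable clusters are disjoint, so each difference is a whole region and has one
     component. *)
  + exists (fun _ _ => 1%N) => [k j /andP[n1 n2]|]; last first.
      by symmetry; apply: big1 => k _; apply: big1.
    rewrite !regionE.
    have -> : reg k `\` reg j = reg k.
      apply/seteqP; split => z; first by case.
      by move=> h; split => // h'; exact: (incomparable_reg n1 n2 h h').
    exact: components_reg.
- apply: leq_trans (crossings_sum (@clusters_at_card _ _ C)) _.
  apply: (@leq_trans ((6 * n) * (2 * n))%N); first by apply: leq_mul; move: n0; clear; lia.
  by rewrite mulnACA mulnn.
- move=> fl; apply: leq_trans (crossings_sum (fun v => flat_clusters_at_card v fl)) _.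
  by move: n0; clear; lia.
Qed.

End Soundness.

End Soundness.

Theorem theorem3 (R : realType) :
  exists (A : murec) (c : nat),
  forall (n m : nat) (C : cgraph n m),
    c_connected C -> planar R (adj C) ->
    exists (P : polydrawing n m) (beta : nat),
      [/\ computes A (cgraph_code C) (polydrawing_code P),
          abc_drawing C 0 beta 0 (realize R P),
          (beta <= c * n ^ 2)%N
        & flat C -> (beta <= c * n)%N].
Proof.
have [A HA] := LayoutCode.layout_program; exists A, 12%N => n m C cc pl.
have [B [W gm]] := PlanarToGrid.planar_grid_model (@cgraph_sym _ _ C) (@cgraph_irr _ _ C) pl.
have [f [l [p [lay comp]]]] := HA n m C (ClusterTrees.layout_exists cc gm).
have [beta [abc b1 b2]] := Soundness.layout_abc_drawing R lay.
by exists (LayoutCode.layout_drawing n m (LayoutCode.adjC C) (LayoutCode.memC C) f l p), beta; split.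
Qed.
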